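(* For any normal domain $\Omega\subset\mathbb{R}^n$ there exists a normal domain $\Omega'\subset\mathbb{R}^n$ such that $\Omega$ is Dirichlet-subspectral to $\Omega'$ but $\Omega'$ does not embed isometrically in $\Omega$.
   Context: A normal domain in $\mathbb{R}^n$ is a compact codimension zero submanifold with piecewise smooth, Lipschitz boundary. The Dirichlet Laplacian on $\Omega$ is the Friedrichs extension in $L^2(\Omega)$ of $-\sum_i\partial_i^2$ on smooth functions supported away from $\partial\Omega$; $N_\Omega(x)$ is the number of its eigenvalues $\le x$, with multiplicity. $\Omega$ is Dirichlet-subspectral to $\Omega'$ if $N_\Omega(x)\ge N_{\Omega'}(x)$ for all $x$. *)

(* Defs.v *)
From HB Require Import structures.
From mathcomp Require Import all_boot all_order all_algebra.
From mathcomp Require Import all_classical all_reals all_analysis.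

Set Implicit Arguments.
Unset Strict Implicit.
Unset Printing Implicit Defensive.
Import Order.TTheory GRing.Theory Num.Theory.
Import numFieldNormedType.Exports.

Local Open Scope classical_set_scope.
Local Open Scope ring_scope.

(* R^n is 'rV[R]_n.  It carries the product sigma-algebra generated by the
   coordinates (which is its Borel sigma-algebra). *)
Section measurable_rV.
Context {R : realType} {n : nat}.

Definition rV_coord (i : 'I_n) (x : 'rV[R]_n) : measurableTypeR R := x ord0 i.

Let rV_set0 : g_sigma_preimage rV_coord set0.
Proof. exact: sigma_algebra0. Qed.

Let rV_setC A : g_sigma_preimage rV_coord A -> g_sigma_preimage rV_coord (~` A).
Proof. exact: sigma_algebraC. Qed.

Let rV_bigcup (F : (set 'rV[R]_n)^nat) :
  (forall i, g_sigma_preimage rV_coord (F i)) ->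
  g_sigma_preimage rV_coord (\bigcup_i F i).
Proof. exact: sigma_algebra_bigcup. Qed.

HB.instance Definition _ := @isMeasurable.Build default_measure_display
  'rV[R]_n (g_sigma_preimage rV_coord) rV_set0 rV_setC rV_bigcup.

Lemma measurable_rV_coord (i : 'I_n) :
  measurable_fun [set: 'rV[R]_n] (rV_coord i).
Proof.
move=> _ Y mY; rewrite setTI; apply: sub_sigma_algebra => /=.
rewrite -bigcup_seq/=; exists i => /=; first by rewrite mem_index_enum.
by exists Y => //; rewrite setTI.
Qed.

Lemma measurable_fun_rVP d (T : measurableType d) (f : T -> 'rV[R]_n) :
  measurable_fun [set: T] f <->
  forall i, measurable_fun [set: T] (rV_coord i \o f).
Proof.
split=> [mf i|mf]; first by apply: measurableT_comp => //; exact: measurable_rV_coord.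
move=> _ A mA; rewrite setTI.
suff : g_sigma_preimage (fun i => rV_coord i \o f) `<=` measurable.
  by apply; rewrite g_sigma_preimage_comp; exists A => //; rewrite setTI.
apply: smallest_sub; first exact: sigma_algebra_measurable.
rewrite -bigcup_seq => B [i _ [C mC <-]].
exact: mf.
Qed.

End measurable_rV.

(* Lebesgue measure on R^n, by iterating the product measure: the first
   coordinate of a point of R^(n+1) is p.2, the others are those of p.1. *)
Section lebesgue_rV.
Context {R : realType}.

Definition rV_cons n (p : 'rV[R]_n * measurableTypeR R) : 'rV[R]_n.+1 :=
  row_mx (p.2%:M : 'rV[R]_1) p.1.

Lemma measurable_rV_cons n : measurable_fun setT (@rV_cons n).
Proof.
apply/measurable_fun_rVP => i.
case: (split_ordP (i : 'I_(1 + n))) => j ij.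
- rewrite (_ : _ \o _ = snd); first exact: measurable_snd.
  apply/funext => p; rewrite /= /rV_coord /rV_cons ij.
  by rewrite (@row_mxEl _ 1 1 n) mxE (ord1 j) mulr1n.
- rewrite (_ : _ \o _ = rV_coord j \o fst).
    by apply: measurableT_comp => //; exact: measurable_rV_coord.
  by apply/funext => p; rewrite /= /rV_coord /rV_cons ij (@row_mxEr _ 1 1 n).
Qed.

Section succ.
Variables (n : nat) (mu : {measure set 'rV[R]_n -> \bar R}).

Definition lebesgue_rV_succ : set 'rV[R]_n.+1 -> \bar R :=
  pushforward (mu \x @lebesgue_measure R)%E (@rV_cons n).

HB.instance Definition _ := Measure.copy lebesgue_rV_succ
  (@measure_function_pushforward__canonical__measure_function_Measure
     _ _ _ _ _ _ _ (@measurable_rV_cons n)).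

End succ.

Fixpoint lebesgue_rV n : {measure set 'rV[R]_n -> \bar R} :=
  match n with
  | 0 => \d_ (0 : 'rV[R]_0)
  | n.+1 => lebesgue_rV_succ (lebesgue_rV n)
  end.

End lebesgue_rV.

Section euclidean.
Context {R : realType} {n : nat}.

Definition dot (u v : 'rV[R]_n) : R := \sum_(i < n) u ord0 i * v ord0 i.

Definition partials {W : normedModType R} (s : seq 'I_n) (f : 'rV[R]_n -> W) :
    'rV[R]_n -> W :=
  foldr (fun (i : 'I_n) g x => 'D_(delta_mx ord0 i) g x) f s.

(* This is C^oo when U is open, the only case in which it is used: all
   iterated partial derivatives exist on U and are (Frechet) differentiable
   there, hence continuous. *)
Definition smooth_on {W : normedModType R} (U : set 'rV[R]_n)
    (f : 'rV[R]_n -> W) : Prop :=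
  forall (s : seq 'I_n) (x : 'rV[R]_n), U x -> differentiable (partials s f) x.

Definition laplacian (f : 'rV[R]_n -> R) (x : 'rV[R]_n) : R :=
  \sum_(i < n) partials [:: i; i] f x.

End euclidean.

Section normal_domain.
Context {R : realType}.

Definition cube (m : nat) : set 'rV[R]_m :=
  [set t | forall i, 0 <= t ord0 i <= 1].

Definition open_cube (m : nat) : set 'rV[R]_m :=
  [set t | forall i, 0 < t ord0 i < 1].

(* Smoothness on the closed cube means smoothness of an extension to a
   neighbourhood; injectivity on the cube and of the differentials makes the
   image a smoothly embedded closed m-cube (corners and faces included). *)
Definition smooth_cell (m n : nat) (sigma : 'rV[R]_m -> 'rV[R]_n) : Prop :=
  [/\ exists U : set 'rV[R]_m, [/\ open U, @cube m `<=` U & smooth_on U sigma],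
      set_inj (@cube m) sigma &
      forall t, @cube m t -> injective ('d sigma t)].

Definition boundary (n : nat) (Omega : set 'rV[R]_n) : set 'rV[R]_n :=
  closure Omega `\` interior Omega.

(* Near each boundary point, Omega is the closed region below the graph of a
   Lipschitz function over a hyperplane.  The hyperplane is given by its unit
   normal nu, and x - <x,nu> nu is the orthogonal projection of x on it.  In
   particular Omega is locally on one side of its boundary, and is thus a
   codimension zero topological submanifold if it is closed. *)
Definition lipschitz_boundary (n : nat) (Omega : set 'rV[R]_n) : Prop :=
  forall p, boundary Omega p ->
  exists (nu : 'rV[R]_n) (g : 'rV[R]_n -> R),
    [/\ dot nu nu = 1, lipschitz g &
        \forall x \near p,
          Omega x <-> dot x nu <= g (x - dot x nu *: nu)].

(* The boundary is tiled by finitely many smoothly embedded closed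
   (n-1)-cubes with disjoint interiors (for n = 2, the usual finite
   concatenations of regular smooth arcs; for n = 1, finitely many points).
   A smooth simplex is a union of such cubes, so smooth triangulations of the
   boundary are covered. *)
Definition piecewise_smooth_boundary (n : nat) (Omega : set 'rV[R]_n) : Prop :=
  exists (k : nat) (sigma : 'I_k -> 'rV[R]_n.-1 -> 'rV[R]_n),
    [/\ forall i, smooth_cell (sigma i),
        boundary Omega = \bigcup_i (sigma i @` @cube n.-1) &
        forall i j, i != j ->
          (sigma i @` @open_cube n.-1) `&` (sigma j @` @open_cube n.-1) = set0].

(* Not required to be connected, but required to be nonempty. *)
Definition normal_domain (n : nat) (Omega : set 'rV[R]_n) : Prop :=
  [/\ Omega !=set0, compact Omega, lipschitz_boundary Omega &
      piecewise_smooth_boundary Omega].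

(* Isometric embeddings in the Riemannian sense, for the flat metrics: smooth
   injective maps Omega' -> Omega that preserve the metric tensor.  They are
   topological embeddings when Omega' is compact.  Restrictions of rigid
   motions are an instance; when Omega' is not connected, the components may
   be moved independently. *)
Definition isometric_embedding (n : nat) (Omega' Omega : set 'rV[R]_n)
    (f : 'rV[R]_n -> 'rV[R]_n) : Prop :=
  [/\ exists U : set 'rV[R]_n, [/\ open U, Omega' `<=` U & smooth_on U f],
      set_inj Omega' f,
      f @` Omega' `<=` Omega &
      forall x, Omega' x -> forall v w, dot ('d f x v) ('d f x w) = dot v w].

Definition embeds_isometrically (n : nat) (Omega' Omega : set 'rV[R]_n) : Prop :=
  exists f, isometric_embedding Omega' Omega f.

End normal_domain.

(* L^2(Omega) is the space of real functions satisfying [L2], up to equality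
   almost everywhere on Omega. *)
Section dirichlet_laplacian.
Context {R : realType} {n : nat}.
Variable Omega : set 'rV[R]_n.

Local Notation leb := (@lebesgue_rV R n).

Definition L2 (u : 'rV[R]_n -> R) : Prop :=
  measurable_fun Omega (u : 'rV[R]_n -> measurableTypeR R) /\
  (\int[leb]_(x in Omega) ((u x) ^+ 2)%:E < +oo)%E.

Definition L2_inner (u v : 'rV[R]_n -> R) : R :=
  (\int[leb]_(x in Omega) (u x * v x))%R.

Definition test_function (phi : 'rV[R]_n -> R) : Prop :=
  smooth_on setT phi /\ closure [set x | phi x != 0] `<=` interior Omega.

(* The completion of the test functions for the norm
   (|phi|^2 + <- laplacian phi, phi>)^(1/2), realized in L^2(Omega). *)
Definition form_domain (u : 'rV[R]_n -> R) : Prop :=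
  L2 u /\
  exists phi : nat -> 'rV[R]_n -> R,
    [/\ forall k, test_function (phi k),
        (fun k => L2_inner (phi k \- u) (phi k \- u)) @ \oo --> (0 : R) &
        forall e : R, 0 < e -> exists N : nat, forall k l : nat,
          (N <= k)%N -> (N <= l)%N ->
          L2_inner (\- laplacian (phi k \- phi l)) (phi k \- phi l) < e].

(* The graph of the Friedrichs extension of - laplacian on test functions: it
   is the restriction to the form domain of the adjoint. *)
Definition dirichlet_laplacian (u w : 'rV[R]_n -> R) : Prop :=
  [/\ form_domain u, L2 w &
      forall psi, test_function psi ->
        L2_inner u (\- laplacian psi) = L2_inner w psi].

Definition dirichlet_eigenspace (lam : R) : set ('rV[R]_n -> R) :=
  [set u | dirichlet_laplacian u (fun x => lam * u x)].

Definition L2_free (k : nat) (u : 'I_k -> 'rV[R]_n -> R) : Prop :=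
  forall c : 'I_k -> R,
    {ae leb, forall x, Omega x -> \sum_(i < k) c i * u i x = 0} ->
    forall i, c i = 0.

Definition L2_dim (E : set ('rV[R]_n -> R)) : \bar R :=
  ereal_sup [set (k%:R)%:E | k in
    [set k : nat | exists u : 'I_k -> 'rV[R]_n -> R,
       (forall i, E (u i)) /\ L2_free u]].

(* The number of eigenvalues <= x, each counted as many times as the
   dimension of its eigenspace (0 if it is not an eigenvalue). *)
Definition dirichlet_counting (x : R) : \bar R :=
  \esum_(lam in [set lam : R | lam <= x]) L2_dim (dirichlet_eigenspace lam).

End dirichlet_laplacian.

Definition dirichlet_subspectral (R : realType) (n : nat)
    (Omega Omega' : set 'rV[R]_n) : Prop :=
  forall x : R, (dirichlet_counting Omega' x <= dirichlet_counting Omega x)%E.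

(* Main.v *)
Require Import Defs.
From HB Require Import structures.
From mathcomp Require Import all_boot all_order all_algebra.
From mathcomp Require Import all_classical all_reals all_analysis.
From mathcomp Require Import measurable_realfun.
From mathcomp Require Import ring lra.

Set Implicit Arguments.
Unset Strict Implicit.
Unset Printing Implicit Defensive.
Import Order.TTheory GRing.Theory Num.Theory.
Import numFieldNormedType.Exports.
Local Open Scope classical_set_scope.
Local Open Scope ring_scope.


(* For n >= 2, Omega' is a box with one thin side eps = L / q and all others
   equal to L, with L large compared to the size of Omega.  An isometric
   embedding has orthonormal partial derivatives, hence (Schwarz) vanishing
   pure second derivatives, hence maps a segment of length L / 2 of the box to
   a segment of the same length, too long for Omega.  Both counting functions
   are compared by the min-max principle on test functions.  The Poincare
   inequality in the thin direction gives N_Omega' (x) = 0 for x < 1 / eps^2;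
   the Poincare inequality on cubes of side eps / (m + 1) gives
   N_Omega' (x) <= q^(n-1) (m+1)^n for m^2 <= x eps^2 < (m+1)^2; disjoint bumps
   in a cube inside Omega give N_Omega (x) >= M^n as soon as x >= c M^2.  The
   last bound wins for q large, since N_Omega is then at least a constant times
   (q m / L)^n.

   For n = 1, Omega' is Omega cut at an interior point a, the right part being
   moved to the right by 1.  Test functions of Omega' are those of Omega that
   vanish near a, hence N_Omega' <= N_Omega.  An isometric embedding of Omega'
   in Omega preserves Lebesgue measure, hence is onto, hence maps boundary
   points to boundary points; but Omega' has two more boundary points. *)

(** * Positive semidefinite forms and variational eigenvalue counting *)

(** The counting function sums dimensions of eigenspaces, so a lower bound for N_Omega has to
    produce genuine eigenfunctions, and not only test functions of small energy. The compactness
    behind their existence is a Poincare inequality up to finite rank: on a fine grid, any multiple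
    of the square norm of u is at most the energy of u plus a multiple of finitely many squared cell
    integrals. Together with the completeness of L^2, it makes penalised minimising sequences
    converge. Upper bounds for N_Omega' come from the same inequalities by counting the functionals.

    Both bounds have only the Weyl order x^(n/2), with lossy constants: the volume L^n / q of the
    box tends to 0 while its long sides keep the length L, so that large q absorbs any constant.

    In dimension one the length is the volume and no long side is available. Since an embedding may
    move components independently, the example keeps the length of Omega and the obstruction is a
    count of boundary points. *)

Lemma cvg0_sqr_le (R : realType) (a b : nat -> R) :
  (forall k, a k ^+ 2 <= b k) -> b @ \oo --> (0 : R) -> a @ \oo --> (0 : R).
Proof.
move=> ab b0; apply/cvgr0Pnorm_le => e e0.
move/cvgr0Pnorm_le : b0 => /(_ (e ^+ 2)) /(_ (exprn_gt0 _ e0)).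
apply: filterS => k bk.
rewrite -(@ler_pXn2r _ 2%N) ?nnegrE ?normr_ge0 ?(ltW e0)//.
rewrite real_normK ?num_real//; apply: le_trans (ab k) _.
by apply: le_trans bk; exact: ler_norm.
Qed.

Section psd_forms.
Context {R : realType} {V : lmodType R}.

(** The form is constrained only on [S]: the L^2 product is bilinear on square integrable functions
    alone, the Dirichlet form on test functions. Null vectors are allowed, since functions equal
    almost everywhere are not identified. *)
Record psd_form (S : set V) (q : V -> V -> R) : Prop := PsdForm {
  psd0 : S 0;
  psdL : forall a u v, S u -> S v -> S (a *: u + v);
  psdC : forall u v, S u -> S v -> q u v = q v u;
  psd_linear : forall a u v w, S u -> S v -> S w ->
    q (a *: u + v) w = a * q u w + q v w;
  psd_ge0 : forall u, S u -> 0 <= q u u }.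

Variables (S : set V) (q : V -> V -> R) (qP : psd_form S q).

Lemma psd_memB u v : S u -> S v -> S (u - v).
Proof. by move=> Su Sv; rewrite addrC -scaleN1r; apply: (psdL qP). Qed.

Lemma psd_memZ a u : S u -> S (a *: u).
Proof. by move=> Su; rewrite -[_ *: _]addr0; apply: (psdL qP) => //; apply: psd0 qP. Qed.

Lemma psd_memD u v : S u -> S v -> S (u + v).
Proof. by move=> Su Sv; rewrite -[u]scale1r; apply: (psdL qP). Qed.

Lemma psd_mem_sum (I : Type) (r : seq I) (c : I -> R) (u : I -> V) :
  (forall i, S (u i)) -> S (\sum_(i <- r) c i *: u i).
Proof.
move=> Su; elim/big_rec : _ => [|i x _ Sx]; first exact: psd0 qP.
exact: (psdL qP).
Qed.

Lemma psdZl a u w : S u -> S w -> q (a *: u) w = a * q u w.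
Proof.
move=> Su Sw; have S0 := psd0 qP.
have q0 : q 0 w = 0.
  have := psd_linear qP 1 S0 S0 Sw; rewrite scaler0 addr0 mul1r.
  by move/eqP; rewrite -subr_eq subrr eq_sym => /eqP.
by rewrite -[a *: u]addr0 (psd_linear qP)// q0 addr0.
Qed.

Lemma psd0l w : S w -> q 0 w = 0.
Proof. by move=> Sw; rewrite -(scale0r 0) psdZl ?mul0r//; apply: psd0 qP. Qed.

Lemma psdDl u v w : S u -> S v -> S w -> q (u + v) w = q u w + q v w.
Proof. by move=> Su Sv Sw; rewrite -[u]scale1r (psd_linear qP)// mul1r scale1r. Qed.

Lemma psdBl u v w : S u -> S v -> S w -> q (u - v) w = q u w - q v w.
Proof.
by move=> Su Sv Sw; rewrite addrC -scaleN1r (psd_linear qP)// mulN1r addrC.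
Qed.

Lemma psdBr u v w : S u -> S v -> S w -> q w (u - v) = q w u - q w v.
Proof.
move=> Su Sv Sw; have Suv := psd_memB Su Sv.
by rewrite (psdC qP)// psdBl// (psdC qP Su)// (psdC qP Sv).
Qed.

Lemma psdDr u v w : S u -> S v -> S w -> q w (u + v) = q w u + q w v.
Proof.
move=> Su Sv Sw; have Suv := psd_memD Su Sv.
by rewrite (psdC qP)// psdDl// (psdC qP Su)// (psdC qP Sv).
Qed.

Lemma psdZr a u w : S u -> S w -> q w (a *: u) = a * q w u.
Proof.
move=> Su Sw; have Sau := psd_memZ a Su.
by rewrite (psdC qP)// psdZl// (psdC qP Su).
Qed.

Lemma psd_suml (I : Type) (r : seq I) (c : I -> R) (u : I -> V) w :
  (forall i, S (u i)) -> S w ->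
  q (\sum_(i <- r) c i *: u i) w = \sum_(i <- r) c i * q (u i) w.
Proof.
move=> Su Sw; elim: r => [|i r ih]; first by rewrite !big_nil psd0l.
by rewrite !big_cons (psd_linear qP)// ?ih//; exact: psd_mem_sum.
Qed.

Lemma psd_sumr (I : Type) (r : seq I) (c : I -> R) (u : I -> V) w :
  (forall i, S (u i)) -> S w ->
  q w (\sum_(i <- r) c i *: u i) = \sum_(i <- r) c i * q w (u i).
Proof.
move=> Su Sw; rewrite (psdC qP)//; last exact: psd_mem_sum.
by rewrite psd_suml//; apply: eq_bigr => i _; rewrite (psdC qP).
Qed.

Lemma psd_sum2 (I : Type) (r : seq I) (c : I -> R) (u : I -> V) :
  (forall i, S (u i)) ->
  q (\sum_(i <- r) c i *: u i) (\sum_(i <- r) c i *: u i) =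
  \sum_(i <- r) \sum_(j <- r) c i * c j * q (u i) (u j).
Proof.
move=> Su; rewrite psd_suml//; last exact: psd_mem_sum.
apply: eq_bigr => i _; rewrite psd_sumr// mulr_sumr.
by apply: eq_bigr => j _; rewrite mulrA.
Qed.

Lemma psd_quad u v a b : S u -> S v ->
  q (a *: u + b *: v) (a *: u + b *: v) =
  a ^+ 2 * q u u + 2 * a * b * q u v + b ^+ 2 * q v v.
Proof.
move=> Su Sv; have Sau := psd_memZ a Su; have Sbv := psd_memZ b Sv.
rewrite psdDl ?psdDr ?psdZl ?psdZr//; try exact: psd_memD.
by rewrite (psdC qP Sv Su); ring.
Qed.

(** As [q] may be degenerate, the discriminant argument covers only [q u u != 0]. If [q u u = 0],
    the polynomial is affine in the coefficient of [u] and would take negative values unless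
    [q u v = 0]. *)
Lemma psd_CS u v : S u -> S v -> q u v ^+ 2 <= q u u * q v v.
Proof.
move=> Su Sv.
have quad a b : 0 <= a ^+ 2 * q u u + 2 * a * b * q u v + b ^+ 2 * q v v.
  by rewrite -psd_quad//; apply: (psd_ge0 qP); apply: psd_memD; exact: psd_memZ.
have [u0|u0] := eqVneq (q u u) 0; last first.
  have qu : 0 < q u u by rewrite lt_neqAle eq_sym u0 (psd_ge0 qP).
  have := quad (- q u v) (q u u).
  set x := q u u in qu *; set y := q u v; set z := q v v => h.
  have : 0 <= x * (x * z - y ^+ 2) by move: h; congr (0 <= _); ring.
  by rewrite pmulr_rge0// subr_ge0.
rewrite u0 mul0r leNgt; apply/negP => y2.
(* This coefficient of [u] makes the affine polynomial equal to [-1]. *)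
have := quad (- (q v v + 1) / (2 * q u v ^+ 2) * q u v) 1.
rewrite u0 mulr0 add0r.
have -> : 2 * (- (q v v + 1) / (2 * q u v ^+ 2) * q u v) * 1 * q u v
  + 1 ^+ 2 * q v v = - 1.
  by field; apply: contraTneq y2 => ->; rewrite expr0n ltxx.
by rewrite oppr_ge0 ler10.
Qed.

Lemma psdNN u : S u -> q (- u) (- u) = q u u.
Proof.
move=> Su; rewrite -scaleN1r psdZl ?psdZr ?mulrA ?mulrNN ?mulr1 ?mul1r//.
exact: psd_memZ.
Qed.

Lemma psd_subr_le u v : S u -> S v ->
  q (u - v) (u - v) <= 2 * q u u + 2 * q v v.
Proof.
move=> Su Sv.
have := psd_ge0 qP (psd_memD Su Sv).
have := psd_quad 1 1 Su Sv; have := psd_quad 1 (-1) Su Sv.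
rewrite !scale1r scaleN1r => -> ->; lra.
Qed.

End psd_forms.

(** The dimension count used throughout: among [M] vectors, some nontrivial combination satisfies
    [N < M] linear conditions, because a matrix with [N] columns has rank at most [N]. *)
Lemma left_kernel_vector (R : fieldType) (M N : nat) (a : 'I_M -> 'I_N -> R) :
  (N < M)%N ->
  exists2 c : 'I_M -> R, (exists i, c i != 0) &
    forall j, \sum_(i < M) c i * a i j = 0.
Proof.
move=> NM; pose B := \matrix_(i, j) a i j.
have : kermx B != 0.
  by rewrite kermx_eq0 /row_free neq_ltn (leq_ltn_trans (rank_leq_col B)).
case/rowV0Pn => v /sub_kermxP vB /rV0Pn[i vi].
exists (v ord0); first by exists i.
move=> j; have := congr1 (fun m : 'rV[R]_N => m ord0 j) vB; rewrite !mxE => h.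
by rewrite -[RHS]h; apply: eq_bigr => k _; rewrite !mxE.
Qed.

(** * Eigenvectors and spaces of bounded energy *)

Section glazman.
Context {R : realType} {V : lmodType R}.
Variables (X D : set V) (ip : V -> V -> R) (A : V -> V).

Definition energy (u v : V) : R := ip (A u) v.

Hypothesis ipP : psd_form X ip.
Hypothesis EP : psd_form D energy.
Hypothesis DX : D `<=` X.
Hypothesis AX : forall u, D u -> X (A u).

(** Elements of the form domain are handled through a sequence that converges in [ip] and is Cauchy
    in energy; the completion itself is not built. *)
Definition form_approx (phi : nat -> V) (u : V) : Prop :=
  [/\ forall k, D (phi k),
      (fun k => ip (phi k - u) (phi k - u)) @ \oo --> (0 : R) &
      forall e : R, 0 < e -> exists N : nat, forall k l : nat,
        (N <= k)%N -> (N <= l)%N ->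
        energy (phi k - phi l) (phi k - phi l) < e].

(** The Friedrichs extension is the adjoint of [A] restricted to the form domain; hence the equation
    is tested against [A psi], and [u] only needs an approximating sequence. *)
Definition weak_eigenvector (lam : R) (u : V) : Prop :=
  [/\ X u, exists phi, form_approx phi u &
      forall psi, D psi -> ip u (A psi) = lam * ip u psi].

(* By the min-max principle, the number of eigenvalues [<= x] is the largest
   such [k].  The slack [d] is there because [D] is only dense in the form
   domain. *)
Definition energy_bounded_dim (x : R) (k : nat) : Prop :=
  forall d, 0 < d -> exists2 phi : 'I_k -> V, forall i, D (phi i) &
    forall c : 'I_k -> R, (exists i, c i != 0) ->
      let v := \sum_(i < k) c i *: phi i in
      0 < ip v v /\ energy v v <= (x + d) * ip v v.

(** Families are indexed by all of [nat], with arbitrary values from [k] on, so that they can be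
    extended and concatenated freely. *)
Definition eigen_orthonormal (x : R) (k : nat) (u : nat -> V) (lam : nat -> R)
    : Prop :=
  [/\ forall i, (i < k)%N -> weak_eigenvector (lam i) (u i),
      forall i, (i < k)%N -> lam i <= x &
      forall i j, (i < k)%N -> (j < k)%N -> ip (u i) (u j) = (i == j)%:R].

Lemma ip_cvgl u_ u w : (forall k, X (u_ k)) -> X u -> X w ->
  (fun k => ip (u_ k - u) (u_ k - u)) @ \oo --> (0 : R) ->
  (fun k => ip (u_ k) w) @ \oo --> ip u w.
Proof.
move=> Xu_ Xu Xw uu; apply/subr_cvg0.
apply: (@cvg0_sqr_le _ _ (fun k => ip (u_ k - u) (u_ k - u) * ip w w)).
  move=> k; rewrite -(psdBl ipP)//.
  by apply: (psd_CS ipP) => //; exact: (psd_memB ipP).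
by rewrite -[0](mul0r (ip w w)); apply: cvgMl.
Qed.

Lemma ip_cvg u_ u v_ v : (forall k, X (u_ k)) -> X u ->
  (forall k, X (v_ k)) -> X v ->
  (fun k => ip (u_ k - u) (u_ k - u)) @ \oo --> (0 : R) ->
  (fun k => ip (v_ k - v) (v_ k - v)) @ \oo --> (0 : R) ->
  (fun k => ip (u_ k) (v_ k)) @ \oo --> ip u v.
Proof.
move=> Xu_ Xu Xv_ Xv uu vv.
have -> : (fun k => ip (u_ k) (v_ k)) =
    (fun k => ip (u_ k - u) (v_ k - v) + ip u (v_ k) + ip (u_ k - u) v).
  apply/funext => k; have XB := psd_memB ipP.
  by rewrite (psdBr ipP)//; [rewrite !(psdBl ipP)//; ring | exact: XB].
rewrite -[ip u v]addr0 -[X in X + 0]add0r; apply: cvgD.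
  apply: cvgD.
    apply: (@cvg0_sqr_le _ _
      (fun k => ip (u_ k - u) (u_ k - u) * ip (v_ k - v) (v_ k - v))).
      by move=> k; apply: (psd_CS ipP) => //; exact: (psd_memB ipP).
    by rewrite -[0](mulr0 0); apply: cvgM.
  rewrite (_ : (fun k => ip u (v_ k)) = (fun k => ip (v_ k) u)).
    by rewrite (psdC ipP)//; exact: ip_cvgl.
  by apply/funext => k; rewrite (psdC ipP).
have -> : (fun k => ip (u_ k - u) v) = (fun k => ip (u_ k) v - ip u v).
  by apply/funext => k; rewrite (psdBl ipP).
by rewrite -(subrr (ip u v)); apply: cvgB; [exact: ip_cvgl|exact: cvg_cst].
Qed.

Lemma energy_bounded phi u : form_approx phi u ->
  exists M N, 0 < M /\ forall k, (N <= k)%N -> energy (phi k) (phi k) <= M.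
Proof.
move=> [Dphi _ /(_ _ ltr01)[N phiC]].
exists (2 + 2 * energy (phi N) (phi N)), N; split.
  by have := psd_ge0 EP (Dphi N); lra.
move=> k Nk.
have := psd_subr_le EP (psd_memB EP (Dphi k) (Dphi N))
  (psd_memZ EP (-1) (Dphi N)).
rewrite scaleN1r opprK subrK (psdNN EP)// => h.
have := phiC k N Nk (leqnn N).
lra.
Qed.

(** For fixed [l], [energy (phi k) (psi l) = ip (phi k) (A (psi l))] tends to [lam * ip u (psi l)]
    by the weak equation. Replacing [psi l] by [psi k] costs little, by Cauchy-Schwarz for the
    energy: the [phi k] have bounded energy and [psi] is Cauchy in energy. *)
Lemma eigen_energy_cvg lam u v phi psi : weak_eigenvector lam u -> X v ->
  form_approx phi u -> form_approx psi v ->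
  (fun k => energy (phi k) (psi k)) @ \oo --> lam * ip u v.
Proof.
move=> [Xu _ ueig] Xv phiu psiv.
have [M [N0 [M0 phiM]]] := energy_bounded phiu.
case: phiu => Dphi phi_u _; case: psiv => Dpsi psi_v psiC.
apply/cvgrPdist_le => e e0.
have e30 : 0 < e / 3 by rewrite divr_gt0.
have psi_cvg : (fun l => lam * ip u (psi l)) @ \oo --> lam * ip u v.
  apply: cvgMr.
  rewrite (_ : (fun k => ip u (psi k)) = (fun k => ip (psi k) u)).
    by rewrite (psdC ipP)//; apply: ip_cvgl => // k; exact: DX.
  by apply/funext => k; rewrite (psdC ipP)//; exact: DX.
have [N1 psiN1] := psiC ((e / 3) ^+ 2 / M) (divr_gt0 (exprn_gt0 _ e30) M0).
move/cvgrPdist_le : psi_cvg => /(_ _ e30) [N2 _ psiN2].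
pose l := maxn N1 N2.
have phil : (fun k => energy (phi k) (psi l)) @ \oo --> lam * ip u (psi l).
  rewrite -ueig//; rewrite (_ : (fun k => _) = (fun k => ip (phi k) (A (psi l)))).
    by apply: ip_cvgl => // [k|]; [exact: DX|exact: AX].
  apply/funext => k; rewrite (psdC EP)// /energy (psdC ipP)//; [exact: AX|exact: DX].
move/cvgrPdist_le : phil => /(_ _ e30) [N3 _ phiN3].
exists (maxn N0 (maxn l N3)) => // k /=; rewrite !geq_max => /and3P[N0k /andP[N1k _] N3k].
have := phiN3 k N3k; have := psiN2 l (leq_maxr _ _).
have : `|energy (phi k) (psi k - psi l)| <= e / 3.
  rewrite -(@ler_pXn2r _ 2%N) ?nnegrE ?normr_ge0 ?(ltW e30)//.
  rewrite real_normK ?num_real//.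
  apply: (le_trans (psd_CS EP (Dphi k) (psd_memB EP (Dpsi k) (Dpsi l)))).
  have := psiN1 k l N1k (leq_maxl _ _).
  rewrite ltr_pdivlMr// => /ltW; apply: le_trans.
  rewrite mulrC ler_wpM2l//; last exact: phiM.
  by apply: (psd_ge0 EP); apply: (psd_memB EP).
rewrite (psdBr EP)//.
move: (energy _ _) (energy _ _) (lam * _) (lam * _) => a b c d.
rewrite !ler_norml => /andP[? ?] /andP[? ?] /andP[? ?].
apply/andP; split; lra.
Qed.

Lemma eigen_ge0 lam u : weak_eigenvector lam u -> 0 < ip u u -> 0 <= lam.
Proof.
move=> h u0; have [Xu [phi phiu] _] := h.
rewrite -(pmulr_lge0 _ u0).
have E := eigen_energy_cvg h Xu phiu phiu.
rewrite -(cvg_lim _ E)//; apply: limr_ge; first by apply/cvg_ex; eexists; exact: E.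
by apply: nearW => k; apply: (psd_ge0 EP); case: phiu.
Qed.

(** The limit of [energy (phi k) (psi k)] can be computed from either eigenvector, which gives
    [lam * ip u v = mu * ip v u]. *)
Lemma eigen_orthogonal lam mu u v : lam != mu ->
  weak_eigenvector lam u -> weak_eigenvector mu v -> ip u v = 0.
Proof.
move=> lm hu hv; have [Xu [phi phiu] _] := hu; have [Xv [psi psiv] _] := hv.
have h1 := eigen_energy_cvg hu Xv phiu psiv.
have h2 := eigen_energy_cvg hv Xu psiv phiu.
have : lam * ip u v = mu * ip v u.
  apply: (cvg_unique _ h1) => //.
  rewrite (_ : (fun k => _) = (fun k => energy (psi k) (phi k)))//.
  by apply/funext => k; rewrite (psdC EP)//; [case: phiu|case: psiv].
rewrite (psdC ipP Xv)// => /eqP; rewrite -subr_eq0 -mulrBl mulf_eq0.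
by rewrite subr_eq0 (negbTE lm) => /eqP.
Qed.

(** The bound [|c i * c j| <= (c i ^+ 2 + c j ^+ 2) / 2], summed over all pairs, produces the factor
    [k]. *)
Lemma near_diag_bound (k : nat) (a : 'I_k -> 'I_k -> R) (l c : 'I_k -> R) eta :
  0 <= eta -> (forall i j, `|a i j - l i * (i == j)%:R| <= eta) ->
  `|\sum_i \sum_j c i * c j * a i j - \sum_i l i * c i ^+ 2|
    <= eta * k%:R * \sum_i c i ^+ 2.
Proof.
move=> eta0 h.
have -> : \sum_i l i * c i ^+ 2 =
    \sum_i \sum_j c i * c j * (l i * (i == j)%:R).
  apply: eq_bigr => i _; rewrite (bigD1 i)//= eqxx mulr1 big1 ?addr0; first ring.
  by move=> j ji; rewrite eq_sym (negbTE ji) !mulr0.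
rewrite -sumrB.
have -> : eta * k%:R * \sum_i c i ^+ 2 =
   \sum_(i < k) \sum_(j < k) eta * ((c i ^+ 2 + c j ^+ 2) / 2).
  have -> : \sum_(i < k) \sum_(j < k) eta * ((c i ^+ 2 + c j ^+ 2) / 2) =
      \sum_(i < k) (eta * k%:R / 2 * c i ^+ 2 + eta / 2 * \sum_j c j ^+ 2).
    apply: eq_bigr => i _; rewrite mulr_sumr.
    have -> : eta * k%:R / 2 * c i ^+ 2 = \sum_(j < k) (eta / 2 * c i ^+ 2).
      by rewrite sumr_const card_ord -mulr_natl; ring.
    by rewrite -big_split/=; apply: eq_bigr => j _; ring.
  by rewrite big_split/= -mulr_sumr sumr_const card_ord -mulr_natl; field.
apply: le_trans (ler_norm_sum _ _ _) _; apply: ler_sum => i _.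
rewrite -sumrB; apply: le_trans (ler_norm_sum _ _ _) _; apply: ler_sum => j _.
rewrite -mulrBr normrM mulrC; apply: ler_pM => //.
rewrite ler_norml; apply/andP; split.
  by have := sqr_ge0 (c i + c j); nra.
by have := sqr_ge0 (c i - c j); nra.
Qed.

(** At a common late stage [m], the Gram matrices of the approximants [phi i m] are close to the
    identity for [ip] and to the diagonal of the [lam i] for the energy; [near_diag_bound] compares
    the two quadratic forms on their span. *)
Lemma energy_bounded_dim_eigen x k u lam : eigen_orthonormal x k u lam ->
  energy_bounded_dim x k.
Proof.
move=> [ueig lamx uon] d d0.
have /choice[phi phiP] : forall i : 'I_k, exists phi, form_approx phi (u i).
  by move=> i; have [] := ueig i (ltn_ord i).
(* The bound [eta * k * (1 + |x| + d) <= d] gives both [eta * k < 1], whence [ip v v > 0], and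
   [x + eta * k <= (x + d) * (1 - eta * k)], whence the energy bound. *)
pose eta := d / (k%:R + 1) / (1 + `|x| + d).
have k0 : 0 <= k%:R :> R by [].
have den0 : 0 < 1 + `|x| + d by have := normr_ge0 x; lra.
have eta0 : 0 < eta by rewrite !divr_gt0//; lra.
have etak : eta * k%:R * (1 + `|x| + d) <= d.
  have -> : eta * k%:R * (1 + `|x| + d) = d * (k%:R / (k%:R + 1)).
    by rewrite /eta; field; apply/andP; split; apply: lt0r_neq0 => //; lra.
  by rewrite ler_piMr ?(ltW d0)// ler_pdivrMr; lra.
have Dphi i m : D (phi i m) by case: (phiP i).
have Xphi i m : X (phi i m) by exact: DX.
have Xu (i : 'I_k) : X (u i) by case: (ueig i (ltn_ord i)).
have ipc (i j : 'I_k) :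
    (fun m => ip (phi i m) (phi j m)) @ \oo --> (1 * (i == j)%:R : R).
  rewrite mul1r -[_ == _]/(nat_of_ord i == j) -uon//; apply: ip_cvg => //.
    by case: (phiP i).
  by case: (phiP j).
have Ec (i j : 'I_k) :
    (fun m => energy (phi i m) (phi j m)) @ \oo --> (lam i * (i == j)%:R : R).
  rewrite -[_ == _]/(nat_of_ord i == j) -uon//; apply: eigen_energy_cvg => //.
  by apply: ueig.
have [m hm] : exists m, forall i j : 'I_k,
    `|ip (phi i m) (phi j m) - 1 * (i == j)%:R| <= eta /\
    `|energy (phi i m) (phi j m) - lam i * (i == j)%:R| <= eta.
  have : \forall m \near \oo, forall ij : 'I_k * 'I_k,
    `|ip (phi ij.1 m) (phi ij.2 m) - 1 * (ij.1 == ij.2)%:R| <= eta /\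
    `|energy (phi ij.1 m) (phi ij.2 m) - lam ij.1 * (ij.1 == ij.2)%:R| <= eta.
    apply: filter_forall => -[i j] /=.
    move/cvgrPdist_le : (ipc i j) => /(_ _ eta0) h1.
    move/cvgrPdist_le : (Ec i j) => /(_ _ eta0) h2.
    by near=> m; split; rewrite distrC; near: m.
  by move=> [m _ /(_ m (leqnn m)) h]; exists m => i j; exact: (h (i, j)).
exists (fun i => phi i m); first by move=> i.
move=> c [i0 ci0] /=.
have S0 : 0 < \sum_i c i ^+ 2.
  rewrite (bigD1 i0)//= ltr_pwDl//; first by rewrite exprn_even_gt0.
  by apply: sumr_ge0 => i _; exact: sqr_ge0.
have H1 := near_diag_bound c (ltW eta0) (fun i j => (hm i j).1).
have H2 := near_diag_bound c (ltW eta0) (fun i j => (hm i j).2).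
rewrite (psd_sum2 ipP)// (psd_sum2 EP)//.
have L : \sum_(i < k) lam i * c i ^+ 2 <= x * \sum_i c i ^+ 2.
  by rewrite mulr_sumr; apply: ler_sum => i _; rewrite ler_wpM2r ?sqr_ge0// lamx.
have S1 : \sum_(i < k) 1 * c i ^+ 2 = \sum_i c i ^+ 2.
  by apply: eq_bigr => i _; rewrite mul1r.
rewrite S1 in H1; move: H1 H2.
move: (\sum_i \sum_j _) (\sum_i \sum_j _) (\sum_(i < k) lam i * _) L S0.
set S := \sum_i c i ^+ 2 => b a s L S0.
move: etak; set ek := eta * k%:R => etak.
have ek0 : 0 <= ek by rewrite mulr_ge0// ltW.
rewrite !ler_norml => /andP[a1 a2] /andP[b1 b2].
have ek1 : ek < 1.
  rewrite ltNge; apply/negP => ek1.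
  by have := ler_wpM2r (ltW den0) ek1; have := normr_ge0 x; lra.
have aS : (1 - ek) * S <= a by lra.
split; first by apply: lt_le_trans aS; rewrite mulr_gt0// subr_gt0.
have bS : b <= (x + ek) * S by lra.
have xd : x + ek <= (x + d) * (1 - ek).
  have : ek * (1 + x + d) <= d.
    by apply: le_trans etak; rewrite ler_wpM2l// lerD2r lerD2l ler_norm.
  by lra.
(* A nonzero coefficient exists, so there is at least one eigenvalue below [x], and eigenvalues are
   nonnegative; the sign of [x + d] is used to multiply inequalities. *)
have x0 : 0 <= x.
  apply: le_trans (lamx _ (ltn_ord i0)).
  by apply: (eigen_ge0 (ueig _ (ltn_ord i0))); rewrite uon// eqxx.
apply: (le_trans bS); apply: (le_trans (ler_wpM2r (ltW S0) xd)).
by rewrite -mulrA ler_wpM2l//; lra.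
Unshelve. all: by end_near.
Qed.

End glazman.

Lemma cvg_sumr (R : realType) (I : Type) (r : seq I) (F : I -> nat -> R)
    (l : I -> R) : (forall i, F i @ \oo --> l i) ->
  (fun k => \sum_(i <- r) F i k) @ \oo --> \sum_(i <- r) l i.
Proof.
move=> Fl; elim: r => [|i r ih].
  rewrite big_nil (_ : (fun k => _) = cst 0); first exact: cvg_cst.
  by apply/funext => k; rewrite big_nil.
rewrite big_cons (_ : (fun k => _) = (fun k => F i k + \sum_(j <- r) F j k)).
  exact: cvgD.
by apply/funext => k; rewrite big_cons.
Qed.

(** Bolzano-Weierstrass in dimension [K]. The conclusion records arbitrarily late terms close to [L]
    instead of a subsequence. *)
Lemma bounded_cluster_point (R : realType) (K : nat) (l : nat -> 'I_K -> R)
    (B : 'I_K -> R) : (forall k j, `|l k j| <= B j) ->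
  exists L : 'I_K -> R, forall e N, 0 < e ->
    exists2 k, (N <= k)%N & forall j, `|l k j - L j| < e.
Proof.
move=> lB.
have cB : compact [set v : 'rV[R]_K | forall j, `[- B j, B j]%classic (v ord0 j)].
  by apply: (@rV_compact _ _ (fun j => `[- B j, B j]%classic)) => j; exact: segment_compact.
pose v k : 'rV[R]_K := \row_j l k j.
have [|L [_ clL]] := cB (v @ \oo).
  exists 0%N => // k _ j /=; rewrite mxE in_itv/= -ler_norml; exact: lB.
exists (L ord0) => e N e0.
have vN : (v @ \oo) (v @` [set k | (N <= k)%N]) by exists N => // k Nk; exists k.
have [y [[k Nk <-] yL]] := clL _ _ vN (nbhsx_ballx L e e0).
exists k => // j; have {yL}[_ /(_ ord0 j)] := yL.
by rewrite /ball/= mxE distrC.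
Qed.

(** * A further eigenvector by minimising a Rayleigh quotient *)

Section eigen_extend.
Context {R : realType} {V : lmodType R}.
Variables (X D : set V) (ip : V -> V -> R) (A : V -> V).
Notation E := (energy ip A).
Hypothesis ipP : psd_form X ip.
Hypothesis EP : psd_form D E.
Hypothesis DX : D `<=` X.
Hypothesis AX : forall u, D u -> X (A u).
Hypothesis X_complete : forall phi : nat -> V, (forall k, D (phi k)) ->
  (forall e : R, 0 < e -> exists N : nat, forall k l : nat,
     (N <= k)%N -> (N <= l)%N -> ip (phi k - phi l) (phi k - phi l) < e) ->
  exists2 u, X u & (fun k => ip (phi k - u) (phi k - u)) @ \oo --> (0 : R).
(** A substitute for the compact embedding of the form domain: for any [y], the energy dominates [y]
    times the square norm up to finitely many linear functionals. *)
Hypothesis poincare : forall y : R, exists K (C : R) (e : 'I_K -> V),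
  [/\ 0 <= C, forall j, X (e j) & forall u, D u ->
    y * ip u u <= E u u + C * \sum_j ip u (e j) ^+ 2].

Notation weig := (weak_eigenvector X D ip A).
Notation approx := (form_approx D ip A).

Let psd_formD (a : R) q1 q2 : 0 <= a -> psd_form D q1 -> psd_form D q2 ->
  psd_form D (fun u v => q1 u v + a * q2 u v).
Proof.
move=> a0 [D0 DL c1 l1 p1] [_ _ c2 l2 p2]; split => //.
- by move=> u v Du Dv; rewrite c1// c2.
- by move=> b u v w Du Dv Dw; rewrite l1// l2//; ring.
- by move=> u Du; rewrite addr_ge0// ?p1// mulr_ge0// p2.
Qed.

Let ipDP : psd_form D ip.
Proof.
have [D0 DL _ _ _] := EP; have [_ _ c l p] := ipP; split => //.
- by move=> u v /DX Du /DX Dv; exact: c.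
- by move=> a u v w /DX Du /DX Dv /DX Dw; exact: l.
- by move=> u /DX Du; exact: p.
Qed.

Section extend.
Variables (x : R) (M N : nat) (f : nat -> V) (mu : nat -> R).
Hypothesis xM : energy_bounded_dim D ip A x M.
Hypothesis fmu : eigen_orthonormal X D ip A x N f mu.
Hypothesis NM : (N < M)%N.

Let Xf (j : 'I_N) : X (f j).
Proof. by case: fmu => /(_ _ (ltn_ord j))[]. Qed.

Let P u v := \sum_(j < N) ip u (f j) * ip v (f j).

Let PP : psd_form D P.
Proof.
have [D0 DL _ _ _] := EP; split => //.
- by move=> u v Du Dv; apply: eq_bigr => j _; rewrite mulrC.
- move=> a u v w /DX Du /DX Dv Dw; rewrite /P mulr_sumr -big_split/=.
  by apply: eq_bigr => j _; rewrite (psd_linear ipP)//; ring.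
- by move=> u Du; apply: sumr_ge0 => j _; rewrite -expr2 sqr_ge0.
Qed.

(* The penalty lifts the eigenvalues of the [f j] above [x], so that the
   minimiser of the penalised Rayleigh quotient is orthogonal to them. *)
Let c0 : R := `|x| + 1.
Let c0_ge0 : 0 <= c0. Proof. by rewrite addr_ge0. Qed.

Let q0 u v := E u v + c0 * P u v.
Let q0P : psd_form D q0. Proof. exact: psd_formD. Qed.

Let sphere : set V := [set u | D u /\ ip u u = 1].

Let normalize u : D u -> 0 < ip u u -> exists2 t, t ^+ 2 * ip u u = 1 & sphere (t *: u).
Proof.
move=> Du u0; have t1 : ((Num.sqrt (ip u u))^-1) ^+ 2 * ip u u = 1.
  by rewrite exprVn sqr_sqrtr ?(ltW u0)// mulVf// gt_eqF.
exists (Num.sqrt (ip u u))^-1 => //; split; first exact: (psd_memZ ipDP).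
rewrite (psdZl ipDP)//; last exact: (psd_memZ ipDP).
by rewrite (psdZr ipDP)// mulrA -expr2.
Qed.

(** As [N < M], some nonzero combination of the [M] vectors of low energy is orthogonal to all the
    [f j], and its penalty vanishes. *)
Let q0_test d : 0 < d -> exists2 u, sphere u & q0 u u <= x + d.
Proof.
move=> d0; have [phi Dphi phiE] := xM d0.
have [c c0' cf] := left_kernel_vector (fun i j => ip (phi i) (f j)) NM.
have [v0 vE] := phiE c c0'.
set v := \sum_i _ in v0 vE.
have Dv : D v by exact: (psd_mem_sum EP).
have [t t1 tv] := normalize Dv v0; exists (t *: v) => //.
have Dtv : D (t *: v) by case: tv.
rewrite (psdZl q0P)// (psdZr q0P)// mulrA -expr2.
have -> : q0 v v = E v v.
  rewrite /q0 [P v v]big1 ?mulr0 ?addr0// => j _.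
  rewrite (psd_suml ipP) ?cf ?mulr0 ?mul0r// => i; exact: DX.
apply: le_trans (ler_wpM2l (sqr_ge0 t) vE) _.
by rewrite mulrCA t1 mulr1.
Qed.

Let S := [set q0 u u | u in sphere].
Let lam := inf S.

Let S_inf : has_inf S.
Proof.
split; first by have [u su _] := q0_test ltr01; exists (q0 u u), u.
by exists 0 => _ [u [Du _] <-]; apply: (psd_ge0 q0P).
Qed.

Let lamx : lam <= x.
Proof.
apply/ler_addgt0Pr => d d0; have [u su ux] := q0_test d0.
by apply: le_trans ux; apply: ge_inf; [case: S_inf|exists u].
Qed.

(** Subtracting the infimum of the Rayleigh quotient leaves a nonnegative form. Its Cauchy-Schwarz
    inequality turns [q (phi k) (phi k) --> 0] along a minimising sequence into the Euler-Lagrange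
    equation [q (phi k) g --> 0]. *)
Let q u v := q0 u v - lam * ip u v.

Let qP : psd_form D q.
Proof.
have [D0 DL c1 l1 p1] := q0P; have [_ _ c2 l2 p2] := ipDP; split => //.
- by move=> u v Du Dv; rewrite /q c1// c2.
- by move=> a u v w Du Dv Dw; rewrite /q l1// l2//; ring.
- move=> u Du; rewrite subr_ge0.
  have [u0|u0] := eqVneq (ip u u) 0; first by rewrite u0 mulr0 p1.
  have {}u0 : 0 < ip u u by rewrite lt_neqAle eq_sym u0 p2.
  have [t t1 tu] := normalize Du u0.
  have : lam <= q0 (t *: u) (t *: u) by apply: ge_inf; [case: S_inf|exists (t *: u)].
  have Dtu : D (t *: u) by case: tu.
  rewrite (psdZl q0P)// (psdZr q0P)// mulrA -expr2 => h.
  apply: le_trans (ler_wpM2r (ltW u0) h) _.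
  by rewrite mulrAC t1 mul1r.
Qed.

Let minimizing : exists K (C : R) (e : 'I_K -> V) (L : 'I_K -> R),
  [/\ 0 <= C, forall j, X (e j), forall u, D u ->
    (x + 1) * ip u u <= E u u + C * \sum_j ip u (e j) ^+ 2 &
    forall d, 0 < d -> exists u, [/\ sphere u, q u u < d &
       forall j, `|ip u (e j) - L j| < d]].
Proof.
(* The level [x + 1] exceeds [lam] by at least [1]: once [lam * ip v v] is absorbed, a full [ip v v]
   remains on the left. *)
have [K [C [e [C0 Xe eP]]]] := poincare (x + 1).
have /choice[phi phiP] : forall k : nat, exists u, sphere u /\ q u u < k.+1%:R^-1.
  move=> k; have [|_ [u su <-] uS] := inf_adherent _ S_inf (eps := k.+1%:R^-1).
    by rewrite invr_gt0.
  by exists u; split => //; case: su => _ u1; rewrite /q u1 mulr1 ltrBlDl.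
have [|L LP] := @bounded_cluster_point R K (fun k j => ip (phi k) (e j))
    (fun j => Num.sqrt (ip (e j) (e j))).
  move=> k j; have [[Dk k1] _] := phiP k.
  rewrite -sqrtr_sqr ler_wsqrtr//.
  by apply: le_trans (psd_CS ipP (DX Dk) (Xe j)) _; rewrite k1 mul1r.
exists K, C, e, L; split=> // d d0.
have [n0 _ n0P] := near_infty_natSinv_lt (PosNum d0).
have [k n0k kP] := LP d n0 d0.
exists (phi k); have [sk qk] := phiP k; split => //.
by apply: (lt_trans qk); exact: n0P.
Qed.

(** The minimising sequence is Cauchy in [ip], because [q] and the functionals [ip _ (e j)] are
    small on differences, and then Cauchy in energy. Testing the Euler-Lagrange equation on
    approximants of [f j] gives orthogonality to [f j], and on elements of [D] the weak equation. *)
Lemma eigen_extend : exists u l, [/\ weig l u, l <= x, ip u u = 1 &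
  forall j, (j < N)%N -> ip u (f j) = 0].
Proof.
have [K [C [e [L [C0 Xe eP minP]]]]] := minimizing.
have /choice[phi phiP] : forall k : nat, exists u, [/\ sphere u, q u u < k.+1%:R^-1 &
   forall j, `|ip u (e j) - L j| < k.+1%:R^-1].
  by move=> k; apply: minP; rewrite invr_gt0.
have Dphi k : D (phi k) by case: (phiP k) => -[].
have Xphi k : X (phi k) by exact: DX.
have phi1 k : ip (phi k) (phi k) = 1 by case: (phiP k) => -[].
(* With [r = 1 / (n + 1)], [q v v] contributes [4 * r] and each of the [K] functionals at most
   [(2 * r) ^+ 2 <= 4 * r]. *)
pose G := 4 + C * (K%:R * 4).
have G0 : 0 < G by rewrite /G ltr_pwDl// mulr_ge0// mulr_ge0.
have small (k l n : nat) : (n <= k)%N -> (n <= l)%N ->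
    q (phi k - phi l) (phi k - phi l) <= 4 * n.+1%:R^-1 /\
    ip (phi k - phi l) (phi k - phi l) <= G * n.+1%:R^-1.
  move=> nk nl; set v := phi k - phi l.
  have Dv : D v by exact: (psd_memB EP).
  have inv_le (m : nat) : (n <= m)%N -> m.+1%:R^-1 <= n.+1%:R^-1 :> R.
    by move=> nm; rewrite lef_pV2 ?posrE// ler_nat.
  have qv : q v v <= 4 * n.+1%:R^-1.
    apply: le_trans (psd_subr_le qP (Dphi k) (Dphi l)) _.
    have [_ /ltW hk _] := phiP k; have [_ /ltW hl _] := phiP l.
    have := le_trans hk (inv_le _ nk); have := le_trans hl (inv_le _ nl).
    move: (q _ _) (q _ _) (n.+1%:R^-1) => a b r; lra.
  split => //.
  have ev (j : 'I_K) : ip v (e j) ^+ 2 <= 4 * n.+1%:R^-1.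
    rewrite /v (psdBl ipP)//.
    have [_ _ /(_ j)/ltW hk] := phiP k; have [_ _ /(_ j)/ltW hl] := phiP l.
    have := le_trans hk (inv_le _ nk); have := le_trans hl (inv_le _ nl).
    have n1 : n.+1%:R^-1 <= 1 :> R by rewrite invf_le1// ler1n.
    have n0 : 0 <= n.+1%:R^-1 :> R by rewrite invr_ge0.
    move: (ip _ _) (ip _ _) (L j) (n.+1%:R^-1) n0 n1 => a b c r r0 r1.
    rewrite !ler_norml => /andP[? ?] /andP[? ?].
    have ab1 : 0 <= 2 * r - (a - b) by lra.
    have ab2 : 0 <= 2 * r + (a - b) by lra.
    have := mulr_ge0 ab1 ab2; have : 0 <= r * (1 - r) by rewrite mulr_ge0// subr_ge0.
    by lra.
  have Ev : E v v <= q v v + lam * ip v v.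
    have : 0 <= c0 * P v v by rewrite mulr_ge0// (psd_ge0 PP).
    by rewrite /q /q0; lra.
  have sumv : \sum_j ip v (e j) ^+ 2 <= K%:R * (4 * n.+1%:R^-1).
    rewrite mulr_natl -[K in _ *+ K]card_ord -sumr_const.
    by apply: ler_sum => j _.
  have := eP v Dv; have := ler_wpM2l C0 sumv.
  have : lam * ip v v <= x * ip v v by rewrite ler_wpM2r// (psd_ge0 ipDP).
  rewrite /G; move: qv Ev.
  move: (n.+1%:R^-1) (K%:R : R) (ip v v) (q v v) (E v v) (\sum_j _) => r k1 iv qv Ev s.
  by lra.
have inv_cvg : (fun n : nat => n.+1%:R^-1) @ \oo --> (0 : R) by exact: cvg_harmonic.
have arch (c d : R) : 0 <= c -> 0 < d -> exists n : nat, c * n.+1%:R^-1 < d.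
  move=> c_ge0 d0.
  have [n0 _ n0P] := near_infty_natSinv_lt (PosNum (divr_gt0 d0 (ltr_pwDl ltr01 c_ge0))).
  exists n0; have /= := n0P n0 (leqnn _); rewrite ltr_pdivlMr; last by lra.
  have : 0 <= n0.+1%:R^-1 :> R by rewrite invr_ge0.
  by move: (n0.+1%:R^-1) => r r0 h; lra.
have [u Xu phiu] : exists2 u, X u &
    (fun k => ip (phi k - u) (phi k - u)) @ \oo --> (0 : R).
  apply: X_complete => // d d0; have [n nd] := arch G d (ltW G0) d0.
  exists n => k l nk nl; have [_ h] := small k l n nk nl.
  by apply: le_lt_trans nd.
have uapp : approx phi u.
  split => // d d0.
  (* The energy of [v] is at most [q v v + lam * ip v v], hence at most
     [(4 + |x| * G) / (n + 1)]. *)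
  have [|n nd] := arch (4 + `|x| * G) d _ d0.
    by rewrite addr_ge0// mulr_ge0// ltW.
  exists n => k l nk nl; have [h1 h2] := small k l n nk nl.
  apply: le_lt_trans nd.
  set v := phi k - phi l in h1 h2 *.
  have Dv : D v by exact: (psd_memB EP).
  have : 0 <= c0 * P v v by rewrite mulr_ge0// (psd_ge0 PP).
  have v0 := psd_ge0 ipDP Dv.
  have : lam * ip v v <= `|x| * (G * n.+1%:R^-1).
    apply: (@le_trans _ _ (`|x| * ip v v)); last by rewrite ler_wpM2l.
    by rewrite ler_wpM2r// (le_trans lamx)// ler_norm.
  move: h1; rewrite /q /q0.
  by move: (n.+1%:R^-1) (ip v v) (E v v) => r iv Ev; lra.
have u1 : ip u u = 1.
  have := ip_cvg ipP Xphi Xu Xphi Xu phiu phiu.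
  rewrite (_ : (fun k => _) = cst 1); last by apply/funext => k; rewrite phi1.
  by move=> /cvg_unique; apply => //; exact: cvg_cst.
have q_phi (g : nat -> V) (B : R) : (forall k, D (g k)) ->
    (exists n0, forall k, (n0 <= k)%N -> q (g k) (g k) <= B) ->
    (fun k => q (phi k) (g k)) @ \oo --> (0 : R).
  move=> Dg [n0 gB].
  suff : (fun k => q (phi (k + n0)%N) (g (k + n0)%N)) @ \oo --> (0 : R).
    by move=> h; rewrite -(cvg_shiftn n0); exact: h.
  apply: (@cvg0_sqr_le _ _ (fun k => k.+1%:R^-1 * B)).
    move=> k; apply: le_trans (psd_CS qP (Dphi _) (Dg _)) _.
    apply: ler_pM; rewrite ?(psd_ge0 qP)//; last by rewrite gB// leq_addl.
    have [_ /ltW h _] := phiP (k + n0)%N; apply: (le_trans h).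
    by rewrite lef_pV2 ?posrE// ler_nat ltnS leq_addr.
  by rewrite -[0](mul0r B); apply: cvgMl.
have uf j : (j < N)%N -> ip u (f j) = 0.
  move=> jN; have [fe fx fon] := fmu.
  have hj := fe j jN; have [Xfj [g gapp] _] := hj.
  have Dg k : D (g k) by case: gapp.
  have Xg k : X (g k) by exact: DX.
  have gf : (fun k => ip (g k - f j) (g k - f j)) @ \oo --> (0 : R) by case: gapp.
  have E1 := eigen_energy_cvg ipP EP DX AX hj Xu gapp uapp.
  have I1 := ip_cvg ipP Xphi Xu Xg Xfj phiu gf.
  have Pcvg (v : nat -> V) w : (forall k, D (v k)) -> X w ->
      (fun k => ip (v k - w) (v k - w)) @ \oo --> (0 : R) ->
      (fun k => P (v k) (g k)) @ \oo --> ip w (f j).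
    move=> Dv Xw vw; have Xv k : X (v k) by exact: DX.
    have -> : ip w (f j) = \sum_(i < N) ip w (f i) * ip (f j) (f i).
      rewrite (bigD1 (Ordinal jN))//= fon// eqxx mulr1 big1 ?addr0// => i ij.
      by rewrite fon// -[j == i]/(Ordinal jN == i) eq_sym (negbTE ij) mulr0.
    rewrite /P; apply: cvg_sumr => i; apply: cvgM.
      exact: (ip_cvgl ipP Xv Xw (Xf i) vw).
    exact: (ip_cvgl ipP Xg Xfj (Xf i) gf).
  (* The energy contributes [mu j] because [f j] is an eigenvector, the penalty [c0] because the
     [f i] are orthonormal. *)
  have Q1 : (fun k => q (phi k) (g k)) @ \oo -->
      mu j * ip (f j) u + c0 * ip u (f j) - lam * ip u (f j).
    rewrite /q /q0; apply: cvgB; last by apply: cvgMr.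
    apply: cvgD; last by apply: cvgMr; apply: Pcvg.
    rewrite (_ : (fun k => _) = (fun k => E (g k) (phi k)))//.
    by apply/funext => k; rewrite (psdC EP).
  have Q2 : exists l : R, (fun k => q (g k) (g k)) @ \oo --> l.
    exists (mu j * ip (f j) (f j) + c0 * ip (f j) (f j) - lam * ip (f j) (f j)).
    rewrite /q /q0; apply: cvgB; last first.
      by apply: cvgMr; exact: (ip_cvg ipP Xg Xfj Xg Xfj gf gf).
    apply: cvgD; last by apply: cvgMr; apply: Pcvg.
    exact: (eigen_energy_cvg ipP EP DX AX hj Xfj gapp gapp).
  have [l /cvgrPdist_le /(_ 1 ltr01)[n1 _ n1P]] := Q2.
  have Q0 : (fun k => q (phi k) (g k)) @ \oo --> (0 : R).
    apply: (q_phi g (l + 1)) => //; exists n1 => k /n1P.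
    by rewrite ler_norml => /andP[h _]; lra.
  have : mu j * ip (f j) u + c0 * ip u (f j) - lam * ip u (f j) = 0.
    exact: (cvg_unique (@norm_hausdorff _ R) Q1 Q0).
  rewrite (psdC ipP Xfj Xu) -mulrDl -mulrBl => /eqP.
  rewrite mulf_eq0 => /orP[/eqP h|/eqP//].
  (* From [mu j >= 0], [c0 = |x| + 1] and [lam <= x], the factor [mu j + c0 - lam] is at least
     [1]. *)
  have mu0 : 0 <= mu j.
    by apply: (eigen_ge0 ipP EP DX AX hj); rewrite fon// eqxx.
  by have := ler_norm x; have := lamx; rewrite /c0 in h; lra.
have ueig : weig lam u.
  split => //; first by exists phi.
  move=> psi Dpsi; have Xpsi := DX Dpsi.
  have Q0 : (fun k => q (phi k) psi) @ \oo --> (0 : R).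
    by apply: (q_phi (cst psi) (q psi psi)) => //; exists 0%N.
  (* Orthogonality to the [f i] removes the penalty in the limit, so that the Euler-Lagrange
     equation is that of the energy alone. *)
  have P0 : (fun k => P (phi k) psi) @ \oo --> (0 : R).
    rewrite -[0](@big1_eq _ 0 +%R _ (index_enum 'I_N) xpredT); apply: cvg_sumr => i.
    rewrite -[0](mul0r (ip psi (f i))); apply: cvgMl.
    by rewrite -(uf i)//; exact: (ip_cvgl ipP Xphi Xu (Xf i) phiu).
  have E0 : (fun k => E (phi k) psi) @ \oo --> ip u (A psi).
    rewrite (_ : (fun k => _) = (fun k => ip (phi k) (A psi))).
      exact: (ip_cvgl ipP Xphi Xu (AX Dpsi) phiu).
    by apply/funext => k; rewrite (psdC EP)// /energy (psdC ipP)//; exact: AX.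
  have I0 := ip_cvgl ipP Xphi Xu Xpsi phiu.
  have : (fun k => q (phi k) psi) @ \oo --> ip u (A psi) + c0 * 0 - lam * ip u psi.
    by apply: cvgB; [apply: cvgD => //; apply: cvgMr|apply: cvgMr].
  move=> /cvg_unique /(_ Q0) h; apply/eqP; rewrite -subr_eq0; apply/eqP.
  by rewrite -[RHS]h// mulr0 addr0.
by exists u, lam.
Qed.
End extend.
End eigen_extend.

(** * Counting eigenvalues with multiplicity *)

Section counting.
Context {R : realType} {V : lmodType R}.
Variables (X D : set V) (ip : V -> V -> R) (A : V -> V).
Notation E := (energy ip A).
Hypothesis ipP : psd_form X ip.
Hypothesis EP : psd_form D E.
Hypothesis DX : D `<=` X.
Hypothesis AX : forall u, D u -> X (A u).
Hypothesis AL : forall a u v, D u -> D v -> A (a *: u + v) = a *: A u + A v.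

Notation weig := (weak_eigenvector X D ip A).
Notation approx := (form_approx D ip A).

(** Independence modulo null vectors of [ip]; in L^2 this is independence of the almost everywhere
    classes. *)
Definition ip_free (k : nat) (u : 'I_k -> V) : Prop :=
  forall c : 'I_k -> R,
    ip (\sum_i c i *: u i) (\sum_i c i *: u i) = 0 -> forall i, c i = 0.

Definition eigen_dim (lam : R) : \bar R :=
  ereal_sup [set (k%:R)%:E | k in
    [set k : nat | exists u : 'I_k -> V, (forall i, weig lam (u i)) /\ ip_free u]].

Let quad_le (q : V -> V -> R) S (a : R) u v : psd_form S q -> S u -> S v ->
  q (a *: u + v) (a *: u + v) <= 2 * a ^+ 2 * q u u + 2 * q v v.
Proof.
move=> qP Su Sv.
have := psd_subr_le qP (psd_memZ qP a Su) (psd_memZ qP (-1) Sv).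
rewrite scaleN1r opprK (psdNN qP)// => h; apply: (le_trans h).
rewrite (psdZl qP)//; last exact: (psd_memZ qP).
by rewrite (psdZr qP)// expr2; lra.
Qed.

Lemma weak_eigenvectorL lam a u v : weig lam u -> weig lam v ->
  weig lam (a *: u + v).
Proof.
move=> [Xu [phi [Dphi phiu phiC]] ueig] [Xv [psi [Dpsi psiv psiC]] veig].
split; first exact: (psdL ipP).
  have dE k : (a *: phi k + psi k) - (a *: u + v) =
      a *: (phi k - u) + (psi k - v).
    by rewrite scalerBr opprD addrACA.
  have dE' k l : (a *: phi k + psi k) - (a *: phi l + psi l) =
      a *: (phi k - phi l) + (psi k - psi l).
    by rewrite scalerBr opprD addrACA.
  exists (fun k => a *: phi k + psi k); split.
  - by move=> k; apply: (psdL EP).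
  - apply: (@squeeze_cvgr _ _ _ _ (cst 0) (fun k =>
      2 * a ^+ 2 * ip (phi k - u) (phi k - u) + 2 * ip (psi k - v) (psi k - v))).
    + apply: nearW => k; rewrite dE.
      have Xp : X (phi k - u) by apply: (psd_memB ipP) => //; exact: DX.
      have Xq : X (psi k - v) by apply: (psd_memB ipP) => //; exact: DX.
      rewrite (quad_le _ ipP)// andbT; apply: (psd_ge0 ipP); exact: (psdL ipP).
    + exact: cvg_cst.
    + rewrite -[0]addr0 -[X in X + _](mulr0 (2 * a ^+ 2)) -[X in _ + X](mulr0 2).
      by apply: cvgD; apply: cvgMr.
  - move=> e e0.
    have d0 : 0 < e / (2 * a ^+ 2 + 2).
      by rewrite divr_gt0//; have := sqr_ge0 a; lra.
    have [N1 h1] := phiC _ d0; have [N2 h2] := psiC _ d0.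
    exists (maxn N1 N2) => k l; rewrite !geq_max => /andP[k1 k2] /andP[l1 l2].
    rewrite dE'; have Dk := psd_memB EP (Dphi k) (Dphi l).
    have Dl := psd_memB EP (Dpsi k) (Dpsi l).
    apply: le_lt_trans (quad_le _ EP Dk Dl) _.
    move: (h1 k l k1 l1) (h2 k l k2 l2).
    have : e / (2 * a ^+ 2 + 2) * (2 * a ^+ 2 + 2) = e.
      by rewrite divfK// gt_eqF//; have := sqr_ge0 a; lra.
    move: (E (phi k - phi l) _) (E (psi k - psi l) _) (e / _) => s t d de sd td.
    have : a ^+ 2 * s <= a ^+ 2 * d by rewrite ler_wpM2l ?sqr_ge0// ltW.
    by move: (a ^+ 2) de => b de bs; lra.
move=> xi Dxi; have Xxi := DX Dxi; have XA := AX Dxi.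
by rewrite !(psd_linear ipP)// ueig// veig//; ring.
Qed.

Lemma weak_eigenvector0 lam : weig lam 0.
Proof.
have X0 := psd0 ipP; have D0 := psd0 EP; split => //.
  exists (cst 0); split => //.
  - rewrite (_ : (fun k => _) = cst 0); first exact: cvg_cst.
    by apply/funext => k /=; rewrite subrr (psd0l ipP).
  - by move=> e e0; exists 0%N => k l _ _ /=; rewrite subrr (psd0l EP).
by move=> psi Dpsi; rewrite !(psd0l ipP) ?mulr0//; [exact: DX|exact: AX].
Qed.

(** A dimension count replaces Gram-Schmidt: as [m < k], some nontrivial combination of the [u i] is
    orthogonal to the [m] vectors already chosen, and freeness makes its norm positive. *)
Lemma eigen_orthonormalize lam (k : nat) (u : 'I_k -> V) :
  (forall i, weig lam (u i)) -> ip_free u ->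
  forall m, (m <= k)%N -> exists w : nat -> V,
    (forall i, (i < m)%N -> weig lam (w i)) /\
    forall i j, (i < m)%N -> (j < m)%N -> ip (w i) (w j) = (i == j)%:R.
Proof.
move=> ueig ufree; elim=> [|m ih] mk; first by exists (cst 0).
have [w [weig_w w_on]] := ih (ltnW mk).
have Xu i : X (u i) by case: (ueig i).
have Xw (j : 'I_m) : X (w j) by case: (weig_w _ (ltn_ord j)).
have [c [i0 ci0] cw] := left_kernel_vector (fun i j => ip (u i) (w j)) mk.
set v := \sum_i c i *: u i.
have vw j : (j < m)%N -> ip v (w j) = 0.
  by move=> jm; rewrite (psd_suml ipP)//; [exact: (cw (Ordinal jm))|exact: (Xw (Ordinal jm))].
have veig : weig lam v.
  rewrite /v; elim/big_rec : _ => [|i z _ zeig]; first exact: weak_eigenvector0.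
  exact: weak_eigenvectorL.
have Xv : X v by case: veig.
have v0 : 0 < ip v v.
  rewrite lt_neqAle (psd_ge0 ipP)// andbT eq_sym; apply/eqP => /ufree /(_ i0).
  by move/eqP; rewrite (negbTE ci0).
pose t := (Num.sqrt (ip v v))^-1.
have tt : t * (t * ip v v) = 1.
  by rewrite mulrA -expr2 exprVn sqr_sqrtr ?(ltW v0)// mulVf// gt_eqF.
have Xtv : X (t *: v) by exact: (psd_memZ ipP).
exists (fun i => if (i < m)%N then w i else t *: v); split.
  move=> i _; case: ifPn => im; first exact: weig_w.
  by rewrite -[_ *: _]addr0; apply: weak_eigenvectorL => //; exact: weak_eigenvector0.
move=> i j; rewrite !ltnS => im jm.
case: ifPn => im'; case: ifPn => jm'.
- exact: w_on.
- have Xwi := Xw (Ordinal im').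
  rewrite (psdC ipP)// (psdZl ipP)// vw// mulr0 (_ : i == j = false)//.
  by apply: contraNF jm' => /eqP <-.
- have Xwj := Xw (Ordinal jm').
  rewrite (psdZl ipP)// vw// mulr0 (_ : i == j = false)//.
  by apply: contraNF im' => /eqP ->.
- have -> : i = m by apply/eqP; rewrite eqn_leq im leqNgt.
  have -> : j = m by apply/eqP; rewrite eqn_leq jm leqNgt.
  by rewrite eqxx (psdZl ipP)// (psdZr ipP).
Qed.

Lemma eigen_dim_ge0 lam : (0 <= eigen_dim lam)%E.
Proof.
apply: ereal_sup_ubound; exists 0%N => //.
by exists (fun i : 'I_0 => 0); split => [[]//|c _ []].
Qed.

Definition eigen_count (x : R) : \bar R :=
  \esum_(lam in [set lam : R | lam <= x]) eigen_dim lam.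

(** The family is split by eigenvalue: over the distinct values [l], the multiplicities of [l] in
    [t] add up to [k], and the vectors with value [l], being orthonormal, are independent in its
    eigenspace. *)
Lemma eigen_count_ge x k f mu : eigen_orthonormal X D ip A x k f mu ->
  (k%:R%:E <= eigen_count x)%E.
Proof.
move=> [feig mux fon]; pose t := [seq mu i | i <- iota 0 k].
apply: esum_ge; exists [set` undup t].
  split; first exact: finite_seq.
  move=> l /=; rewrite mem_undup => /mapP[i]; rewrite mem_iota/= add0n => ik ->.
  exact: mux.
rewrite -fsbig_seq ?undup_uniq//.
apply: (@le_trans _ _ (\sum_(l <- undup t) (count_mem l t)%:R%:E)%E).
  rewrite sumEFin lee_fin -natr_sum ler_nat.
  rewrite -[X in (X <= _)%N](size_iota 0) -(size_map mu) -sum1_size.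
  rewrite -(big_undup_iterop_count addn t xpredT (fun=> 1%N)).
  by apply: leq_sum => l _; rewrite Monoid.iteropE; elim: (count_mem _ _).
apply: lee_sum => l _; apply: ereal_sup_ubound.
pose s := [seq i <- iota 0 k | mu i == l].
have sk (i : 'I_(size s)) : (nth 0%N s i < k)%N /\ mu (nth 0%N s i) = l.
  have : nth 0%N s i \in s by rewrite mem_nth.
  by rewrite mem_filter mem_iota/= add0n => /andP[/eqP ? ?].
exists (size s); last by rewrite size_filter count_map.
exists (fun i : 'I_(size s) => f (nth 0%N s i)); split => [i|c].
  by have [/feig + <-] := sk i.
have Xf i : X (f (nth 0%N s (i : 'I_(size s)))) by have [/feig[]] := sk i.
rewrite (psd_sum2 ipP)// => h i.
have : \sum_(j < size s) c j ^+ 2 = 0.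
  rewrite -[RHS]h; apply: eq_bigr => j _; rewrite (bigD1 j)//= fon; try exact: (sk j).1.
  rewrite eqxx mulr1 -expr2 big1 ?addr0// => m mj.
  rewrite fon; [|exact: (sk j).1|exact: (sk m).1].
  by rewrite nth_uniq// ?filter_uniq ?iota_uniq// eq_sym [(m : nat) == _](negbTE mj) mulr0.
move/eqP; rewrite psumr_eq0; last by move=> j _; exact: sqr_ge0.
by move/allP => /(_ i (mem_index_enum i)); rewrite /= sqrf_eq0 => /eqP.
Qed.

(** It suffices to bound sums over finite sets of eigenvalues. There, finite orthonormal families of
    the eigenspaces concatenate, because eigenvectors for different eigenvalues are orthogonal. *)
Lemma eigen_count_le x (y : \bar R) :
  (forall k f mu, eigen_orthonormal X D ip A x k f mu -> (k%:R%:E <= y)%E) ->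
  (eigen_count x <= y)%E.
Proof.
move=> ub; apply: ge_ereal_sup => _ [F [Ffin Fx] <-].
rewrite fsbig_finite//=.
(* Generalised for the induction on the list of eigenvalues: an orthonormal family whose eigenvalues
   avoid the rest of the list has already been collected. *)
suff H (s : seq R) : uniq s -> {in s, forall l, l <= x} ->
    forall k f mu, eigen_orthonormal X D ip A x k f mu ->
    (forall i, (i < k)%N -> mu i \notin s) ->
    (k%:R%:E + \sum_(l <- s) eigen_dim l <= y)%E.
  rewrite -[leLHS]add0e; apply: (H _ _ _ 0%N (cst 0) (cst 0)) => //.
  - exact: finmap.fset_uniq.
  - by move=> l; rewrite in_fset_set// inE; exact: Fx.
elim: s => [_ _ k f mu h _|l s ih /=/andP[ls us] sx k f mu kf mus].
  by rewrite big_nil adde0; exact: ub h.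
have lx : l <= x by apply: sx; rewrite mem_head.
have sx' : {in s, forall l, l <= x} by move=> z zs; apply: sx; rewrite inE zs orbT.
have S0 : (0 <= \sum_(l <- s) eigen_dim l)%E.
  by apply: sume_ge0 => z _; exact: eigen_dim_ge0.
have step j (u : 'I_j -> V) : (forall i, weig l (u i)) -> ip_free u ->
    ((k + j)%:R%:E + \sum_(l <- s) eigen_dim l <= y)%E.
  move=> ul uf; have [w [wl won]] := eigen_orthonormalize ul uf (leqnn j).
  have [fe fx fon] := kf.
  have sub i : (i < k + j)%N -> (i < k)%N = false -> (i - k < j)%N.
    by move=> ij /negbT; rewrite -leqNgt => ki; rewrite ltn_subLR.
  have notl i : (i < k)%N -> mu i != l.
    by move=> /mus; rewrite inE negb_or => /andP[].
  apply: (ih us sx' _ (fun i => if (i < k)%N then f i else w (i - k)%N)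
                      (fun i => if (i < k)%N then mu i else l)).
    split.
    - by move=> i ij; case: ifP => ik; [exact: fe|exact: (wl _ (sub _ ij ik))].
    - by move=> i ij; case: ifP => ik; [exact: fx|].
    - move=> i i' ij ij'; case: ifP => ik; case: ifP => ik'.
      + exact: fon.
      + rewrite (eigen_orthogonal ipP EP DX AX (notl _ ik) (fe _ ik) (wl _ (sub _ ij' ik'))).
        by rewrite (_ : i == i' = false)//; apply: contraFF ik' => /eqP <-.
      + have li' : l != mu i' by rewrite eq_sym notl.
        rewrite (eigen_orthogonal ipP EP DX AX li' (wl _ (sub _ ij ik)) (fe _ ik')).
        by rewrite (_ : i == i' = false)//; apply: contraFF ik => /eqP ->.
      + rewrite won ?sub// -(eqn_add2r k) !subnK//; by rewrite leqNgt (ik, ik').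
  move=> i ij; case: ifP => ik //.
  by have := mus i ik; rewrite inE negb_or => /andP[].
rewrite big_cons.
have step0 : (k%:R%:E + \sum_(l <- s) eigen_dim l <= y)%E.
  by rewrite -(addn0 k); apply: (step 0%N (fun=> 0)) => [[]//|c _ []].
(* For a finite bound, [step0] makes the remaining sum finite, so that it can be subtracted before
   the supremum over [j] is taken. *)
case: y ub ih step step0 => [r|_ _ _ _|]; [|exact: leey|]; last first.
  by move=> _ _ _; rewrite leeNy_eq; case: (\sum_(_ <- _) _)%E S0.
move=> ub ih step step0.
have Sfin : (\sum_(l <- s) eigen_dim l)%E \is a fin_num.
  rewrite ge0_fin_numE//; apply: le_lt_trans (ltry r).
  by apply: le_trans step0; rewrite leeDr// lee_fin.
have Sr : (\sum_(l <- s) eigen_dim l)%E = (fine (\sum_(l <- s) eigen_dim l)%E)%:E.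
  by rewrite fineK.
rewrite Sr in step step0 *; move: (fine _) step step0 => S step step0.
rewrite addeCA -EFinD -leeBrDr// -EFinB.
apply: ge_ereal_sup => _ [j [u [ul uf]] <-].
have := step j u ul uf; rewrite -!EFinD !lee_fin natrD; lra.
Qed.
End counting.

(** From the empty family on, [eigen_extend] adds one eigenvector at a time as long as fewer than
    [M] have been found. *)
Lemma energy_bounded_dim_le_eigen_count (R : realType) (V : lmodType R)
    (X D : set V) (ip : V -> V -> R) (A : V -> V) (x : R) (M : nat) :
  psd_form X ip -> psd_form D (energy ip A) -> D `<=` X ->
  (forall u, D u -> X (A u)) ->
  (forall phi : nat -> V, (forall k, D (phi k)) ->
    (forall e : R, 0 < e -> exists N : nat, forall k l : nat,
       (N <= k)%N -> (N <= l)%N -> ip (phi k - phi l) (phi k - phi l) < e) ->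
    exists2 u, X u & (fun k => ip (phi k - u) (phi k - u)) @ \oo --> (0 : R)) ->
  (forall y : R, exists K (C : R) (e : 'I_K -> V),
    [/\ 0 <= C, forall j, X (e j) & forall u, D u ->
      y * ip u u <= energy ip A u u + C * \sum_j ip u (e j) ^+ 2]) ->
  energy_bounded_dim D ip A x M -> (M%:R%:E <= eigen_count X D ip A x)%E.
Proof.
move=> ipP EP DX AX compl poinc xM.
suff H N : (N <= M)%N -> exists f mu, eigen_orthonormal X D ip A x N f mu.
  by have [f [mu h]] := H M (leqnn M); exact: (eigen_count_ge ipP h).
elim: N => [_|N ih NM].
  by exists (cst 0), (cst 0); split => // i; rewrite ltn0.
have [f [mu [fe fx fon]]] := ih (ltnW NM).
have [u [l [ul lx u1 uf]]] := eigen_extend ipP EP DX AX compl poinc xM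
  (And3 fe fx fon) NM.
exists (fun i => if (i < N)%N then f i else u).
exists (fun i => if (i < N)%N then mu i else l); split.
- by move=> i _; case: ifP => // iN; exact: fe.
- by move=> i _; case: ifP => // iN; exact: fx.
- move=> i j; rewrite !ltnS => im jm.
  have Xu : X u by case: ul.
  case: ifPn => iN; case: ifPn => jN.
  + exact: fon.
  + have Xi : X (f i) by case: (fe _ iN).
    rewrite (psdC ipP)// uf// (_ : i == j = false)//.
    by apply: contraNF jN => /eqP <-.
  + by rewrite uf// (_ : i == j = false)//; apply: contraNF iN => /eqP ->.
  + have -> : i = N by apply/eqP; rewrite eqn_leq im leqNgt.
    have -> : j = N by apply/eqP; rewrite eqn_leq jm leqNgt.
    by rewrite u1 eqxx.
Qed.

Lemma eigen_count_le_energy_bounded_dim (R : realType) (V : lmodType R)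
    (X D : set V) (ip : V -> V -> R) (A : V -> V) (x : R) (y : \bar R) :
  psd_form X ip -> psd_form D (energy ip A) -> D `<=` X ->
  (forall u, D u -> X (A u)) ->
  (forall a u v, D u -> D v -> A (a *: u + v) = a *: A u + A v) ->
  (forall k, energy_bounded_dim D ip A x k -> (k%:R%:E <= y)%E) ->
  (eigen_count X D ip A x <= y)%E.
Proof.
move=> ipP EP DX AX AL H; apply: (eigen_count_le ipP EP DX AX) => k f mu h.
exact: H (energy_bounded_dim_eigen ipP EP DX AX h).
Qed.

(** * Integration of bounded functions with bounded support *)

Lemma rV_cons0 (R : realType) n (p : 'rV[R]_n * measurableTypeR R) :
  rV_cons p ord0 ord0 = p.2.
Proof.
rewrite /rV_cons (_ : ord0 = lshift n (ord0 : 'I_1)); last exact/val_inj.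
by rewrite (@row_mxEl _ 1 1 n) mxE.
Qed.

Lemma rV_consS (R : realType) n (p : 'rV[R]_n * measurableTypeR R) (i : 'I_n) :
  rV_cons p ord0 (lift ord0 i) = p.1 ord0 i.
Proof.
rewrite /rV_cons (_ : lift ord0 i = rshift 1 i); last exact/val_inj.
by rewrite (@row_mxEr _ 1 1 n).
Qed.

Section bounded_support.
Context {R : realType}.
Implicit Types n : nat.

Definition centered_box n (B : R) : set 'rV[R]_n := [set x | forall i, `|x ord0 i| <= B].
Arguments centered_box : clear implicits.

(** One constant bounds both the values and the support. The class lies in L^1 and is closed under
    sums, products and slicing, so that Fubini applies to it without further integrability
    checks. *)
Definition bsupp n (f : 'rV[R]_n -> R) : Prop :=
  measurable_fun setT (f : 'rV[R]_n -> measurableTypeR R) /\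
  exists B : R, forall x, `|f x| <= B /\ ((exists i, B < `|x ord0 i|) -> f x = 0).

Definition bsupp1 (f : R -> R) : Prop :=
  measurable_fun setT (f : measurableTypeR R -> measurableTypeR R) /\
  exists B : R, forall t, `|f t| <= B /\ (B < `|t| -> f t = 0).

Definition integral_rV n (f : 'rV[R]_n -> R) : R :=
  (\int[@lebesgue_rV R n]_x f x)%R.

Definition integral_R (f : R -> R) : R := (\int[@lebesgue_measure R]_x f x)%R.

Lemma integral_rV_eq0 n (f : 'rV[R]_n -> R) : (forall x, f x = 0) -> integral_rV f = 0.
Proof.
move=> f0; rewrite /integral_rV (eq_Rintegral _ (g := fun=> 0)) => [|x _ //].
by rewrite Rintegral_cst ?mul0r.
Qed.

Lemma integral_R_eq0 (f : R -> R) : (forall x, f x = 0) -> integral_R f = 0.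
Proof.
move=> f0; rewrite /integral_R (eq_Rintegral _ (g := fun=> 0)) => [|x _ //].
by rewrite Rintegral_cst ?mul0r.
Qed.

Lemma measurable_centered_box n B : measurable (centered_box n B).
Proof.
rewrite (_ : centered_box n B = \bigcap_(i in [set: 'I_n]) (rV_coord i @^-1` `[- B, B])).
  apply: fin_bigcap_measurable => // i _.
  by rewrite -[X in measurable X]setTI; apply: measurable_rV_coord => //; exact: measurable_itv.
apply/seteqP; split => [x xB i _|x xB i] /=; first by rewrite in_itv/= -ler_norml xB.
by have := xB i I; rewrite /= in_itv/= -ler_norml.
Qed.

Lemma lebesgue_measure_segment_lty (a b : R) : (@lebesgue_measure R `[a, b]%classic < +oo)%E.
Proof. by rewrite lebesgue_measure_itv/=; case: ifP => _; rewrite ?ltry// -EFinB ltry. Qed.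

Lemma lebesgue_rV_centered_box n B : (lebesgue_rV n (centered_box n B) < +oo)%E.
Proof.
elim: n => [|n ih] /=; first by rewrite diracE ltry.
rewrite /lebesgue_rV_succ /pushforward.
have -> : @rV_cons R n @^-1` centered_box n.+1 B = centered_box n B `*` `[- B, B].
  apply/seteqP; split => [[y t] /= yt|[y t] /= [yB tB] i].
    split; first by move=> i; have := yt (lift ord0 i); rewrite rV_consS.
    by have := yt ord0; rewrite rV_cons0 /= in_itv/= -ler_norml.
  case: (unliftP ord0 i) => [j ->|->]; rewrite ?rV_consS//= rV_cons0/=.
  by move: tB; rewrite in_itv/= -ler_norml.
rewrite product_measure1E//; last exact: measurable_centered_box.
have itvB := lebesgue_measure_segment_lty (- B) B.
by apply: lte_mul_pinfty => //; rewrite ge0_fin_numE.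
Qed.

Lemma lebesgue_rV_sigma_finite n : sigma_finite setT (@lebesgue_rV R n).
Proof.
exists (fun k : nat => centered_box n k%:R).
  apply/esym/seteqP; split => // x _.
  have [k kx] : exists k : nat, forall i : 'I_n, `|x ord0 i| <= k%:R.
    exists (\max_(i < n) (Num.truncn `|x ord0 i|).+1)%N => i.
    apply: ltW; apply: lt_le_trans (truncnS_gt _) _.
    by rewrite ler_nat (leq_bigmax (F := fun i => (Num.truncn `|x ord0 i|).+1)).
  by exists k.
by move=> k; split; [exact: measurable_centered_box|exact: lebesgue_rV_centered_box].
Qed.

Lemma integrable_bounded_support d (T : measurableType d)
    (mu : {measure set T -> \bar R}) (f : T -> R) (A : set T) B :
  measurable_fun setT f -> measurable A -> (mu A < +oo)%E ->
  (forall x, `|f x| <= B) -> (forall x, ~ A x -> f x = 0) ->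
  mu.-integrable setT (EFin \o f).
Proof.
move=> mf mA Afin fB f0.
have fA : EFin \o f = (EFin \o f) \_ A.
  apply/funext => x; rewrite patchE; case: ifPn => // /negP xA /=.
  by rewrite f0// => Ax; apply: xA; rewrite inE.
rewrite fA; apply: (iffLR (integrable_mkcond _ mA)).
apply: measurable_bounded_integrable => //; first exact: measurable_funTS.
exists B; split; first by rewrite num_real.
by move=> M BM x _; apply: le_trans (fB x) (ltW BM).
Qed.

Lemma normr_Rintegral_bounded_support d (T : measurableType d)
    (mu : {measure set T -> \bar R}) (f : T -> R) (A : set T) B :
  measurable_fun setT f -> measurable A -> (mu A < +oo)%E ->
  (forall x, `|f x| <= B) -> (forall x, ~ A x -> f x = 0) ->
  `|(\int[mu]_x f x)%R| <= B * fine (mu A).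
Proof.
move=> mf mA Afin fB f0.
have fi := integrable_bounded_support mf mA Afin fB f0.
apply: le_trans (le_normr_Rintegral _ fi) _ => //.
have -> : (\int[mu]_x `|f x| = \int[mu]_(x in A) `|f x|)%R.
  rewrite [RHS]Rintegral_mkcond; apply: eq_Rintegral => x _.
  rewrite patchE; case: ifPn => // /negP xA.
  by rewrite f0 ?normr0// => Ax; apply: xA; rewrite inE.
rewrite -Rintegral_cst//; apply: le_Rintegral => //.
- by apply: integrable_norm; apply: integrableS fi.
- apply: measurable_bounded_integrable => //.
  by exists `|B|; split; [rewrite num_real|move=> M BM x _; exact: ltW].
Qed.

Lemma bsupp_integrable n (f : 'rV[R]_n -> R) : bsupp f ->
  (@lebesgue_rV R n).-integrable setT (EFin \o f).
Proof.
move=> [mf [B fB]].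
apply: (@integrable_bounded_support _ _ _ _ (centered_box n B) B) => //.
- exact: measurable_centered_box.
- exact: lebesgue_rV_centered_box.
- by move=> x; case: (fB x).
- move=> x /existsNP[i /negP]; rewrite -ltNge => xi.
  by have [_] := fB x; apply; exists i.
Qed.

Lemma bsupp1_integrable f : bsupp1 f ->
  (@lebesgue_measure R).-integrable setT (EFin \o f).
Proof.
move=> [mf [B fB]].
apply: (@integrable_bounded_support _ (measurableTypeR R) (@lebesgue_measure R) f `[- B, B]%classic B) => //.
- exact: lebesgue_measure_segment_lty.
- by move=> x; case: (fB x).
- move=> x /negP; rewrite /= in_itv/= -ler_norml -ltNge => xi.
  by have [_] := fB x; apply.
Qed.

Lemma bsupp0 n : bsupp (fun _ : 'rV[R]_n => 0).
Proof.
split; first exact: measurable_cst.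
by exists 0 => x; rewrite normr0.
Qed.

Lemma bsuppD n (f g : 'rV[R]_n -> R) : bsupp f -> bsupp g -> bsupp (fun x => f x + g x).
Proof.
move=> [mf [B fB]] [mg [C gC]]; split; first exact: measurable_funD.
have B0 : 0 <= B by have [h _] := fB 0; exact: le_trans h.
have C0 : 0 <= C by have [h _] := gC 0; exact: le_trans h.
exists (B + C) => x; have [f1 f2] := fB x; have [g1 g2] := gC x; split.
  by apply: le_trans (ler_normD _ _) (lerD _ _).
by move=> [i xi]; rewrite f2 ?g2 ?addr0//; exists i; apply: le_lt_trans xi; lra.
Qed.

Lemma bsuppM n (f g : 'rV[R]_n -> R) : bsupp f ->
  measurable_fun setT (g : 'rV[R]_n -> measurableTypeR R) ->
  (exists C, forall x, `|g x| <= C) -> bsupp (fun x => f x * g x).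
Proof.
move=> [mf [B fB]] mg [C gC]; split; first exact: measurable_funM.
have B0 : 0 <= B by have [h _] := fB 0; exact: le_trans h.
have C0 : 0 <= C by exact: le_trans (gC 0).
exists (B + B * C) => x; have [f1 f2] := fB x; split.
  rewrite normrM; apply: le_trans (ler_pM _ _ f1 (gC x)) _ => //; lra.
move=> [i xi]; rewrite f2 ?mul0r//; exists i; apply: le_lt_trans xi.
by rewrite lerDl mulr_ge0.
Qed.

Lemma bsupp_bounded n (f : 'rV[R]_n -> R) : bsupp f -> exists C, forall x, `|f x| <= C.
Proof. by move=> [_ [B fB]]; exists B => x; case: (fB x). Qed.

Lemma bsuppMM n (f g : 'rV[R]_n -> R) : bsupp f -> bsupp g -> bsupp (fun x => f x * g x).
Proof. by move=> fS gS; apply: bsuppM => //; [case: gS|exact: bsupp_bounded]. Qed.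

Lemma bsuppZ n c (f : 'rV[R]_n -> R) : bsupp f -> bsupp (fun x => c * f x).
Proof.
move=> fS; rewrite (_ : (fun x => _) = (fun x => f x * c)).
  by apply: bsuppM => //; exists `|c|.
by apply/funext => x; rewrite mulrC.
Qed.

Lemma bsupp_sum n (I : Type) (r : seq I) (f : I -> 'rV[R]_n -> R) :
  (forall i, bsupp (f i)) -> bsupp (fun x => \sum_(i <- r) f i x).
Proof.
move=> fS; elim: r => [|i r ih].
  rewrite (_ : (fun x => _) = fun=> 0); first exact: bsupp0.
  by apply/funext => x; rewrite big_nil.
rewrite (_ : (fun x => _) = fun x => f i x + \sum_(j <- r) f j x); first exact: bsuppD.
by apply/funext => x; rewrite big_cons.
Qed.

Lemma integral_rVD n (f g : 'rV[R]_n -> R) : bsupp f -> bsupp g ->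
  integral_rV (fun x => f x + g x) = integral_rV f + integral_rV g.
Proof. by move=> fS gS; rewrite /integral_rV RintegralD//; exact: bsupp_integrable. Qed.

Lemma integral_rVZ n c (f : 'rV[R]_n -> R) : bsupp f ->
  integral_rV (fun x => c * f x) = c * integral_rV f.
Proof. by move=> fS; rewrite /integral_rV RintegralZl//; exact: bsupp_integrable. Qed.

Lemma integral_rV_sum n (I : Type) (r : seq I) (f : I -> 'rV[R]_n -> R) :
  (forall i, bsupp (f i)) ->
  integral_rV (fun x => \sum_(i <- r) f i x) = \sum_(i <- r) integral_rV (f i).
Proof.
move=> fS; elim: r => [|i r ih].
  by rewrite big_nil integral_rV_eq0// => x; rewrite big_nil.
rewrite big_cons -ih -integral_rVD//; last exact: bsupp_sum.
by congr (integral_rV _); apply/funext => x; rewrite big_cons.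
Qed.

Lemma le_integral_rV n (f g : 'rV[R]_n -> R) : bsupp f -> bsupp g ->
  (forall x, f x <= g x) -> integral_rV f <= integral_rV g.
Proof. by move=> fS gS fg; apply: le_Rintegral => //; exact: bsupp_integrable. Qed.

Lemma integral_rV_ge0 n (f : 'rV[R]_n -> R) : (forall x, 0 <= f x) -> 0 <= integral_rV f.
Proof. by move=> f0; apply: Rintegral_ge0. Qed.


(** A copy of [lebesgue_rV] with its own head constant, on which the sigma-finite structure required
    by Fubini is registered. *)
Definition rV_measure n : set 'rV[R]_n -> \bar R := lebesgue_rV n.

HB.instance Definition _ n := Measure.copy (@rV_measure n) (@lebesgue_rV R n).

HB.instance Definition _ n := Measure_isSigmaFinite.Build _ _ _
  (@rV_measure n) (lebesgue_rV_sigma_finite n).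

Section fubini.
Variables (n : nat) (f : 'rV[R]_n.+1 -> R).
Hypothesis fS : bsupp f.

Let g (p : 'rV[R]_n * measurableTypeR R) : R := f (rV_cons p).

Let mg : measurable_fun setT g.
Proof. by apply: measurableT_comp; [case: fS|exact: measurable_rV_cons]. Qed.

Lemma bsupp_slice t : bsupp (fun y => f (rV_cons (y, t))).
Proof.
split; first by apply: (measurable_fun_pair1 (f := g)).
have [_ [B fB]] := fS; exists B => y; have [h1 h2] := fB (rV_cons (y, t)).
by split=> // -[i yi]; apply: h2; exists (lift ord0 i); rewrite rV_consS.
Qed.

Lemma bsupp1_slice y : bsupp1 (fun t => f (rV_cons (y, t))).
Proof.
split; first by apply: (measurable_fun_pair2 (f := g)).
have [_ [B fB]] := fS; exists B => t; have [h1 h2] := fB (rV_cons (y, t)).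
by split=> // ti; apply: h2; exists ord0; rewrite rV_cons0.
Qed.

Let mu := @rV_measure n.
Let nu := @lebesgue_measure R.

Let g_int : (mu \x nu)%E.-integrable setT (EFin \o g).
Proof.
have [mf [B fB]] := fS.
apply: (@integrable_bounded_support _ ('rV[R]_n * measurableTypeR R)%type (mu \x nu)%E g
  (centered_box n B `*` `[- B, B]%classic) B) => //.
- by apply: measurableX => //; exact: measurable_centered_box.
- have itvB := lebesgue_measure_segment_lty (- B) B.
  have boxB : (mu (centered_box n B) < +oo)%E by exact: lebesgue_rV_centered_box.
  have h : (mu (centered_box n B) * nu `[(- B)%R, B]%classic < +oo)%E.
    by apply: lte_mul_pinfty => //; rewrite ge0_fin_numE.
  rewrite -(@product_measure1E _ _ _ _ _ mu nu) in h; [exact: h| |by []].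
  exact: measurable_centered_box.
- by move=> x; case: (fB (rV_cons x)).
- move=> [y t] yt; have [_] := fB (rV_cons (y, t)); apply.
  apply: contrapT => /forallNP h; apply: yt; split => [i|] /=.
    by have /negP := h (lift ord0 i); rewrite rV_consS -leNgt.
  by have /negP := h ord0; rewrite rV_cons0 /= -leNgt in_itv/= -ler_norml.
Qed.

Lemma integral_rV_prod : integral_rV f = fine (\int[mu \x nu]_p (g p)%:E)%E.
Proof.
rewrite /integral_rV /Rintegral; congr fine.
rewrite [lebesgue_rV _]/= (integral_pushforward (@measurable_rV_cons R n)) //.
by apply/measurable_EFinP; case: fS.
Qed.

Lemma integral_rV_slice : integral_rV f =
  integral_R (fun t => integral_rV (fun y => f (rV_cons (y, t)))).
Proof.
rewrite integral_rV_prod -integral21_prod_meas1//.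
rewrite /integral_R /Rintegral; congr fine; apply: eq_integral => t _.
rewrite /fubini_G fineK//; apply: integrable_fin_num => //.
exact: (bsupp_integrable (bsupp_slice t)).
Qed.

Lemma integral_rV_slice' : integral_rV f =
  integral_rV (fun y => integral_R (fun t => f (rV_cons (y, t)))).
Proof.
rewrite integral_rV_prod -integral12_prod_meas1//.
rewrite /integral_rV /Rintegral; congr fine; apply: eq_integral => y _.
rewrite /fubini_F fineK//; apply: integrable_fin_num => //.
exact: (bsupp1_integrable (bsupp1_slice y)).
Qed.

Lemma bsupp1_integral_slice : bsupp1 (fun t => integral_rV (fun y => f (rV_cons (y, t)))).
Proof.
split.
  by apply: measurableT_comp => //; exact: (measurable_fubini_G g_int).
have [_ [B fB]] := fS.
have B0 : 0 <= B by have [h _] := fB 0; exact: le_trans h.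
pose C := fine (mu (centered_box n B)).
have C0 : 0 <= C by rewrite fine_ge0.
exists (B + B * C) => t; split.
  apply: (@le_trans _ _ (B * C)); last by lra.
  apply: normr_Rintegral_bounded_support.
  - by case: (bsupp_slice t).
  - exact: measurable_centered_box.
  - exact: lebesgue_rV_centered_box.
  - by move=> y; case: (fB (rV_cons (y, t))).
  - move=> y /existsNP[i /negP]; rewrite -ltNge => yi.
    by have [_] := fB (rV_cons (y, t)); apply; exists (lift ord0 i); rewrite rV_consS.
move=> Bt; apply: integral_rV_eq0 => y.
have [_] := fB (rV_cons (y, t)); apply.
by exists ord0; rewrite rV_cons0/=; apply: le_lt_trans Bt; rewrite lerDl mulr_ge0.
Qed.

Lemma bsupp_integral_slice : bsupp (fun y => integral_R (fun t => f (rV_cons (y, t)))).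
Proof.
split.
  by apply: measurableT_comp => //; exact: (measurable_fubini_F g_int).
have [_ [B fB]] := fS.
have B0 : 0 <= B by have [h _] := fB 0; exact: le_trans h.
pose C := fine (nu `[- B, B]%classic).
have C0 : 0 <= C by rewrite fine_ge0.
exists (B + B * C) => y; split.
  apply: (@le_trans _ _ (B * C)); last by lra.
  apply: (@normr_Rintegral_bounded_support _ (measurableTypeR R)).
  - by case: (bsupp1_slice y).
  - exact: measurable_itv.
  - exact: lebesgue_measure_segment_lty.
  - by move=> t; case: (fB (rV_cons (y, t))).
  - move=> t /negP; rewrite /= in_itv/= -ler_norml -ltNge => ti.
    by have [_] := fB (rV_cons (y, t)); apply; exists ord0; rewrite rV_cons0.
move=> [i Bi]; apply: integral_R_eq0 => t.
have [_] := fB (rV_cons (y, t)); apply.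
exists (lift ord0 i); rewrite rV_consS/=; apply: le_lt_trans Bi.
by rewrite lerDl mulr_ge0.
Qed.

End fubini.
End bounded_support.

Arguments centered_box {R} n B.

(** * Continuous functions: measurability and restriction to lines *)

Lemma rV_ballP (R : realType) n (x y : 'rV[R]_n) e :
  0 < e -> ball x e y <-> forall i, `|x ord0 i - y ord0 i| < e.
Proof.
move=> e0; split=> [[_ h] i|h]; first exact: h.
by split => // i j; rewrite ord1; exact: h.
Qed.

(** The sigma-algebra is generated by the coordinates, so an open set has to be written as a
    countable union of boxes, here with rational centres and half-sides [1 / (k + 1)]. *)
Lemma measurable_open_rV (R : realType) n (U : set 'rV[R]_n) :
  open U -> measurable U.
Proof.
move=> oU.
pose box (qk : {ffun 'I_n -> rat} * nat) : set 'rV[R]_n :=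
  [set x | forall i, `|ratr (qk.1 i) - x ord0 i| < qk.2.+1%:R^-1].
have mbox qk : measurable (box qk).
  rewrite (_ : box qk = \bigcap_(i in [set: 'I_n]) (rV_coord i @^-1`
      `]ratr (qk.1 i) - qk.2.+1%:R^-1, ratr (qk.1 i) + qk.2.+1%:R^-1[)).
    apply: fin_bigcap_measurable => // i _.
    by rewrite -[X in measurable X]setTI; apply: measurable_rV_coord => //; exact: measurable_itv.
  apply/seteqP; split => [x xB i _|x xB i] /=.
    by have := xB i; rewrite /rV_coord in_itv/= distrC ltr_distl.
  by have := xB i I; rewrite /= /rV_coord in_itv/= distrC ltr_distl.
rewrite (_ : U = \bigcup_qk (if `[< box qk `<=` U >] then box qk else set0)).
  apply: countable_bigcupT_measurable; first exact: countableP.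
  by move=> qk; case: ifP.
apply/seteqP; split => [x Ux|x [qk _]]; last first.
  by case: ifPn => // /asboolP; apply.
have /nbhs_ballP[e /= e0 eU] : nbhs x U by exact: open_nbhs_nbhs.
have e20 : 0 < e / 2 by rewrite divr_gt0.
have [k _ kP] := near_infty_natSinv_lt (PosNum e20).
have k0 : 0 < k.+1%:R^-1 :> R by rewrite invr_gt0.
have /choice[q qP] : forall i : 'I_n, exists q : rat, `|ratr q - x ord0 i| < k.+1%:R^-1.
  move=> i; have /rat_in_itvoo[q] : x ord0 i - k.+1%:R^-1 < x ord0 i + k.+1%:R^-1.
    by rewrite ltrBlDr -addrA ltrDl addr_gt0.
  by rewrite in_itv/= => qx; exists q; rewrite ltr_distl.
exists ([ffun i => q i], k) => //; rewrite ifT.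
  by move=> i /=; rewrite ffunE.
apply/asboolP => y yq; apply: eU; apply/rV_ballP => // i.
have := yq i; rewrite /= ffunE => h1; have h2 := qP i.
have h3 := kP k (leqnn k); rewrite /= in h3.
rewrite -(subrKA (ratr (q i))); apply: le_lt_trans (ler_normD _ _) _.
rewrite [X in X + _]distrC.
by apply: lt_trans (ltrD h2 h1) _; rewrite [ltRHS]splitr ltrD.
Qed.

Lemma continuous_measurable_rV (R : realType) n (f : 'rV[R]_n -> R) :
  continuous f -> measurable_fun setT (f : 'rV[R]_n -> measurableTypeR R).
Proof.
move=> cf; apply: (measurability _ (RGenOpens.measurableE R)) => _ [_ [a [b ->] <-]].
rewrite setTI; apply: measurable_open_rV; by apply: open_comp => // x _; exact: cf.
Qed.

Section bounded_support_continuous.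
Context {R : realType}.

Definition supp_bounded n (f : 'rV[R]_n -> R) : Prop :=
  exists B : R, forall x : 'rV[R]_n, (exists i, B < `|x ord0 i|) -> f x = 0.

Lemma compact_centered_box n (B : R) : compact (centered_box n B).
Proof.
rewrite (_ : centered_box n B = [set v : 'rV[R]_n | forall j, `[- B, B]%classic (v ord0 j)]).
  by apply: (@rV_compact _ _ (fun=> `[- B, B]%classic)) => j; exact: segment_compact.
by apply/seteqP; split => x h i; have := h i; rewrite /= in_itv/= -ler_norml.
Qed.

Lemma bsupp_continuous n (f : 'rV[R]_n -> R) : continuous f -> supp_bounded f -> bsupp f.
Proof.
move=> cf [B fB]; split; first exact: continuous_measurable_rV.
have [C [_ fC]] : bounded_set (f @` centered_box n B).
  apply: compact_bounded; apply: continuous_compact; last exact: compact_centered_box.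
  by apply: continuous_subspaceT => x; exact: cf.
exists (`|B| + (`|C| + 1)) => x; split; last first.
  move=> [i xi]; apply: fB; exists i; apply: le_lt_trans xi.
  by have := ler_norm B; have := normr_ge0 C; lra.
have [xB|/existsNP[i /negP]] := pselect (centered_box n B x); last first.
  by rewrite -ltNge => xi; rewrite fB ?normr0; [rewrite !addr_ge0|exists i].
apply: (@le_trans _ _ (`|C| + 1)); last by have := normr_ge0 B; lra.
by apply: fC; [have := ler_norm C; lra|exists x].
Qed.

Lemma bsupp1_continuous (f : R -> R) B : continuous f -> (forall t, B < `|t| -> f t = 0) ->
  bsupp1 f.
Proof.
move=> cf fB; split; first exact: continuous_measurable_fun.
have [C [_ fC]] : bounded_set (f @` `[- B, B]%classic).
  apply: compact_bounded; apply: continuous_compact; last exact: segment_compact.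
  by apply: continuous_subspaceT => x; exact: cf.
exists (`|B| + (`|C| + 1)) => x; split; last first.
  move=> xi; apply: fB; apply: le_lt_trans xi.
  by have := ler_norm B; have := normr_ge0 C; lra.
have [xB|xB] := leP `|x| B; last by rewrite fB ?normr0// !addr_ge0.
apply: (@le_trans _ _ (`|C| + 1)); last by have := normr_ge0 B; lra.
apply: fC; first by have := ler_norm C; lra.
by exists x => //=; rewrite in_itv/= -ler_norml.
Qed.

Lemma rV_cons_continuous1 n t : continuous (fun y : 'rV[R]_n => rV_cons (y, t)).
Proof.
move=> y A /nbhs_ballP[e /= e0 eA].
apply/nbhs_ballP; exists e => //= z /(rV_ballP _ _ e0) yz.
apply: eA; apply/rV_ballP => // i; case: (unliftP ord0 i) => [j ->|->].
  by rewrite !rV_consS/=; exact: yz.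
by rewrite !rV_cons0 subrr normr0.
Qed.

Lemma rV_cons_continuous2 n (y : 'rV[R]_n) : continuous (fun t : R => rV_cons (y, t)).
Proof.
move=> t A /nbhs_ballP[e /= e0 eA].
apply/nbhs_ballP; exists e => //= s ts.
apply: eA; apply/rV_ballP => // i; case: (unliftP ord0 i) => [j ->|->].
  by rewrite !rV_consS/= subrr normr0.
by rewrite !rV_cons0.
Qed.

(** A directional derivative only sees the restriction to a line; both its value and its existence
    are transferred to a function of one variable. *)
Lemma derive_line n (f : 'rV[R]_n -> R) (g : R -> R) (v x : 'rV[R]_n) (a : R) :
  (forall h, f (h *: v + x) = g (h + a)) ->
  'D_v f x = derive1 g a /\ (derivable f x v <-> derivable g a 1).
Proof.
move=> fg; have fx : f x = g a by have := fg 0; rewrite scale0r !add0r.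
have E : (fun h => h^-1 *: (f (h *: v + x) - f x)) = (fun h => h^-1 *: (g (h + a) - g a)).
  by apply/funext => h; rewrite fg fx.
have E1 : (fun h => h^-1 *: (g (h *: 1 + a) - g a)) = (fun h => h^-1 *: (g (h + a) - g a)).
  by apply/funext => h; rewrite -[h *: 1]/(h * 1) mulr1.
split; first by rewrite /derive derive1E /derive /= E E1.
by rewrite /derivable /= E E1.
Qed.

End bounded_support_continuous.

Section bounded_support_line.
Context {R : realType}.

Lemma bsupp1D (f g : R -> R) : bsupp1 f -> bsupp1 g -> bsupp1 (fun x => f x + g x).
Proof.
move=> [mf [B fB]] [mg [C gC]]; split; first exact: measurable_funD.
have B0 : 0 <= B by have [h _] := fB 0; exact: le_trans h.
have C0 : 0 <= C by have [h _] := gC 0; exact: le_trans h.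
exists (B + C) => x; have [f1 f2] := fB x; have [g1 g2] := gC x; split.
  by apply: le_trans (ler_normD _ _) (lerD _ _).
by move=> xi; rewrite f2 ?g2 ?addr0//; apply: le_lt_trans xi; lra.
Qed.

Lemma bsupp1M (f g : R -> R) : bsupp1 f ->
  measurable_fun setT (g : measurableTypeR R -> measurableTypeR R) ->
  (exists C, forall x, `|g x| <= C) -> bsupp1 (fun x => f x * g x).
Proof.
move=> [mf [B fB]] mg [C gC]; split; first exact: measurable_funM.
have B0 : 0 <= B by have [h _] := fB 0; exact: le_trans h.
have C0 : 0 <= C by exact: le_trans (gC 0).
exists (B + B * C) => x; have [f1 f2] := fB x; split.
  rewrite normrM; apply: le_trans (ler_pM _ _ f1 (gC x)) _ => //; lra.
move=> xi; rewrite f2 ?mul0r//; apply: le_lt_trans xi.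
by rewrite lerDl mulr_ge0.
Qed.

Lemma bsupp1_bounded (f : R -> R) : bsupp1 f -> exists C, forall x, `|f x| <= C.
Proof. by move=> [_ [B fB]]; exists B => x; case: (fB x). Qed.

Lemma bsupp1MM (f g : R -> R) : bsupp1 f -> bsupp1 g -> bsupp1 (fun x => f x * g x).
Proof. by move=> fS gS; apply: bsupp1M => //; [case: gS|exact: bsupp1_bounded]. Qed.

Lemma bsupp1Z c (f : R -> R) : bsupp1 f -> bsupp1 (fun x => c * f x).
Proof.
move=> fS; rewrite (_ : (fun x => _) = (fun x => f x * c)).
  by apply: bsupp1M => //; exists `|c|.
by apply/funext => x; rewrite mulrC.
Qed.

Lemma bsupp1_indic (i : interval R) B : (forall t, t \in i -> `|t| <= B) ->
  bsupp1 (\1_[set` i] : R -> R).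
Proof.
move=> iB; split; first exact: measurable_indic (measurable_itv i).
exists (1 + `|B|) => t; rewrite indicE; case: (boolP (t \in [set` i])) => ti; split.
- by rewrite normr1 lerDl.
- move: ti; rewrite inE/= => /iB tB; have := ler_norm B; lra.
- by rewrite normr0 addr_ge0.
- by [].
Qed.

Lemma integral_RD (f g : R -> R) : bsupp1 f -> bsupp1 g ->
  integral_R (fun x => f x + g x) = integral_R f + integral_R g.
Proof. by move=> fS gS; rewrite /integral_R RintegralD//; exact: bsupp1_integrable. Qed.

Lemma integral_RZ c (f : R -> R) : bsupp1 f ->
  integral_R (fun x => c * f x) = c * integral_R f.
Proof. by move=> fS; rewrite /integral_R RintegralZl//; exact: bsupp1_integrable. Qed.

Lemma le_integral_R (f g : R -> R) : bsupp1 f -> bsupp1 g ->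
  (forall x, f x <= g x) -> integral_R f <= integral_R g.
Proof. by move=> fS gS fg; apply: le_Rintegral => //; exact: bsupp1_integrable. Qed.

Lemma integral_R_indic_co (a h : R) : 0 <= h -> integral_R (\1_(`[a, a + h[%classic)) = h.
Proof.
move=> h0; rewrite /integral_R /Rintegral integral_indic ?setIT//.
transitivity (fine (@lebesgue_measure R `[a, a + h[%classic)); first by [].
rewrite lebesgue_measure_itv/= lte_fin; case: ifPn => [_|].
  by rewrite -EFinB/= addrAC subrr add0r.
by rewrite -leNgt gerDl => h1; apply/esym/eqP; rewrite eq_le h0 h1.
Qed.

Lemma integral_R_indic A (f : R -> R) :
  integral_R (fun r => \1_A r * f r) = (\int[lebesgue_measure]_(r in A) f r)%R.
Proof.
rewrite [RHS]Rintegral_mkcond; apply: eq_Rintegral => r _.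
by rewrite indicE patchE; case: ifPn; rewrite ?mul1r ?mul0r.
Qed.

Lemma FTC_indic (F f : R -> R) s t : s <= t -> continuous f ->
  (forall a, derivable F a 1) -> (forall a, derive1 F a = f a) ->
  F t - F s = integral_R (fun r => \1_(`[s, t]%classic) r * f r).
Proof.
rewrite le_eqVlt integral_R_indic => /predU1P[->|st] cf dF F'.
  by rewrite subrr set_itv1 Rintegral_set1.
have cF : continuous F.
  by move=> a; apply: differentiable_continuous; apply/derivable1_diffP; exact: dF.
rewrite /Rintegral (@continuous_FTC2 R f F s t st)//.
- by apply: continuous_subspaceT => a; exact: cf.
- split.
  + by move=> a _; exact: dF.
  + by apply: cvg_at_right_filter; exact: cF.
  + by apply: cvg_at_left_filter; exact: cF.
Qed.

End bounded_support_line.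

(** * Weak gradients along coordinate lines *)

Section weak_gradient.
Context {R : realType}.

(* Stated through the fundamental theorem of calculus on lines, so that the
   Poincare inequalities follow by induction on the dimension and Fubini,
   without differentiation under the integral sign. *)
Fixpoint weak_grad n : ('rV[R]_n -> R) -> ('I_n -> 'rV[R]_n -> R) -> Prop :=
  match n with
  | 0 => fun u _ => bsupp u
  | m.+1 => fun u g =>
    [/\ bsupp u, forall i, bsupp (g i),
        forall y s t, s <= t -> u (rV_cons (y, t)) - u (rV_cons (y, s)) =
          integral_R (fun r => \1_(`[s, t]%classic) r * g ord0 (rV_cons (y, r))) &
        forall t, weak_grad (fun y => u (rV_cons (y, t)))
                            (fun i y => g (lift ord0 i) (rV_cons (y, t)))]
  end.

Lemma weak_grad_bsupp n (u : 'rV[R]_n -> R) g : weak_grad u g -> bsupp u.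
Proof. by case: n u g => [//|n] u g /= []. Qed.

Lemma weak_grad_bsupp_grad n (u : 'rV[R]_n -> R) g : weak_grad u g -> forall i, bsupp (g i).
Proof. by case: n u g => [|n] u g /=; [move=> _ []|case]. Qed.

Definition pderiv n (i : 'I_n) (f : 'rV[R]_n -> R) : 'rV[R]_n -> R :=
  fun x => 'D_(delta_mx ord0 i) f x.

Lemma rV_cons_line0 n (y : 'rV[R]_n) t h :
  h *: delta_mx ord0 ord0 + rV_cons (y, t) = rV_cons (y, h + t).
Proof.
apply/rowP => i; rewrite mxE [X in X + _]mxE [X in _ * X + _]mxE eqxx/=.
case: (unliftP ord0 i) => [j ->|->].
  by rewrite !rV_consS/= mulr0 add0r.
by rewrite !rV_cons0/= mulr1.
Qed.

Lemma rV_cons_lineS n (y : 'rV[R]_n) t h (i : 'I_n) :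
  h *: delta_mx ord0 (lift ord0 i) + rV_cons (y, t) = rV_cons (h *: delta_mx ord0 i + y, t).
Proof.
apply/rowP => k; rewrite mxE [X in X + _]mxE [X in _ * X + _]mxE eqxx/=.
case: (unliftP ord0 k) => [j ->|->].
  by rewrite !rV_consS/= !mxE/= (inj_eq (@lift_inj _ ord0)).
by rewrite !rV_cons0/= mulr0 add0r.
Qed.

Lemma pderiv_slice n (u : 'rV[R]_n.+1 -> R) (i : 'I_n) t :
  pderiv i (fun y => u (rV_cons (y, t))) = fun y => pderiv (lift ord0 i) u (rV_cons (y, t)).
Proof.
apply/funext => y; rewrite /pderiv /derive; congr (lim _).
rewrite (_ : (fun h => _) = (fun h => h^-1 *:
   ((u \o shift (rV_cons (y, t))) (h *: delta_mx ord0 (lift ord0 i)) - u (rV_cons (y, t)))))//.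
by apply/funext => h /=; rewrite -rV_cons_lineS.
Qed.

Lemma derivable_slice n (u : 'rV[R]_n.+1 -> R) (i : 'I_n) t y :
  derivable u (rV_cons (y, t)) (delta_mx ord0 (lift ord0 i)) ->
  derivable (fun y => u (rV_cons (y, t))) y (delta_mx ord0 i).
Proof.
have E : (fun h : R => h^-1 *: (((fun y => u (rV_cons (y, t))) \o shift y)
      (h *: delta_mx ord0 i) - u (rV_cons (y, t)))) =
    (fun h => h^-1 *: ((u \o shift (rV_cons (y, t)))
      (h *: delta_mx ord0 (lift ord0 i)) - u (rV_cons (y, t)))).
  by apply/funext => h /=; rewrite rV_cons_lineS.
by rewrite /derivable E.
Qed.

Lemma supp_bounded_pderiv n (u : 'rV[R]_n -> R) (i : 'I_n) :
  supp_bounded u -> supp_bounded (pderiv i u).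
Proof.
move=> [B uB]; exists B => x [j xj]; rewrite /pderiv.
rewrite (@near_eq_derive _ _ _ _ (cst 0)) ?derive_cst//.
have e0 : 0 < `|x ord0 j| - B by rewrite subr_gt0.
apply/nbhs_ballP; exists (`|x ord0 j| - B) => //= z /(rV_ballP _ _ e0) /(_ j) xz.
apply: uB; exists j.
have := ler_distD (z ord0 j) (x ord0 j) 0; rewrite !subr0; lra.
Qed.

Lemma weak_grad_C1 n (u : 'rV[R]_n -> R) : continuous u -> supp_bounded u ->
  (forall i x, derivable u x (delta_mx ord0 i)) ->
  (forall i, continuous (pderiv i u)) -> weak_grad u (fun i => pderiv i u).
Proof.
elim: n u => [|n ih] u cu su du cdu; first exact: bsupp_continuous.
split.
- exact: bsupp_continuous.
- by move=> i; apply: bsupp_continuous => //; exact: supp_bounded_pderiv.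
- move=> y s t st.
  have line a : pderiv ord0 u (rV_cons (y, a)) = derive1 (fun t => u (rV_cons (y, t))) a /\
      derivable (fun t => u (rV_cons (y, t))) a 1.
    have [h1 h2] := @derive_line R _ u (fun t => u (rV_cons (y, t))) (delta_mx ord0 ord0)
      (rV_cons (y, a)) a (fun h => congr1 u (rV_cons_line0 y a h)).
    by split; [rewrite /pderiv h1|apply: (iffLR h2); exact: du].
  apply: (@FTC_indic R (fun t => u (rV_cons (y, t))) (fun t => pderiv ord0 u (rV_cons (y, t)))) => //.
  + by move=> a; apply: continuous_comp; [exact: rV_cons_continuous2|exact: cdu].
  + by move=> a; exact: (line a).2.
  + by move=> a; rewrite (line a).1.
- move=> t; rewrite (_ : (fun i y => _) =
    (fun i => pderiv i (fun y => u (rV_cons (y, t))))); last first.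
    by apply/funext => i; rewrite pderiv_slice.
  apply: ih.
  + by move=> y; apply: continuous_comp; [exact: rV_cons_continuous1|exact: cu].
  + have [B uB] := su; exists B => y [i yi]; apply: uB.
    by exists (lift ord0 i); rewrite rV_consS.
  + by move=> i x; apply: derivable_slice; exact: du.
  + move=> i; rewrite pderiv_slice => y.
    by apply: continuous_comp; [exact: rV_cons_continuous1|exact: cdu].
Qed.

(** Along a line in direction [i], the derivative integrates to a difference of values of [u]
    outside its support; Fubini reduces the other directions to slices. *)
Lemma weak_grad_integral0 n (u : 'rV[R]_n -> R) g i : weak_grad u g ->
  integral_rV (g i) = 0.
Proof.
elim: n u g i => [u g []//|n ih] u g i [uS gS gu sl].
case: (unliftP ord0 i) => [j ->|->].
  rewrite (integral_rV_slice (gS _)); apply: integral_R_eq0 => t.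
  exact: ih (sl t).
rewrite (integral_rV_slice' (gS _)); apply: integral_rV_eq0 => y.
have [_ [B uB]] := uS; have [_ [C gC]] := gS ord0.
have B0 : 0 <= B by have [h _] := uB 0; exact: le_trans h.
have C0 : 0 <= C by have [h _] := gC 0; exact: le_trans h.
(* [[- T, T]] contains the supports of [u] and of [g ord0] along the line, and [u] vanishes at its
   ends. *)
pose T := B + C + 1.
have := gu y (- T) T; rewrite (_ : u (rV_cons (y, T)) = 0); last first.
  have [_] := uB (rV_cons (y, T)); apply; exists ord0; rewrite rV_cons0/=.
  by rewrite ger0_norm /T; lra.
rewrite (_ : u (rV_cons (y, - T)) = 0); last first.
  have [_] := uB (rV_cons (y, - T)); apply; exists ord0; rewrite rV_cons0/=.
  by rewrite normrN ger0_norm /T; lra.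
rewrite subrr => ->; last by rewrite /T; lra.
congr integral_R; apply/funext => r; rewrite indicE.
case: (boolP (r \in _)) => [_|]; first by rewrite mul1r.
rewrite mul0r notin_setE /= in_itv/= -ler_norml => /negP.
rewrite -ltNge => rT; have [_] := gC (rV_cons (y, r)); apply.
by exists ord0; rewrite rV_cons0/=; apply: le_lt_trans rT; rewrite /T; lra.
Qed.

End weak_gradient.

(** * Poincare inequalities *)

(** The integral of [chi * (f - t) ^+ 2] is nonnegative for every [t]; the best choice is the
    weighted mean [b / m]. *)
Lemma weighted_mean_sqr_le d (T : measurableType d) (R : realType)
    (mu : {measure set T -> \bar R}) (chi f : T -> R) :
  mu.-integrable setT (EFin \o chi) ->
  mu.-integrable setT (EFin \o (fun x => chi x * f x)) ->
  mu.-integrable setT (EFin \o (fun x => chi x * f x ^+ 2)) ->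
  (forall x, 0 <= chi x) -> 0 < (\int[mu]_x chi x)%R ->
  (\int[mu]_x (chi x * f x))%R ^+ 2 <=
    (\int[mu]_x chi x)%R * (\int[mu]_x (chi x * f x ^+ 2))%R.
Proof.
move=> i0 i1 i2 chi0 m0.
set m := (\int[mu]_x chi x)%R in m0 *.
set b := (\int[mu]_x (chi x * f x))%R.
set c := (\int[mu]_x (chi x * f x ^+ 2))%R.
have scal k (g : T -> R) : mu.-integrable setT (EFin \o g) ->
    mu.-integrable setT (EFin \o (fun x => k * g x)).
  by move=> gi; exact: (integrableZl measurableT k gi).
have H t : 0 <= c + (- 2 * t) * b + t ^+ 2 * m.
  have <- : (\int[mu]_x (chi x * f x ^+ 2 + (- 2 * t) * (chi x * f x) + t ^+ 2 * chi x))%R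
     = c + (- 2 * t) * b + t ^+ 2 * m.
    rewrite RintegralD//=; last exact: scal.
      rewrite RintegralD//=; last exact: scal.
      by rewrite !RintegralZl.
    exact: (integrableD measurableT i2 (scal _ _ i1)).
  apply: Rintegral_ge0 => x _.
  have -> : chi x * f x ^+ 2 + (- 2 * t) * (chi x * f x) + t ^+ 2 * chi x =
    chi x * (f x - t) ^+ 2 by ring.
  by rewrite mulr_ge0// sqr_ge0.
have := H (b / m).
have -> : c + - 2 * (b / m) * b + (b / m) ^+ 2 * m = c - b ^+ 2 / m.
  by field; rewrite gt_eqF.
by rewrite subr_ge0 ler_pdivrMr// mulrC.
Qed.

Section poincare.
Context {R : realType}.

Let J (a h : R) : set R := `[a, a + h[%classic.

Let J_S a h : bsupp1 (\1_(J a h) : R -> R).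
Proof.
apply: (@bsupp1_indic _ _ (`|a| + `|h|)) => t; rewrite in_itv/= => /andP[t1 t2].
rewrite ler_norml; have := ler_norm h; have := ler_norm a.
have := ler_norm (- a); have := ler_norm (- h); rewrite !normrN => *.
by apply/andP; split; have := normr_ge0 h; lra.
Qed.

Let JZ a h c : bsupp1 (fun t => c * \1_(J a h) t : R).
Proof. exact: (bsupp1Z c (J_S a h)). Qed.

Let integrable1 (f : R -> R) : bsupp1 f ->
  (@lebesgue_measure R).-integrable setT (EFin \o f).
Proof. exact: bsupp1_integrable. Qed.

Lemma mean_sqr_le_line (a h : R) f : 0 < h -> bsupp1 f ->
  integral_R (fun t => \1_(J a h) t * f t) ^+ 2 <=
    h * integral_R (fun t => \1_(J a h) t * f t ^+ 2).
Proof.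
move=> h0 fS; rewrite -[X in _ <= X * _](integral_R_indic_co a (ltW h0)).
apply: (@weighted_mean_sqr_le _ (measurableTypeR R) R lebesgue_measure) => //.
- exact: integrable1.
- by apply: integrable1; exact: bsupp1MM.
- by apply: integrable1; apply: bsupp1MM => //; exact: bsupp1MM.
- by rewrite -/(integral_R _) integral_R_indic_co// ltW.
Qed.

Section line.
Variables (U G : R -> R) (a h : R).
Hypotheses (US : bsupp1 U) (GS : bsupp1 G) (h0 : 0 < h).
Hypothesis UG : forall s t, s <= t ->
  U t - U s = integral_R (fun r => \1_(`[s, t]%classic) r * G r).

Let K := integral_R (fun t => \1_(J a h) t * G t ^+ 2).

(** The increment is the integral of [G] over a subinterval of [J a h]; extending the integral of
    [G ^+ 2] to all of [J a h] makes the Cauchy-Schwarz bound uniform in [s] and [t]. *)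
Lemma increment_sqr_le s t : J a h s -> J a h t -> (U t - U s) ^+ 2 <= h * K.
Proof.
wlog st : s t / s <= t.
  move=> H; have [st|/ltW ts] := leP s t; first exact: H.
  by move=> Js Jt; rewrite -sqrrN opprB; exact: H.
rewrite /J /= !in_itv/= => /andP[s1 s2] /andP[t1 t2].
have iS : bsupp1 (\1_(`[s, t]%classic) : R -> R).
  apply: (@bsupp1_indic _ _ (`|s| + `|t|)) => r; rewrite in_itv/= => /andP[r1 r2].
  rewrite ler_norml; have := ler_norm t; have := ler_norm (- s); rewrite !normrN => *.
  by apply/andP; split; have := normr_ge0 t; have := normr_ge0 s; lra.
have sub r : \1_(`[s, t]%classic) r = \1_(J a h) r * \1_(`[s, t]%classic) r :> R.
  rewrite !indicE; case: (boolP (r \in `[s, t]%classic)) => rst; last by rewrite mulr0.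
  rewrite (_ : r \in J a h) ?mulr1//.
  move: rst; rewrite !inE /J/= !in_itv/= => /andP[r1 r2].
  by apply/andP; split; lra.
have {1}-> : U t - U s = integral_R (fun r => \1_(J a h) r * (\1_(`[s, t]%classic) r * G r)).
  by rewrite UG//; congr integral_R; apply/funext => r; rewrite mulrA -sub.
apply: le_trans (mean_sqr_le_line a h0 _) _; first exact: bsupp1MM.
rewrite ler_pM2l//; apply: le_integral_R.
- by apply: bsupp1MM => //; apply: bsupp1MM; exact: bsupp1MM.
- by apply: bsupp1MM => //; exact: bsupp1MM.
- move=> r; rewrite !indicE; case: (r \in J a h); rewrite ?mul0r// !mul1r.
  by case: (r \in _); rewrite ?mul1r// mul0r expr0n/= sqr_ge0.
Qed.

Let hhK : h * (h * K) = integral_R (fun t => h * K * \1_(J a h) t).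
Proof. by rewrite integral_RZ// integral_R_indic_co ?(ltW h0)// mulrC. Qed.

(** Averaging [U t - U s] over [s] bounds [(U t - m) ^+ 2] by [h * K] pointwise, where [m] is the
    mean. Integrating over [t] and expanding the square gives the inequality, with [h ^+ 2] in place
    of the sharp constant. *)
Lemma poincare_line : integral_R (fun t => \1_(J a h) t * U t ^+ 2) <=
  h^-1 * integral_R (fun t => \1_(J a h) t * U t) ^+ 2 + h ^+ 2 * K.
Proof.
pose m := h^-1 * integral_R (fun t => \1_(J a h) t * U t).
have hm : integral_R (fun t => \1_(J a h) t * U t) = h * m.
  by rewrite /m mulrA divff ?mul1r// gt_eqF.
have UmS c : bsupp1 (fun t => \1_(J a h) t * (c - U t)).
  rewrite (_ : (fun t => _) = (fun t => c * \1_(J a h) t + (- 1) * (\1_(J a h) t * U t))).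
    by apply: bsupp1D; apply: bsupp1Z => //; exact: bsupp1MM.
  by apply/funext => t; ring.
have pt t : J a h t -> (U t - m) ^+ 2 <= h * K.
  move=> Jt.
  have E : h * (U t - m) = integral_R (fun s => \1_(J a h) s * (\1_(J a h) s * (U t - U s))).
    rewrite (_ : (fun s => _) = (fun s => U t * \1_(J a h) s + (-1) * (\1_(J a h) s * U s))).
      rewrite integral_RD; [|exact: JZ|by apply: bsupp1Z; exact: bsupp1MM].
      rewrite !integral_RZ//; last exact: bsupp1MM.
      by rewrite integral_R_indic_co ?(ltW h0)// hm; ring.
    apply/funext => s.
    by rewrite !indicE; case: (s \in _); rewrite ?mul0r ?mul1r ?mulr1 ?mulr0 ?mulN1r ?addr0.
  have := mean_sqr_le_line a h0 (UmS (U t)); rewrite -E.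
  have : integral_R (fun s => \1_(J a h) s * (\1_(J a h) s * (U t - U s)) ^+ 2) <= h * (h * K).
    rewrite hhK.
    apply: le_integral_R; [by apply: bsupp1MM => //; exact: bsupp1MM|exact: JZ|].
    move=> s; rewrite !indicE; case: (boolP (s \in _)) => Js; last by rewrite mul0r mulr0.
    by rewrite !mul1r mulr1; apply: increment_sqr_le => //; rewrite inE in Js.
  move=> h1 h2.
  have : h ^+ 2 * (U t - m) ^+ 2 <= h ^+ 2 * (h * K).
    rewrite -exprMn; apply: (le_trans h2); rewrite expr2 -mulrA.
    by rewrite ler_pM2l.
  by rewrite ler_pM2l// exprn_gt0.
have : integral_R (fun t => \1_(J a h) t * U t ^+ 2 + (- 2 * m) * (\1_(J a h) t * U t)
    + m ^+ 2 * \1_(J a h) t) <= h * (h * K).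
  rewrite hhK.
  apply: le_integral_R; [|exact: JZ|].
    apply: bsupp1D; last exact: JZ.
    apply: bsupp1D; last by apply: bsupp1Z; exact: bsupp1MM.
    by apply: bsupp1MM => //; exact: bsupp1MM.
  move=> t; rewrite !indicE; case: (boolP (t \in _)) => Jt; last first.
    by rewrite !mul0r !mulr0 !addr0.
  have := pt t; rewrite inE in Jt => /(_ Jt).
  by rewrite !mul1r !mulr1; congr (_ <= _); ring.
rewrite integral_RD; last exact: JZ; last first.
  apply: bsupp1D; last by apply: bsupp1Z; exact: bsupp1MM.
  by apply: bsupp1MM => //; exact: bsupp1MM.
rewrite integral_RD; last by apply: bsupp1Z; exact: bsupp1MM.
  rewrite !integral_RZ//; last exact: bsupp1MM.
  rewrite integral_R_indic_co ?(ltW h0)// hm => H.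
  have -> : h^-1 * (h * m) ^+ 2 = h * m ^+ 2 by field; rewrite gt_eqF.
  by move: H; rewrite expr2; lra.
by apply: bsupp1MM => //; exact: bsupp1MM.
Qed.

(** Since [U a = 0], [increment_sqr_le] bounds [U t] itself, and no mean appears on the right. *)
Lemma dirichlet_line : (forall t, ~ (a < t < a + h) -> U t = 0) ->
  integral_R (fun t => U t ^+ 2) <= h ^+ 2 * integral_R (fun t => G t ^+ 2).
Proof.
move=> U0; have Ua : U a = 0 by apply: U0; rewrite ltxx.
have Ja : J a h a by rewrite /J /= in_itv/= lexx ltrDl.
apply: (@le_trans _ _ (h * (h * K))).
  rewrite hhK.
  apply: le_integral_R; [exact: bsupp1MM|exact: JZ|].
  move=> t; rewrite indicE; case: (boolP (t \in _)) => Jt.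
    by rewrite mulr1 -[U t]subr0 -Ua; apply: increment_sqr_le => //; rewrite inE in Jt.
  rewrite mulr0 U0 ?expr0n// => /andP[t1 t2].
  by move: Jt; rewrite notin_setE; apply; rewrite /J /= in_itv/= (ltW t1).
rewrite mulrA -expr2 ler_pM2l ?exprn_gt0//; apply: le_integral_R.
- by apply: bsupp1MM => //; exact: bsupp1MM.
- exact: bsupp1MM.
- by move=> t; rewrite indicE; case: (_ \in _); rewrite ?mul1r// mul0r sqr_ge0.
Qed.

End line.
End poincare.

(** * The Poincare inequality on a cell *)

Section cells.
Context {R : realType}.

(** Half-open sides let cells tile a box without overlap, so that their indicators add up
    exactly. *)
Definition cell n (a : 'I_n -> R) (h : R) : set 'rV[R]_n :=
  [set x | forall i, a i <= x ord0 i < a i + h].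

Lemma indic_cell_cons n (a : 'I_n.+1 -> R) h y t :
  \1_(cell a h) (rV_cons (y, t)) =
  \1_(`[a ord0, a ord0 + h[%classic) t * \1_(cell (a \o lift ord0) h) y :> R.
Proof.
rewrite !indicE -natrM mulnb; congr (_%:R); congr nat_of_bool; apply/idP/idP.
  rewrite inE => cx; apply/andP; split; rewrite inE/=.
    by rewrite in_itv/=; have := cx ord0; rewrite rV_cons0.
  by move=> i; have := cx (lift ord0 i); rewrite rV_consS.
move=> /andP[]; rewrite !inE/= in_itv/= => t1 yc i; case: (unliftP ord0 i) => [j ->|->]; first by rewrite rV_consS; exact: yc.
by rewrite rV_cons0.
Qed.

Lemma measurable_cell n (a : 'I_n -> R) h : measurable (cell a h).
Proof.
rewrite (_ : cell a h = \bigcap_(i in [set: 'I_n]) (rV_coord i @^-1` `[a i, a i + h[)).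
  apply: fin_bigcap_measurable => // i _.
  by rewrite -[X in measurable X]setTI; apply: measurable_rV_coord => //; exact: measurable_itv.
apply/seteqP; split => [x xB i _|x xB i] /=; first by rewrite /rV_coord in_itv/= xB.
by have := xB i I; rewrite /= /rV_coord in_itv.
Qed.

Lemma bsupp_cell n (a : 'I_n -> R) h : bsupp (\1_(cell a h) : 'rV[R]_n -> R).
Proof.
split; first exact: measurable_indic (measurable_cell a h).
exists (1 + \sum_i `|a i| + `|h|) => x.
have S0 : 0 <= \sum_i `|a i| by apply: sumr_ge0.
have h0 := normr_ge0 h.
rewrite indicE; case: (boolP (x \in cell a h)) => xc; split.
- by rewrite normr1; lra.
- move=> [i xi]; move: xc; rewrite inE => /(_ i) /andP[x1 x2]; move: xi.
  rewrite ltNge ler_norml; apply: contraNeq => _.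
  have ai : `|a i| <= \sum_i `|a i| by rewrite (bigD1 i)//= lerDl sumr_ge0.
  have := ler_norm h; have := ler_norm (a i); have := ler_norm (- a i); rewrite normrN => *.
  by apply/andP; split; lra.
- by rewrite normr0; lra.
- by [].
Qed.

Lemma bsupp1_co (a h : R) : bsupp1 (\1_(`[a, a + h[%classic) : R -> R).
Proof.
apply: (@bsupp1_indic _ _ (`|a| + `|h|)) => t; rewrite in_itv/= => /andP[t1 t2].
rewrite ler_norml; have := ler_norm h; have := ler_norm a.
have := ler_norm (- a); have := ler_norm (- h); rewrite !normrN => *.
by apply/andP; split; have := normr_ge0 h; lra.
Qed.

Lemma bsupp1_sum (I : Type) (r : seq I) (f : I -> R -> R) :
  (forall i, bsupp1 (f i)) -> bsupp1 (fun x => \sum_(i <- r) f i x).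
Proof.
move=> fS; elim: r => [|i r ih].
  rewrite (_ : (fun x => _) = fun=> 0).
    by split; [exact: measurable_cst|exists 0 => t; rewrite normr0].
  by apply/funext => x; rewrite big_nil.
rewrite (_ : (fun x => _) = fun x => f i x + \sum_(j <- r) f j x); first exact: bsupp1D.
by apply/funext => x; rewrite big_cons.
Qed.

Lemma integral_R_sum (I : Type) (r : seq I) (f : I -> R -> R) :
  (forall i, bsupp1 (f i)) ->
  integral_R (fun x => \sum_(i <- r) f i x) = \sum_(i <- r) integral_R (f i).
Proof.
move=> fS; elim: r => [|i r ih].
  by rewrite big_nil integral_R_eq0// => x; rewrite big_nil.
rewrite big_cons -ih -integral_RD//; last exact: bsupp1_sum.
by congr integral_R; apply/funext => x; rewrite big_cons.
Qed.

Definition rV_tail n (x : 'rV[R]_n.+1) : 'rV[R]_n := \row_i x ord0 (lift ord0 i).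

Lemma rV_tail_cons n (y : 'rV[R]_n) t : rV_tail (rV_cons (y, t)) = y.
Proof. by apply/rowP => i; rewrite mxE rV_consS. Qed.

Lemma measurable_rV_tail n : measurable_fun setT (@rV_tail n).
Proof.
apply/measurable_fun_rVP => i; rewrite (_ : _ \o _ = rV_coord (lift ord0 i)).
  exact: measurable_rV_coord.
by apply/funext => x; rewrite /= /rV_coord mxE.
Qed.

Lemma bsuppM_tail n (f : 'rV[R]_n.+1 -> R) (chi : 'rV[R]_n -> R) :
  bsupp f -> bsupp chi -> bsupp (fun x => f x * chi (rV_tail x)).
Proof.
move=> fS [mchi [C chiC]]; apply: bsuppM => //.
  apply: (@measurableT_comp _ _ _ _ _ _ (chi : _ -> measurableTypeR R) _ (@rV_tail n)) => //.
  exact: measurable_rV_tail.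
by exists C => x; case: (chiC (rV_tail x)).
Qed.

Lemma integral_rV0 (f : 'rV[R]_0 -> R) : integral_rV f = f 0.
Proof.
rewrite /integral_rV (eq_Rintegral _ (g := fun=> f 0)); last first.
  by move=> x _; congr f; apply/rowP => -[].
rewrite Rintegral_cst//.
have -> : (@lebesgue_rV R 0 setT = 1)%E.
  by rewrite -[LHS]/(dirac (0 : 'rV[R]_0) setT) diracT.
by rewrite mulr1.
Qed.

Lemma integral_cell n (a : 'I_n -> R) h : 0 <= h ->
  integral_rV (\1_(cell a h)) = h ^+ n.
Proof.
move=> h0; elim: n a => [|n ih] a.
  by rewrite expr0 integral_rV0 indicE (_ : _ \in _)// inE => -[].
rewrite (integral_rV_slice (bsupp_cell a h)).
rewrite (_ : (fun t => _) =
  (fun t => h ^+ n * \1_(`[a ord0, a ord0 + h[%classic) t)); last first.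
  apply/funext => t; rewrite -(ih (a \o lift ord0)) mulrC -integral_rVZ; last exact: bsupp_cell.
  by congr integral_rV; apply/funext => y; rewrite indic_cell_cons.
by rewrite integral_RZ ?integral_R_indic_co ?exprSr//; exact: bsupp1_co.
Qed.

Lemma bsupp_sqr n (f : 'rV[R]_n -> R) : bsupp f -> bsupp (fun x => f x ^+ 2).
Proof. by move=> fS; exact: (bsuppMM fS fS). Qed.

Lemma bsupp_cellM n (a : 'I_n -> R) h (f : 'rV[R]_n -> R) :
  bsupp f -> bsupp (fun x => \1_(cell a h) x * f x).
Proof. by move=> fS; exact: (bsuppMM (bsupp_cell a h) fS). Qed.

Lemma mean_sqr_le_cell n (a : 'I_n -> R) h f : 0 < h -> bsupp f ->
  integral_rV (fun t => \1_(cell a h) t * f t) ^+ 2 <=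
    h ^+ n * integral_rV (fun t => \1_(cell a h) t * f t ^+ 2).
Proof.
move=> h0 fS; rewrite -(integral_cell a (ltW h0)).
apply: weighted_mean_sqr_le => //.
- apply: bsupp_integrable; exact: bsupp_cell.
- by apply: bsupp_integrable; exact: bsupp_cellM.
- by apply: bsupp_integrable; apply: bsupp_cellM; exact: bsupp_sqr.
- by rewrite -/(integral_rV _) integral_cell ?exprn_gt0// ltW.
Qed.

(** Induction on the dimension, slicing at the first coordinate [t]. The inductive inequality on
    each slice leaves the square of [U t], the integral of [u] over the slice, to which
    [poincare_line] applies with derivative [G ord0]. *)
Lemma poincare_cell n (u : 'rV[R]_n -> R) g (a : 'I_n -> R) h :
  0 < h -> weak_grad u g ->
  integral_rV (fun x => \1_(cell a h) x * u x ^+ 2) <=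
    (h ^+ n)^-1 * integral_rV (fun x => \1_(cell a h) x * u x) ^+ 2 +
    h ^+ 2 * \sum_i integral_rV (fun x => \1_(cell a h) x * g i x ^+ 2).
Proof.
move=> h0; elim: n u g a => [|n ih] u g a.
  move=> uS; rewrite big_ord0 mulr0 addr0 expr0 invr1 mul1r.
  by rewrite !integral_rV0 indicE; case: (_ \in _); rewrite ?mul1r ?mul0r ?expr0n.
move=> [uS gS ug sl].
pose a' := a \o lift ord0; pose J := `[a ord0, a ord0 + h[%classic.
pose chi : 'rV[R]_n -> R := \1_(cell a' h).
have chiS : bsupp chi by exact: bsupp_cell.
pose U t := integral_rV (fun y => chi y * u (rV_cons (y, t))).
pose G i t := integral_rV (fun y => chi y * g i (rV_cons (y, t))).
pose G2 i t := integral_rV (fun y => chi y * g i (rV_cons (y, t)) ^+ 2).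
pose U2 t := integral_rV (fun y => chi y * u (rV_cons (y, t)) ^+ 2).
have JS : bsupp1 (\1_J : R -> R).
  exact: bsupp1_co.
pose ext (f : 'rV[R]_n.+1 -> R) : 'rV[R]_n.+1 -> R :=
  fun x => \1_(cell a h) x * f x.
have cS : bsupp (\1_(cell a h) : 'rV[R]_n.+1 -> R) by exact: bsupp_cell.
have slice (f : 'rV[R]_n.+1 -> R) : bsupp f -> integral_rV (ext f) =
    integral_R (fun t => \1_J t * integral_rV (fun y => chi y * f (rV_cons (y, t)))).
  move=> fS; rewrite (integral_rV_slice (bsuppMM cS fS)); congr integral_R.
  apply/funext => t; rewrite -integral_rVZ; last by apply: bsuppMM => //; exact: bsupp_slice.
  by congr integral_rV; apply/funext => y; rewrite /ext indic_cell_cons mulrA.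
have sliceS (f : 'rV[R]_n.+1 -> R) : bsupp f ->
    bsupp1 (fun t => integral_rV (fun y => chi y * f (rV_cons (y, t)))).
  move=> fS; have := bsupp1_integral_slice (bsuppM_tail fS chiS).
  congr bsupp1; apply/funext => t; congr integral_rV; apply/funext => y.
  by rewrite rV_tail_cons mulrC.
have US : bsupp1 U by exact: sliceS.
have GS i : bsupp1 (G i) by exact: sliceS.
have u2S : bsupp (fun x => u x ^+ 2) by exact: bsupp_sqr.
have g2S i : bsupp (fun x => g i x ^+ 2) by exact: bsupp_sqr.
have U2S : bsupp1 U2 by exact: (sliceS _ u2S).
have G2S i : bsupp1 (G2 i) by exact: (sliceS _ (g2S i)).
(* The fundamental theorem of calculus on each line is integrated over the slice, and Fubini
   exchanges the two integrals. *)
have UG s t : s <= t -> U t - U s = integral_R (fun r => \1_(`[s, t]%classic) r * G ord0 r).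
  move=> st.
  have chiu r : bsupp (fun y => chi y * u (rV_cons (y, r))).
    by apply: bsuppMM => //; exact: bsupp_slice.
  have -> : U t - U s = integral_rV (fun y => chi y * (u (rV_cons (y, t)) - u (rV_cons (y, s)))).
    rewrite -[U s]mul1r -mulNr -integral_rVZ// -integral_rVD//; last exact: bsuppZ.
    by congr integral_rV; apply/funext => y; ring.
  have iS : measurable_fun setT
      ((fun x : 'rV[R]_n.+1 => \1_(`[s, t]%classic) (x ord0 ord0)) : _ -> measurableTypeR R).
    apply: (measurableT_comp (f := (\1_(`[s, t]%classic) : measurableTypeR R -> measurableTypeR R))).
      exact: measurable_indic (measurable_itv `[s, t]).
    exact: (measurable_rV_coord ord0).
  have gS' : bsupp (fun x : 'rV[R]_n.+1 => g ord0 x * \1_(`[s, t]%classic) (x ord0 ord0)).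
    apply: bsuppM => //.
    by exists 1 => x; rewrite indicE; case: (_ \in _); rewrite ?normr1 ?normr0.
  have FS := bsuppM_tail gS' chiS.
  transitivity (integral_rV (fun x : 'rV[R]_n.+1 =>
      g ord0 x * \1_(`[s, t]%classic) (x ord0 ord0) * chi (rV_tail x))).
    rewrite (integral_rV_slice' FS); congr integral_rV; apply/funext => y.
    rewrite ug// -integral_RZ.
      by congr integral_R; apply/funext => r; rewrite rV_tail_cons rV_cons0/=; ring.
    have := bsupp1_slice gS' y; congr bsupp1; apply/funext => r.
    by rewrite rV_cons0/= mulrC.
  rewrite (integral_rV_slice FS); congr integral_R; apply/funext => r.
  rewrite -integral_rVZ; last by apply: bsuppMM => //; exact: bsupp_slice.
  by congr integral_rV; apply/funext => y; rewrite rV_tail_cons rV_cons0/=; ring.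
have ihU t : U2 t <= (h ^+ n)^-1 * U t ^+ 2 + h ^+ 2 * \sum_i G2 (lift ord0 i) t.
  exact: (ih _ _ a' (sl t)).
rewrite (slice _ u2S) (slice _ uS) big_ord_recl/= (slice _ (g2S _)).
under eq_bigr => i _ do rewrite (slice _ (g2S (lift ord0 i))).
rewrite -/U2 -/(G2 _) -/U.
have P1 := poincare_line (a ord0) US (GS ord0) h0 UG.
(* Cauchy-Schwarz over the slice costs its volume [h ^+ n], which cancels the factor [(h ^+ n)^-1]
   of the inductive inequality. *)
have P2 : integral_R (fun t => \1_J t * G ord0 t ^+ 2) <= h ^+ n * integral_R (fun t => \1_J t * G2 ord0 t).
  rewrite -integral_RZ; last exact: bsupp1MM.
  apply: le_integral_R; [by apply: bsupp1MM => //; exact: bsupp1MM|by apply: bsupp1Z; exact: bsupp1MM|].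
  have cs t : G ord0 t ^+ 2 <= h ^+ n * G2 ord0 t.
    by apply: mean_sqr_le_cell => //; exact: bsupp_slice.
  by move=> t; rewrite indicE; case: (_ \in _); rewrite ?mul1r ?mul0r ?mulr0.
have P0 : integral_R (fun t => \1_J t * U2 t) <=
    (h ^+ n)^-1 * integral_R (fun t => \1_J t * U t ^+ 2) +
    h ^+ 2 * \sum_i integral_R (fun t => \1_J t * G2 (lift ord0 i) t).
  rewrite -integral_R_sum; last by move=> i; exact: bsupp1MM.
  have JU2 : bsupp1 (fun t => \1_J t * U t ^+ 2).
    by apply: bsupp1MM => //; exact: bsupp1MM.
  have JG2 : bsupp1 (fun t => \sum_i \1_J t * G2 (lift ord0 i) t).
    by apply: bsupp1_sum => i; exact: bsupp1MM.
  rewrite -!integral_RZ// -integral_RD; [|exact: bsupp1Z|exact: bsupp1Z].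
  apply: le_integral_R; [exact: bsupp1MM|by apply: bsupp1D; exact: bsupp1Z|].
  move=> t; rewrite -mulr_sumr indicE.
  by case: (_ \in _); rewrite ?mul1r ?mul0r ?mulr0 ?addr0.
apply: (le_trans P0); rewrite [h ^+ n.+1]exprS invfM.
have hn : 0 < (h ^+ n)^-1 by rewrite invr_gt0 exprn_gt0.
have h2 : 0 <= h ^+ 2 by exact: sqr_ge0.
have := ler_wpM2l (ltW hn) P1; have := ler_wpM2l h2 P2.
have := mulVf (lt0r_neq0 (exprn_gt0 n h0)).
move: (integral_R (fun t => \1_J t * G ord0 t ^+ 2)) => K.
move: (integral_R (fun t => \1_J t * U t ^+ 2)) => K2.
move: (integral_R (fun t => \1_J t * U t)) => K3.
move: (integral_R (fun t => \1_J t * G2 ord0 t)) (\sum_i _) => K4 K5 e1 e2 e3.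
have {}e2 : (h ^+ n)^-1 * (h ^+ 2 * K) <= h ^+ 2 * K4.
  have := ler_wpM2l (ltW hn) e2.
  have -> : (h ^+ n)^-1 * (h ^+ 2 * (h ^+ n * K4)) = ((h ^+ n)^-1 * h ^+ n) * (h ^+ 2 * K4) by ring.
  by rewrite e1 mul1r.
move: e2 e3; rewrite !mulrDr !mulrA.
by rewrite [(h ^+ n)^-1 * h^-1]mulrC; lra.
Qed.
End cells.

(** * Grids of cells *)

Section grid.
Context {R : realType}.

Definition hbox n (a s : 'I_n -> R) : set 'rV[R]_n :=
  [set x | forall i, a i <= x ord0 i < a i + s i].

Lemma indic_hbox n (a s : 'I_n -> R) x :
  \1_(hbox a s) x = \prod_i \1_(`[a i, a i + s i[%classic) (x ord0 i) :> R.
Proof.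
rewrite indicE; case: (boolP (x \in _)) => xB.
  rewrite big1// => i _; rewrite indicE (_ : _ \in _)//.
  by move: xB; rewrite !inE/= in_itv/=; apply.
move: xB; rewrite notin_setE => /existsNP[i xi].
rewrite (bigD1 i)//= indicE (_ : _ \in _ = false) ?mul0r//.
by apply/negbTE; rewrite notin_setE /= in_itv/=.
Qed.

Lemma sum_indic_co (a h t : R) m : 0 <= h ->
  \sum_(k < m) \1_(`[a + k%:R * h, a + k%:R * h + h[%classic) t =
  \1_(`[a, a + m%:R * h[%classic) t :> R.
Proof.
move=> h0; elim: m => [|m ih].
  rewrite big_ord0 mul0r addr0 indicE (_ : _ \in _ = false)//.
  by apply/negbTE; rewrite notin_setE /= in_itv/= => /andP[t1]; rewrite ltNge t1.
rewrite big_ord_recr/= ih !indicE -natrD; congr (_%:R).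
have E b c : (t \in `[b, c[%classic) = (b <= t < c).
  by apply/idP/idP; rewrite inE/= in_itv.
rewrite !E -natr1 mulrDl mul1r addrA.
have mh : 0 <= m%:R * h by rewrite mulr_ge0.
case: (leP (a + m%:R * h) t) => t1; case: (ltP t _) => t2; case: (leP a t) => t3 //=; exfalso; lra.
Qed.

Variables (n : nat) (a : 'I_n.+1 -> R) (h : R) (m M : nat).
Hypothesis h0 : 0 < h.

(** The first coordinate has its own number [m] of cells, the others have [M] each. This
    accommodates the thin box: [1] and [q] at the scale of the thin side, [m] and [q * m] after
    subdivision. *)
Definition grid_index : finType := ('I_m * {ffun 'I_n -> 'I_M})%type.

Definition grid_corner (k : grid_index) (i : 'I_n.+1) : R :=
  a i + (if unlift ord0 i is Some j then (k.2 j : nat)%:R else (k.1 : nat)%:R) * h.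

Definition grid_size (i : 'I_n.+1) : R :=
  (if unlift ord0 i is Some _ then M%:R else m%:R) * h.

Lemma card_grid_index : #|{: grid_index}| = (m * M ^ n)%N.
Proof. by rewrite card_prod card_ffun !card_ord. Qed.

Lemma sum_indic_grid x :
  \sum_(k : grid_index) \1_(cell (grid_corner k) h) x = \1_(hbox a grid_size) x :> R.
Proof.
under eq_bigr => k _ do rewrite -[cell _ _]/(hbox (grid_corner k) (fun=> h)) indic_hbox
  big_ord_recl.
rewrite indic_hbox big_ord_recl /grid_size unlift_none -sum_indic_co ?(ltW h0)//.
under [X in _ = _ * X]eq_bigr => i _ do rewrite liftK -sum_indic_co ?(ltW h0)//.
rewrite bigA_distr_bigA/= big_distrlr/= pair_big/=; apply: eq_bigr => -[k0 k] _ /=.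
rewrite /grid_corner unlift_none/=; congr (_ * _); apply: eq_bigr => i _.
by rewrite liftK.
Qed.

Lemma poincare_grid (u : 'rV[R]_n.+1 -> R) g : weak_grad u g ->
  (forall x, ~ hbox a grid_size x -> u x = 0) ->
  integral_rV (fun x => u x ^+ 2) <=
    (h ^+ n.+1)^-1 * \sum_(k : grid_index)
      integral_rV (fun x => \1_(cell (grid_corner k) h) x * u x) ^+ 2 +
    h ^+ 2 * \sum_i integral_rV (fun x => g i x ^+ 2).
Proof.
move=> ug u0; have uS := weak_grad_bsupp ug; have gS := weak_grad_bsupp_grad ug.
have -> : integral_rV (fun x => u x ^+ 2) = \sum_(k : grid_index)
    integral_rV (fun x => \1_(cell (grid_corner k) h) x * u x ^+ 2).
  rewrite -integral_rV_sum; last by move=> k; apply: bsupp_cellM; exact: bsupp_sqr.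
  congr integral_rV; apply/funext => x; rewrite -mulr_suml sum_indic_grid indicE.
  case: (boolP (x \in _)); rewrite ?mul1r// notin_setE => /u0 ->.
  by rewrite expr0n mulr0.
apply: (le_trans (ler_sum _ (fun k _ => poincare_cell (grid_corner k) h0 ug))).
rewrite big_split/= -!mulr_sumr lerD2l ler_wpM2l ?sqr_ge0//.
rewrite exchange_big/=; apply: ler_sum => i _.
rewrite -integral_rV_sum; last by move=> k; apply: bsupp_cellM; exact: bsupp_sqr.
apply: le_integral_rV => [||x].
- by apply: bsupp_sum => k; apply: bsupp_cellM; exact: bsupp_sqr.
- exact: bsupp_sqr.
- by rewrite -mulr_suml sum_indic_grid indicE; case: (_ \in _); rewrite ?mul1r// mul0r sqr_ge0.
Qed.

(** On each line in the first direction [u] vanishes outside an interval of length [h];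
    [dirichlet_line] is integrated over the other coordinates. *)
Lemma dirichlet_poincare (u : 'rV[R]_n.+1 -> R) g : weak_grad u g ->
  (forall x : 'rV[R]_n.+1, ~ (a ord0 < x ord0 ord0 < a ord0 + h) -> u x = 0) ->
  integral_rV (fun x => u x ^+ 2) <= h ^+ 2 * integral_rV (fun x => g ord0 x ^+ 2).
Proof.
move=> [uS gS ug _] u0.
have u2S := bsupp_sqr uS; have g2S := bsupp_sqr (gS ord0).
rewrite (integral_rV_slice' u2S) (integral_rV_slice' g2S).
rewrite -integral_rVZ; last exact: (bsupp_integral_slice g2S).
apply: le_integral_rV.
- exact: (bsupp_integral_slice u2S).
- by apply: bsuppZ; exact: (bsupp_integral_slice g2S).
- move=> y; apply: (@dirichlet_line R _ _ (a ord0)) => //.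
  + exact: (bsupp1_slice uS y).
  + exact: (bsupp1_slice (gS ord0) y).
  + exact: ug.
  + by move=> t ta; apply: u0; rewrite rV_cons0.
Qed.

End grid.

(** * Test functions and the Dirichlet form *)

Section smooth_functions.
Context {R : realType} {n : nat}.
Implicit Types f g : 'rV[R]_n -> R.

Lemma smooth_differentiable f x : smooth_on setT f -> differentiable f x.
Proof. by move=> sf; exact: (sf [::] x I). Qed.

Lemma smooth_derivable f x v : smooth_on setT f -> derivable f x v.
Proof. by move=> sf; apply: diff_derivable; exact: smooth_differentiable. Qed.

Lemma smooth_continuous f : smooth_on setT f -> continuous f.
Proof.
by move=> sf x; apply: differentiable_continuous; exact: smooth_differentiable.
Qed.

Lemma partials_pderiv (W : normedModType R) s i (f : 'rV[R]_n -> W) :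
  partials s (fun x => 'D_(delta_mx ord0 i) f x) = partials (rcons s i) f.
Proof. by rewrite /partials foldr_rcons. Qed.

Lemma smooth_pderiv f i : smooth_on setT f -> smooth_on setT (pderiv i f).
Proof. by move=> sf s x _; rewrite partials_pderiv; exact: sf. Qed.

Lemma partials_linear f g a s : smooth_on setT f -> smooth_on setT g ->
  partials s (a *: f + g) = a *: partials s f + partials s g.
Proof.
move=> sf sg; elim: s => [//|i s ih] /=; rewrite ih; apply/funext => x /=.
have df : derivable (partials s f) x (delta_mx ord0 i) by apply: diff_derivable; exact: sf.
have dg : derivable (partials s g) x (delta_mx ord0 i) by apply: diff_derivable; exact: sg.
by rewrite deriveD//; [rewrite deriveZ|exact: derivableZ].
Qed.

Lemma smooth_linear f g a : smooth_on setT f -> smooth_on setT g ->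
  smooth_on setT (a *: f + g).
Proof.
move=> sf sg s x _; rewrite partials_linear//.
by apply: differentiableD; [apply: differentiableZ; exact: sf|exact: sg].
Qed.

(** Smoothness by coinduction: a class of differentiable functions stable under partial derivatives
    consists of smooth functions. This avoids formulas for iterated partials. *)
Lemma smooth_on_coind (W : normedModType R) (C : set ('rV[R]_n -> W)) :
  (forall f : 'rV[R]_n -> W, C f -> forall x, differentiable f x) ->
  (forall f : 'rV[R]_n -> W, C f -> forall i, C (fun x => 'D_(delta_mx ord0 i) f x)) ->
  forall f : 'rV[R]_n -> W, C f -> smooth_on setT f.
Proof.
move=> Cd CD f Cf s x _; apply: Cd.
by elim: s => [//|i s ih] /=; exact: CD.
Qed.

Lemma smooth0 : smooth_on setT (0 : 'rV[R]_n -> R).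
Proof.
apply: (@smooth_on_coind _ [set (0 : 'rV[R]_n -> R)]) => //.
  by move=> _ -> x; exact: differentiable_cst.
by move=> _ -> i /=; apply/funext => x; rewrite derive_cst.
Qed.

Lemma laplacianE f : laplacian f = \sum_i pderiv i (pderiv i f).
Proof. by apply/funext => x; rewrite fct_sumE. Qed.

End smooth_functions.

Section test_functions.
Context {R : realType} {n : nat}.
Variable Omega : set 'rV[R]_n.
Hypothesis cOmega : compact Omega.
Implicit Types f g : 'rV[R]_n -> R.
Local Notation test := (test_function Omega).

Lemma test0 : test 0.
Proof.
split; first exact: smooth0.
rewrite (_ : [set x | _] = set0) ?closure0//.
by apply/seteqP; split => // x /=; rewrite eqxx.
Qed.

Lemma test_linear a f g : test f -> test g -> test (a *: f + g).
Proof.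
move=> [sf cf] [sg cg]; split; first exact: smooth_linear.
apply: (@subset_trans _ (closure ([set x | f x != 0] `|` [set x | g x != 0]))).
  apply: closure_subset => x /= h.
  have [fx|] := eqVneq (f x) 0; last by left.
  right; apply: contraNneq h => gx.
  by rewrite -[(_ + _) x]/(a *: f x + g x) fx gx scaler0 addr0.
by rewrite closureU subUset.
Qed.

Lemma notin_closure_supp_near0 f x : ~ closure [set y | f y != 0] x ->
  \forall y \near x, f y = 0.
Proof.
move=> /existsNP[B /not_implyP[xB AB]]; apply: filterS xB => y By.
by apply/eqP; apply: contra_notT AB => fy; exists y.
Qed.

Lemma test_near0 f x : test f -> ~ interior Omega x -> \forall y \near x, f y = 0.
Proof. by move=> [_ cf] xO; apply: notin_closure_supp_near0 => /cf. Qed.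

Lemma test_out f x : test f -> ~ Omega x -> f x = 0.
Proof.
move=> [_ cf] xO; apply/eqP; apply: contra_notT xO => fx.
by apply: interior_subset; apply: cf; exact: subset_closure.
Qed.

Lemma test_pderiv f i : test f -> test (pderiv i f).
Proof.
move=> [sf cf]; split; first exact: smooth_pderiv.
apply: subset_trans cf; rewrite [X in _ `<=` X](closure_id _).1; last exact: closed_closure.
apply: closure_subset => x /= fx; apply: contrapT => /notin_closure_supp_near0 f0.
by move: fx; rewrite /pderiv (near_eq_derive _ f0) derive_cst eqxx.
Qed.

Lemma compact_coord_bounded : exists B : R, forall x, Omega x -> forall i, `|x ord0 i| <= B.
Proof.
have [B [_ OB]] := compact_bounded cOmega.
exists (`|B| + 1) => x Ox i.
have : `|x| <= `|B| + 1 by apply: OB => //; have := ler_norm B; lra.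
apply: le_trans; rewrite -[leRHS]/(mx_norm x) mx_normrE.
exact: (le_bigmax _ (fun ij : 'I_1 * 'I_n => `|x ij.1 ij.2|) (ord0, i)).
Qed.

Lemma test_supp_bounded f : test f -> supp_bounded f.
Proof.
move=> tf; have [B OB] := compact_coord_bounded.
exists B => x [i xi]; apply: test_out tf _ => /OB/(_ i).
by rewrite leNgt xi.
Qed.

Lemma test_bsupp f : test f -> bsupp f.
Proof.
move=> tf; apply: bsupp_continuous; last exact: test_supp_bounded.
by apply: smooth_continuous; case: tf.
Qed.

Lemma test_weak_grad f : test f -> weak_grad f (fun i => pderiv i f).
Proof.
move=> tf; have [sf _] := tf; apply: weak_grad_C1.
- exact: smooth_continuous.
- exact: test_supp_bounded.
- by move=> i x; exact: smooth_derivable.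
- by move=> i; apply: smooth_continuous; exact: smooth_pderiv.
Qed.

Lemma measurable_compact : measurable Omega.
Proof.
have clO : closed Omega by apply: compact_closed => //; exact: norm_hausdorff.
by have := measurableC (measurable_open_rV (closed_openC clO)); rewrite setCK.
Qed.

Lemma L2_inner_out f g : (forall x, ~ Omega x -> f x * g x = 0) ->
  L2_inner Omega f g = integral_rV (fun x => f x * g x).
Proof.
move=> fg; rewrite /L2_inner Rintegral_mkcond; apply: eq_Rintegral => x _.
rewrite patchE; case: ifPn => // /negP xO; rewrite fg// => Ox.
by apply: xO; rewrite inE.
Qed.

Lemma pderivM f g i j : smooth_on setT f -> smooth_on setT g ->
  pderiv j (fun x => pderiv i f x * g x) =
  fun x => pderiv j (pderiv i f) x * g x + pderiv i f x * pderiv j g x.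
Proof.
move=> sf sg; apply/funext => x; rewrite /pderiv.
have df : derivable (pderiv i f) x (delta_mx ord0 j).
  by apply: smooth_derivable; exact: smooth_pderiv.
have dg : derivable g x (delta_mx ord0 j) by exact: smooth_derivable.
have -> : (fun y => 'D_(delta_mx ord0 i) f y * g y) = pderiv i f * g by [].
rewrite deriveM// /GRing.scale/= addrC mulrC; congr (_ + _).
Qed.

(** The product [pderiv i f * g] has bounded support, so the integral of its [i]-th derivative is
    zero, and the Leibniz rule splits it. *)
Lemma integral_by_parts f g i : test f -> test g ->
  integral_rV (fun x => pderiv i (pderiv i f) x * g x) =
  - integral_rV (fun x => pderiv i f x * pderiv i g x).
Proof.
move=> tf tg; have [sf _] := tf; have [sg _] := tg.
have tfi := test_pderiv i tf.
have wg : weak_grad (fun x => pderiv i f x * g x)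
    (fun j => pderiv j (fun x => pderiv i f x * g x)).
  have sfi := smooth_pderiv i sf.
  apply: weak_grad_C1.
  - move=> x; exact: (cvgM (smooth_continuous sfi (x := x)) (smooth_continuous sg (x := x))).
  - by have [B gB] := test_supp_bounded tg; exists B => x /gB ->; rewrite mulr0.
  - by move=> j x; apply: derivableM; exact: smooth_derivable.
  - move=> j; rewrite pderivM// => x.
    have c1 := smooth_continuous (smooth_pderiv j sfi).
    have c2 := smooth_continuous (smooth_pderiv j sg).
    have c3 := smooth_continuous sfi; have c4 := smooth_continuous sg.
    exact: (cvgD (cvgM (c1 x) (c4 x)) (cvgM (c3 x) (c2 x))).
have := weak_grad_integral0 i wg; rewrite pderivM// integral_rVD.
- by move/eqP; rewrite addr_eq0 => /eqP.
- by apply: bsuppMM; apply: test_bsupp => //; exact: test_pderiv.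
- by apply: bsuppMM; apply: test_bsupp => //; exact: test_pderiv.
Qed.

(** Green's formula, with integrals over the whole space as test functions vanish outside [Omega].
    Symmetry and nonnegativity of the energy are read off from it. *)
Lemma test_energyE f g : test f -> test g ->
  energy (L2_inner Omega) (fun h => \- laplacian h) f g =
  \sum_i integral_rV (fun x => pderiv i f x * pderiv i g x).
Proof.
move=> tf tg; rewrite /energy L2_inner_out; last first.
  by move=> x xO; rewrite (test_out tg xO) mulr0.
transitivity (integral_rV (fun x => \sum_i (- 1) * (pderiv i (pderiv i f) x * g x))).
  congr integral_rV; apply/funext => x.
  by rewrite -mulr_sumr mulN1r /= laplacianE fct_sumE mulNr mulr_suml.
have S i : bsupp (fun x => pderiv i (pderiv i f) x * g x).
  by apply: bsuppMM; apply: test_bsupp => //; do 2 apply: test_pderiv.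
rewrite integral_rV_sum; last by move=> i; exact: bsuppZ.
by apply: eq_bigr => i _; rewrite integral_rVZ// integral_by_parts// mulN1r opprK.
Qed.

End test_functions.

(** * The Riesz-Fischer theorem *)

Lemma limn_einf_le (R : realType) (a : nat -> \bar R) (c : \bar R) K :
  (forall k, (K <= k)%N -> (a k <= c)%E) -> (limn_einf a <= c)%E.
Proof.
move=> ac; rewrite limn_einf_lim; apply: lime_le; first exact: is_cvg_einfs.
apply: nearW => n; apply: le_trans (ac (maxn n K) (leq_maxr _ _)).
by apply: ereal_inf_lbound; exists (maxn n K) => //=; exact: leq_maxl.
Qed.

Lemma nneseries_le (R : realType) (a : nat -> \bar R) (c : \bar R) :
  (forall k, 0 <= a k)%E -> (forall n, \sum_(0 <= k < n) a k <= c)%E ->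
  (\sum_(k <oo) a k <= c)%E.
Proof.
move=> a0 ac; apply: lime_le; first by apply: is_cvg_nneseries => k _ _; exact: a0.
by apply: nearW => n; exact: ac.
Qed.

Lemma cvgn_of_abs_increments (R : realType) (a : nat -> R) :
  (\sum_(k <oo) `|a k.+1 - a k|%:E < +oo)%E -> cvgn a.
Proof.
move=> S; set s := (\sum_(k <oo) _)%E in S.
have s0 : (0 <= s)%E by apply: nneseries_ge0 => k _ _; rewrite lee_fin.
have sfin : s = (fine s)%:E by rewrite fineK// ge0_fin_numE.
have ub n : \sum_(0 <= k < n) `|a k.+1 - a k| <= fine s.
  rewrite -lee_fin -sfin -sumEFin; apply: nneseries_lim_ge => k _ _.
  by rewrite lee_fin.
have cs : cvgn (series (fun k => a k.+1 - a k)).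
  apply: normed_cvg; apply: nondecreasing_is_cvgn.
    apply/nondecreasing_seqP => n; rewrite -[leRHS]/(\sum_(0 <= k < n.+1) `|a k.+1 - a k|).
    by rewrite big_nat_recr//= lerDl.
  by exists (fine s) => _ [n _ <-]; exact: ub.
have -> : a = (fun n => series (fun k => a k.+1 - a k) n + a 0%N).
  apply/funext => n; rewrite /series/=.
  elim: n => [|n ih]; first by rewrite big_geq// add0r.
  by rewrite big_nat_recr//= addrAC -ih; ring.
by apply: is_cvgD => //; exact: is_cvg_cst.
Qed.

Section riesz_fischer.
Context d (T : measurableType d) (R : realType).
Variables (mu : {measure set T -> \bar R}) (D : set T).
Hypotheses (mD : measurable D) (muD : (mu D < +oo)%E).
Variable phi : nat -> T -> R.
Hypothesis mphi : forall k, measurable_fun D (phi k).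
Hypothesis cauchy : forall e : R, 0 < e -> exists N : nat, forall k l : nat,
  (N <= k)%N -> (N <= l)%N -> (\int[mu]_(x in D) ((phi k x - phi l x) ^+ 2)%:E < e%:E)%E.

Let mdist k l : measurable_fun D (fun x => phi k x - phi l x).
Proof. exact: measurable_funB. Qed.

Let mdist2 k l : measurable_fun D (fun x => ((phi k x - phi l x) ^+ 2)%:E).
Proof. by apply/measurable_EFinP; exact: measurable_funX. Qed.

(** Squared distances below [4 ^- k] are distances below [2 ^- k], which are summable. *)
Let fast_subsequence : exists n_ : nat -> nat, (forall k, (k <= n_ k)%N) /\
  forall k, (\int[mu]_(x in D) ((phi (n_ k.+1) x - phi (n_ k) x) ^+ 2)%:E < ((4 ^+ k)^-1)%:E)%E.
Proof.
have /choice[N NP] : forall k, exists N : nat, forall i j : nat, (N <= i)%N -> (N <= j)%N ->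
    (\int[mu]_(x in D) ((phi i x - phi j x) ^+ 2)%:E < ((4 ^+ k)^-1)%:E)%E.
  by move=> k; apply: cauchy; rewrite invr_gt0 exprn_gt0.
(* The maximum over all [i <= k] ensures that [n_ k.+1], like [n_ k], is at least [N k]. *)
pose n_ k := (\max_(i < k.+1) maxn i (N i))%N.
have le_n i k : (i <= k)%N -> (maxn i (N i) <= n_ k)%N.
  by move=> ik; exact: (@leq_bigmax _ (fun i : 'I_k.+1 => maxn i (N i)) (Ordinal (ik : i < k.+1)%N)).
exists n_; split => k; first by apply: leq_trans (le_n _ _ (leqnn k)); exact: leq_maxl.
apply: NP.
  by apply: leq_trans (le_n k _ (leqnSn k)); exact: leq_maxr.
by apply: leq_trans (le_n k _ (leqnn k)); exact: leq_maxr.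
Qed.

(** Along a fast subsequence the increments are summable in L^1, so that it converges almost
    everywhere; Fatou's lemma then bounds the distance from any late [phi m] to the limit. *)
Lemma riesz_fischer : exists u : T -> R, measurable_fun D u /\
  forall e : R, 0 < e -> exists N : nat, forall k : nat, (N <= k)%N ->
    (\int[mu]_(x in D) ((phi k x - u x) ^+ 2)%:E <= e%:E)%E.
Proof.
have [n_ [n_ge n_fast]] := fast_subsequence.
pose psi k := phi (n_ k).
pose dk k x := `|psi k.+1 x - psi k x|.
have mdk k : measurable_fun D (fun x => (dk k x)%:E).
  by apply/measurable_EFinP; apply: measurableT_comp => //; exact: mdist.
pose c := fine (mu D).
have muDc : mu D = c%:E by rewrite fineK// ge0_fin_numE.
have c0 : 0 <= c by rewrite fine_ge0.
have dk0 k x : 0 <= dk k x by exact: normr_ge0.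
(* From [|t| <= p + t ^+ 2 / p] with [p = 2 ^- k]: as [D] has finite measure, square integrals
   control integrals of absolute values. *)
have dk_int k : (\int[mu]_(x in D) (dk k x)%:E <= ((2 ^+ k)^-1 * (c + 1))%:E)%E.
  pose p : R := (2 ^+ k)^-1.
  have p0 : 0 < p by rewrite invr_gt0 exprn_gt0.
  apply: (@le_trans _ _ (\int[mu]_(x in D) (p%:E + p^-1%:E * ((psi k.+1 x - psi k x) ^+ 2)%:E))%E).
    apply: ge0_le_integral => //.
    - by move=> x _; rewrite lee_fin dk0.
    - by apply: emeasurable_funD => //; apply: emeasurable_funM => //; exact: mdist2.
    - move=> x _; rewrite -EFinM -EFinD lee_fin /dk.
      set t := psi k.+1 x - psi k x.
      have : 0 <= p^-1 * (p - `|t|) ^+ 2 by rewrite mulr_ge0 ?sqr_ge0// invr_ge0 ltW.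
      rewrite -(real_normK (num_real t)); set w := `|t|.
      have w0 : 0 <= w by exact: normr_ge0.
      have -> : p^-1 * (p - w) ^+ 2 = p + p^-1 * w ^+ 2 - 2 * w by field; rewrite gt_eqF.
      by lra.
  rewrite ge0_integralD//; last 2 first.
    - by move=> x _; rewrite -EFinM lee_fin mulr_ge0 ?sqr_ge0// invr_ge0 ltW.
    - by apply: emeasurable_funM => //; exact: mdist2.
  - rewrite integral_cst// muDc ge0_integralZl//; last 2 first.
      + by move=> x _; rewrite lee_fin sqr_ge0.
      + by rewrite lee_fin invr_ge0 ltW.
      apply: (@le_trans _ _ (p%:E * c%:E + p^-1%:E * ((4 ^+ k)^-1)%:E)%E).
        by apply: leeD2l; apply: lee_wpmul2l; [rewrite lee_fin invr_ge0 ltW|exact: (ltW (n_fast k))].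
      rewrite -!EFinM -EFinD lee_fin /p invrK.
      have -> : (4 ^+ k)^-1 = (2 ^+ k)^-1 * (2 ^+ k)^-1 :> R.
        by rewrite -invfM -exprMn; congr ((_ ^+ k)^-1); ring.
      by rewrite mulrA mulfV ?mul1r ?mulrDr ?mulr1// expf_neq0.
  - exact: mdist2.
  - by move=> x _; rewrite lee_fin ltW.
have Gint : (\int[mu]_(x in D) (\sum_(k <oo) (dk k x)%:E) < +oo)%E.
  rewrite integral_nneseries//; last by move=> k x _; rewrite lee_fin dk0.
  apply: le_lt_trans (ltry (2 * (c + 1))).
  apply: nneseries_le => [k|n]; first by apply: integral_ge0 => x _; rewrite lee_fin dk0.
  apply: (@le_trans _ _ (\sum_(0 <= k < n) ((2 ^+ k)^-1 * (c + 1))%:E)%E).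
    by apply: lee_sum => k _; exact: dk_int.
  rewrite sumEFin lee_fin -mulr_suml ler_wpM2r ?addr_ge0//.
  suff -> : \sum_(0 <= k < n) (2 ^+ k)^-1 = 2 - 2 * (2 ^+ n)^-1 :> R.
    by rewrite gerBl mulr_ge0// invr_ge0 exprn_ge0.
  elim: n => [|n ih]; first by rewrite big_geq// expr0 invr1 mulr1 subrr.
  by rewrite big_nat_recr//= ih exprS; field; rewrite expf_neq0.
have mG : measurable_fun D (fun x => (\sum_(k <oo) (dk k x)%:E)%E).
  by apply: ge0_emeasurable_sum => // k x Dx _; rewrite lee_fin dk0.
have G_ae : {ae mu, forall x, D x -> cvgn (fun k => psi k x)}.
  have Gi : mu.-integrable D (fun x => (\sum_(k <oo) (dk k x)%:E)%E).
    apply/integrableP; split => //.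
    rewrite (eq_integral (fun x => (\sum_(k <oo) (dk k x)%:E)%E))// => x _.
    by rewrite gee0_abs//; apply: nneseries_ge0 => k _ _; rewrite lee_fin dk0.
  have := integrable_ae mD Gi; apply: filterS => x h Dx.
  apply: cvgn_of_abs_increments; have := h Dx.
  by rewrite ge0_fin_numE//; apply: nneseries_ge0 => k _ _; rewrite lee_fin dk0.
(* The upper limit is measurable and equals the limit wherever the subsequence converges; [fine]
   gives a default value where it is infinite, which happens on a null set only. *)
pose u x := fine (limn_esup (fun k => (psi k x)%:E)).
have mu_ : measurable_fun D u.
  apply: measurableT_comp => //; apply: measurable_fun_limn_esup => k.
  by apply/measurable_EFinP; exact: mphi.
have uE x : cvgn (fun k => psi k x) -> (fun k => psi k x) @ \oo --> u x.
  move=> cx; have lx : (fun k => (psi k x)%:E) @ \oo --> (limn (fun k => psi k x))%:E.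
    by apply: cvg_EFin => //; exact: nearW.
  rewrite /u is_cvg_limn_esupE; last by apply/cvg_ex; eexists; exact: lx.
  by rewrite (cvg_lim _ lx).
exists u; split => // e e0; have [N NP] := cauchy e0.
exists N => m Nm.
have mum : measurable_fun D (fun x => ((phi m x - u x) ^+ 2)%:E).
  by apply/measurable_EFinP; apply: measurable_funX; exact: measurable_funB.
pose F k x := ((phi m x - psi k x) ^+ 2)%:E.
have mF k : measurable_fun D (F k) by exact: mdist2.
have mFl : measurable_fun D (fun x => limn_einf (F^~ x)).
  rewrite (_ : (fun x => _) = (fun x => - limn_esup (fun k => - F k x))%E).
    apply: measurableT_comp => //; apply: measurable_fun_limn_esup => k.
    by apply: measurableT_comp.
  by apply/funext => x; rewrite -limn_einfN; congr limn_einf; apply/funext => k; exact: (esym (oppeK _)).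
rewrite (@ge0_ae_eq_integral _ _ _ _ _ _ (fun x => limn_einf (F^~ x)))//.
- apply: (le_trans (fatou _ _ _ _)) => //; first by move=> k x _; rewrite lee_fin sqr_ge0.
  apply: (@limn_einf_le _ _ _ N) => k Nk; apply: ltW; apply: NP => //.
  exact: leq_trans (n_ge k).
- by move=> x _; rewrite lee_fin sqr_ge0.
- move=> x _; rewrite limn_einf_lim; apply: lime_ge; first exact: is_cvg_einfs.
  by apply: nearW => k; apply: le_ereal_inf_tmp => _ [j _ <-]; rewrite lee_fin sqr_ge0.
- apply: filterS G_ae => x h Dx.
  have ux := uE x (h Dx).
  have Fx : (F^~ x) @ \oo --> ((phi m x - u x) ^+ 2)%:E.
    apply: cvg_EFin; first exact: nearW.
    rewrite (_ : _ \o _ = (fun k => (phi m x - psi k x) * (phi m x - psi k x))).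
      by rewrite expr2; apply: cvgM; apply: cvgB => //; exact: cvg_cst.
    by apply/funext => k.
  rewrite is_cvg_limn_einfE; last by apply/cvg_ex; eexists; exact: Fx.
  by rewrite (cvg_lim _ Fx).
Qed.
End riesz_fischer.

(** * The counting function of a compact domain *)

Section L2_space.
Context {R : realType} {n : nat}.
Variable Omega : set 'rV[R]_n.
Hypothesis cOmega : compact Omega.
Local Notation leb := (@lebesgue_rV R n).
Local Notation X := (L2 Omega).
Local Notation D := (test_function Omega).
Local Notation ip := (L2_inner Omega).
Local Notation A := (fun f : 'rV[R]_n -> R => \- laplacian f).

Let mO : measurable Omega. Proof. exact: measurable_compact. Qed.

Lemma lebesgue_rV_compact : (leb Omega < +oo)%E.
Proof.
have [B OB] := compact_coord_bounded cOmega.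
apply: le_lt_trans (lebesgue_rV_centered_box n B).
by apply: le_measure; rewrite ?inE//; exact: measurable_centered_box.
Qed.

Lemma L2_integrable_sqr u : X u -> leb.-integrable Omega (EFin \o (fun x => u x ^+ 2)).
Proof.
move=> [mu ui]; apply/integrableP; split.
  by apply/measurable_EFinP; exact: measurable_funX.
by under eq_integral => x _ do rewrite /= ger0_norm ?sqr_ge0//.
Qed.

Lemma L2_integrableM u v : X u -> X v -> leb.-integrable Omega (EFin \o (fun x => u x * v x)).
Proof.
move=> Xu Xv; have [mu _] := Xu; have [mv _] := Xv.
apply: (le_integrable mO _ _
  (integrableD mO (L2_integrable_sqr Xu) (L2_integrable_sqr Xv))).
  by apply/measurable_EFinP; exact: measurable_funM.
move=> x _; rewrite /= lee_fin [leRHS]ger0_norm ?addr_ge0 ?sqr_ge0//.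
rewrite ler_norml; apply/andP; split.
  by have := sqr_ge0 (u x + v x); have := sqr_ge0 (u x); have := sqr_ge0 (v x); lra.
by have := sqr_ge0 (u x - v x); have := sqr_ge0 (u x); have := sqr_ge0 (v x); lra.
Qed.

Lemma L2_of_integrable u : measurable_fun Omega (u : 'rV[R]_n -> measurableTypeR R) ->
  leb.-integrable Omega (EFin \o (fun x => u x ^+ 2)) -> X u.
Proof.
move=> mu /integrableP[_ ui]; split => //.
by under eq_integral => x _ do rewrite -[u x ^+ 2]ger0_norm ?sqr_ge0//.
Qed.

Lemma L2_linear a u v : X u -> X v -> X (a *: u + v).
Proof.
move=> Xu Xv; have [mu _] := Xu; have [mv _] := Xv.
have mauv : measurable_fun Omega ((a *: u + v) : 'rV[R]_n -> measurableTypeR R).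
  apply: measurable_funD => //.
  exact: (measurable_funM (measurable_cst a) mu).
apply: L2_of_integrable => //.
have i1 := integrableZl mO (a ^+ 2) (L2_integrable_sqr Xu).
have i2 := integrableZl mO (2 * a) (L2_integrableM Xu Xv).
have := integrableD mO (integrableD mO i1 i2) (L2_integrable_sqr Xv).
apply: eq_integrable => // x _ /=; rewrite -!EFinM -!EFinD; congr EFin.
by rewrite -[(_ + _) x]/(a * u x + v x); ring.
Qed.

Lemma L2_psd_form : psd_form X ip.
Proof.
split.
- split; first exact: measurable_cst.
  rewrite (eq_integral (fun=> 0%E)) ?integral0 ?ltry// => x _.
  by rewrite expr0n.
- exact: L2_linear.
- by move=> u v _ _; apply: eq_Rintegral => x _; rewrite mulrC.
- move=> a u v w Xu Xv Xw; rewrite /L2_inner.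
  rewrite -RintegralZl//; last exact: L2_integrableM.
  rewrite -RintegralD//; last 2 first.
    + exact: (integrableZl mO a (L2_integrableM Xu Xw)).
    + exact: L2_integrableM.
  apply: eq_Rintegral => x _.
  by rewrite -[(_ + _) x]/(a * u x + v x) mulrDl mulrA.
- by move=> u _; apply: Rintegral_ge0 => x _; rewrite -expr2 sqr_ge0.
Qed.

Lemma bsupp_L2 f : bsupp f -> X f.
Proof.
move=> fS; have [mf _] := fS; apply: L2_of_integrable; first exact: measurable_funTS.
by apply: integrableS (bsupp_integrable (bsupp_sqr fS)).
Qed.

Lemma test_L2 f : D f -> X f.
Proof. by move=> tf; apply: bsupp_L2; exact: (test_bsupp cOmega tf). Qed.

Lemma laplacian_linear a (f g : 'rV[R]_n -> R) : smooth_on setT f -> smooth_on setT g ->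
  laplacian (a *: f + g) = a *: laplacian f + laplacian g.
Proof.
move=> sf sg; apply/funext => x; rewrite /laplacian.
rewrite -[RHS]/(a * (\sum_i partials [:: i; i] f x) + \sum_i partials [:: i; i] g x).
rewrite mulr_sumr -big_split/=; apply: eq_bigr => i _.
by have := congr1 (fun h => h x) (partials_linear a [:: i; i] sf sg).
Qed.

Lemma test_laplacian f : D f -> D (A f).
Proof.
move=> tf; have {1}-> : \- laplacian f = (-1) *: laplacian f + 0.
  by rewrite scaleN1r addr0.
apply: test_linear; last exact: test0.
rewrite laplacianE; elim/big_rec : _ => [|i g _ tg]; first exact: test0.
rewrite -[pderiv _ _]scale1r; apply: test_linear => //.
by do 2 apply: test_pderiv.
Qed.

Lemma test_energy_psd_form : psd_form D (energy ip A).
Proof.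
split.
- exact: test0.
- by move=> a u v; exact: test_linear.
- move=> u v tu tv; rewrite (test_energyE cOmega tu tv) (test_energyE cOmega tv tu).
  apply: eq_bigr => i _.
  by congr integral_rV; apply/funext => x; rewrite mulrC.
- move=> a u v w tu tv tw.
  transitivity (ip (a *: (\- laplacian u) + (\- laplacian v)) w).
    apply: (congr1 (ip^~ w)).
    have [su _] := tu; have [sv _] := tv.
    transitivity (- (laplacian (a *: u + v))); first by [].
    by rewrite laplacian_linear// opprD -scalerN.
  by apply: (psd_linear L2_psd_form); apply: test_L2 => //; exact: test_laplacian.
- move=> u tu; rewrite (test_energyE cOmega)//; apply: sumr_ge0 => i _.
  by apply: integral_rV_ge0 => x; rewrite -expr2 sqr_ge0.
Qed.

Let EFin_ip u v : X u -> X v -> (\int[leb]_(x in Omega) (u x * v x)%:E)%E = (ip u v)%:E.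
Proof.
by move=> Xu Xv; rewrite /L2_inner fineK//; apply: integrable_fin_num => //; exact: L2_integrableM.
Qed.

Lemma L2_complete (phi : nat -> 'rV[R]_n -> R) : (forall k, X (phi k)) ->
  (forall e : R, 0 < e -> exists N : nat, forall k l : nat,
     (N <= k)%N -> (N <= l)%N -> ip (phi k - phi l) (phi k - phi l) < e) ->
  exists2 u, X u & (fun k => ip (phi k - u) (phi k - u)) @ \oo --> (0 : R).
Proof.
move=> Xphi phiC; have XB := psd_memB L2_psd_form.
have sqE u v : X u -> X v -> (\int[leb]_(x in Omega) ((u x - v x) ^+ 2)%:E)%E = (ip (u - v) (u - v))%:E.
  by move=> Xu Xv; rewrite -EFin_ip//; exact: XB.
have [|e e0|u [mu uP]] := @riesz_fischer _ _ _ leb Omega mO lebesgue_rV_compact phi.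
- by move=> k; case: (Xphi k).
- by have [N NP] := phiC e e0; exists N => k l Nk Nl; rewrite sqE// lte_fin NP.
have Xu : X u.
  have [N NP] := uP 1 ltr01.
  have XNu : X (phi N - u).
    split; first by apply: measurable_funB => //; case: (Xphi N).
    by apply: le_lt_trans (NP N (leqnn N)) _; rewrite ltry.
  by have := XB _ _ (Xphi N) XNu; rewrite opprB addrCA subrr addr0.
exists u => //; apply/cvgr0Pnorm_le => e e0.
have [N NP] := uP e e0; exists N => // k Nk /=.
rewrite ger0_norm; last by apply: (psd_ge0 L2_psd_form); exact: XB.
by rewrite -lee_fin -sqE// NP.
Qed.

Lemma L2_null u : X u -> ip u u = 0 <-> {ae leb, forall x, Omega x -> u x = 0}.
Proof.
move=> Xu; have [mu _] := Xu.
have m2 : measurable_fun Omega (fun x => (u x * u x)%:E).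
  by apply/measurable_EFinP; exact: measurable_funM.
have H := @ae_eq_integral_abs _ _ _ leb Omega mO _ m2.
have E : (\int[leb]_(x in Omega) `|(u x * u x)%:E|)%E = (ip u u)%:E.
  rewrite -EFin_ip//; apply: eq_integral => x _.
  by rewrite gee0_abs// lee_fin -expr2 sqr_ge0.
rewrite E in H; split.
  move=> u0; have {u0}/H : (ip u u)%:E = 0%E by rewrite u0.
  apply: filterS => x h Ox; have /eqP := h Ox.
  by rewrite eqe -expr2 sqrf_eq0 => /eqP.
move=> h; suff : (ip u u)%:E = 0%E by case.
by apply/H; apply: filterS h => x h Ox; rewrite h//= mul0r.
Qed.

Lemma dirichlet_eigenspaceE lam :
  dirichlet_eigenspace Omega lam = weak_eigenvector X D ip A lam.
Proof.
apply/funext => u; apply/propext; split.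
  move=> [[Xu [phi [tphi phiu phiC]]] _ ueig]; split => //; first by exists phi.
  move=> psi tpsi; rewrite ueig//.
  have Xpsi := test_L2 tpsi; rewrite -(psdZl L2_psd_form lam Xu Xpsi).
  by apply: eq_Rintegral => x _.
move=> [Xu [phi [tphi phiu phiC]] ueig]; split; first by split => //; exists phi.
  exact: (psd_memZ L2_psd_form lam Xu).
move=> psi tpsi; rewrite ueig//.
have Xpsi := test_L2 tpsi; rewrite -(psdZl L2_psd_form lam Xu Xpsi).
by apply: eq_Rintegral => x _.
Qed.

(** Null vectors of [ip] are the functions vanishing almost everywhere on [Omega], so the two
    notions of independence, and the two dimensions, agree. *)
Lemma dirichlet_countingE x :
  dirichlet_counting Omega x = eigen_count X D ip A x.
Proof.
apply: eq_esum => lam _; rewrite /L2_dim /eigen_dim dirichlet_eigenspaceE.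
congr (ereal_sup (_ @` _)).
have free k (u : 'I_k -> 'rV[R]_n -> R) : (forall i, X (u i)) ->
    L2_free Omega u <-> ip_free ip u.
  move=> Xu.
  have Xsum c : X (\sum_i c i *: u i) by exact: (psd_mem_sum L2_psd_form).
  have sumE (c : 'I_k -> R) : {ae leb, forall z, Omega z -> (\sum_i c i *: u i) z = 0} <->
      {ae leb, forall z, Omega z -> \sum_(i < k) c i * u i z = 0}.
    by split; apply: filterS => z h Oz; have := h Oz; rewrite fct_sumE.
  split=> uf c.
    by move/(L2_null (Xsum c))/sumE; exact: uf.
  by move=> /sumE /(L2_null (Xsum c)); exact: uf.
apply/funext => k; apply/propext; split=> -[u [ul uf]]; exists u; split => //.
  by apply/free => // i; case: (ul i).
by apply/free => // i; case: (ul i).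
Qed.

Lemma indic_cell_L2 (a : 'I_n -> R) h : X (\1_(cell a h)).
Proof. by apply: bsupp_L2; exact: bsupp_cell. Qed.

Lemma L2_inner_sqr f : D f -> ip f f = integral_rV (fun x => f x ^+ 2).
Proof.
by move=> tf; rewrite (L2_inner_out (f := f) (g := f))// => x xO; rewrite (test_out tf xO) mul0r.
Qed.

Lemma L2_inner_cell f a h : D f ->
  ip f (\1_(cell a h)) = integral_rV (fun x => \1_(cell a h) x * f x).
Proof.
move=> tf; rewrite (L2_inner_out (f := f)).
  by congr integral_rV; apply/funext => x; rewrite mulrC.
by move=> x xO; rewrite (test_out tf xO) mul0r.
Qed.

Lemma test_energy_sqr f : D f ->
  energy ip A f f = \sum_i integral_rV (fun x => pderiv i f x ^+ 2).
Proof. by move=> tf; rewrite (test_energyE cOmega). Qed.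

End L2_space.

(** * Min-max bounds for compact domains *)

Section bounded_domain.
Context {R : realType} {n : nat}.
Variable Omega : set 'rV[R]_n.+1.
Hypothesis cOmega : compact Omega.
Local Notation X := (L2 Omega).
Local Notation D := (test_function Omega).
Local Notation ip := (L2_inner Omega).
Local Notation A := (fun f : 'rV[R]_n.+1 -> R => \- laplacian f).

Lemma test_poincare_grid (a : 'I_n.+1 -> R) h m M f : 0 < h ->
  (forall x, interior Omega x -> hbox a (grid_size h m M) x) -> D f ->
  ip f f <= (h ^+ n.+1)^-1 * \sum_(k < #|{: grid_index n m M}|)
      ip f (\1_(cell (grid_corner a h (enum_val k)) h)) ^+ 2 +
    h ^+ 2 * energy ip A f f.
Proof.
move=> h0 Oh tf; rewrite (L2_inner_sqr tf) (test_energy_sqr cOmega tf).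
have := @poincare_grid R n a h m M h0 f _ (test_weak_grad cOmega tf).
under [X in _ -> _ <= _ * X + _]eq_bigr => k _ do rewrite (L2_inner_cell _ _ tf).
rewrite -(big_enum_val (A := {: grid_index n m M}) (fun k =>
  integral_rV (fun x => \1_(cell (grid_corner a h k) h) x * f x) ^+ 2)).
apply => x xB; have xO : ~ interior Omega x by move=> /Oh.
exact: nbhs_singleton (test_near0 tf xO).
Qed.

(** [Omega] is covered by a grid of cells of side [h], and the functionals are the integrals over
    the cells. The number [N] of cells per side makes [h * (|y| + 1) <= 1], hence
    [|y| * h ^+ 2 <= 1]. *)
Lemma test_poincare (y : R) : exists K (C : R) (e : 'I_K -> 'rV[R]_n.+1 -> R),
  [/\ 0 <= C, forall j, X (e j) & forall u, D u ->
    y * ip u u <= energy ip A u u + C * \sum_j ip u (e j) ^+ 2].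
Proof.
have [B OB] := compact_coord_bounded cOmega.
(* The margin [1] makes the upper inequalities of the half-open box strict. *)
pose B' := `|B| + 1.
have B'0 : 0 < B' by rewrite /B' ltr_wpDl.
pose N := (Num.truncn (2 * B' * (`|y| + 1))).+1.
have NB : 2 * B' * (`|y| + 1) < N%:R by exact: truncnS_gt.
pose h := 2 * B' / N%:R.
have N0 : 0 < N%:R :> R by [].
have h0 : 0 < h by rewrite divr_gt0// mulr_gt0.
have hy : `|y| * h ^+ 2 <= 1.
  have y1 : 0 < `|y| + 1 by rewrite ltr_wpDl.
  have h1 : h * (`|y| + 1) <= 1.
    by rewrite /h mulrAC ler_pdivrMr// mul1r ltW.
  have y0 := normr_ge0 y.
  have h2 : h <= 1 by nra.
  have : `|y| * h <= 1 by nra.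
  rewrite expr2; nra.
exists #|{: grid_index n N N}|, (`|y| * (h ^+ n.+1)^-1).
exists (fun k => \1_(cell (grid_corner (fun=> - B') h (enum_val k)) h)); split.
- by rewrite mulr_ge0// invr_ge0 exprn_ge0// ltW.
- by move=> j; exact: indic_cell_L2.
move=> u tu.
have Oh x : interior Omega x -> hbox (fun=> - B') (grid_size h N N) x.
  move=> /interior_subset Ox i; rewrite /grid_size.
  have -> : (if unlift ord0 i is Some _ then N%:R else N%:R) = N%:R :> R by case: (unlift _ _).
  have -> : N%:R * h = 2 * B' by rewrite /h mulrC divfK// gt_eqF.
  have := OB x Ox i; rewrite ler_norml => /andP[x1 x2].
  by have := ler_norm B; rewrite /B' => ?; apply/andP; split; lra.
have := test_poincare_grid h0 Oh tu; rewrite /=.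
set S := \sum_(k < _) _; set u2 := ip u u; set E := energy _ _ _ _ => H.
have u20 : 0 <= u2 by exact: (psd_ge0 (L2_psd_form cOmega) (test_L2 cOmega tu)).
have E0 : 0 <= E by exact: (psd_ge0 (test_energy_psd_form cOmega) tu).
have : y * u2 <= `|y| * u2 by rewrite ler_wpM2r// ler_norm.
have := ler_wpM2l (normr_ge0 y) H; rewrite mulrDr [`|y| * (_ * S)]mulrA [`|y| * (h ^+ 2 * E)]mulrA.
have : `|y| * h ^+ 2 * E <= E by rewrite ler_piMl.
move: (_ * S) (`|y| * u2) (`|y| * h ^+ 2 * E) => p q r; lra.
Qed.

Lemma energy_bounded_dim_le_counting x k :
  energy_bounded_dim D ip A x k -> (k%:R%:E <= dirichlet_counting Omega x)%E.
Proof.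
move=> h; rewrite (dirichlet_countingE cOmega).
apply: energy_bounded_dim_le_eigen_count h.
- exact: L2_psd_form.
- exact: test_energy_psd_form.
- by move=> f; exact: test_L2.
- by move=> f tf; apply: test_L2 => //; exact: test_laplacian.
- by move=> phi tphi; apply: L2_complete => // k'; exact: test_L2.
- exact: test_poincare.
Qed.

Lemma counting_le_energy_bounded_dim x (y : \bar R) :
  (forall k, energy_bounded_dim D ip A x k -> (k%:R%:E <= y)%E) ->
  (dirichlet_counting Omega x <= y)%E.
Proof.
move=> h; rewrite (dirichlet_countingE cOmega).
apply: eigen_count_le_energy_bounded_dim h.
- exact: L2_psd_form.
- exact: test_energy_psd_form.
- by move=> f; exact: test_L2.
- by move=> f tf; apply: test_L2 => //; exact: test_laplacian.
- move=> a u v [su _] [sv _]; rewrite laplacian_linear//.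
  by rewrite -[LHS]/(- (a *: laplacian u + laplacian v)) opprD -scalerN.
Qed.

End bounded_domain.

(** If [K < k], some nonzero [v] of low energy is killed by the [K] functionals. The inequality then
    reads [ip v v <= h * energy v v <= h * (x + d) * ip v v], impossible when [h * (x + d) < 1]. *)
Lemma energy_bounded_dim_le (R : realType) (V : lmodType R) (X D : set V)
    (ip : V -> V -> R) (A : V -> V) (h C x : R) (K k : nat) (e : 'I_K -> V) :
  psd_form X ip -> psd_form D (energy ip A) -> D `<=` X -> (forall j, X (e j)) ->
  0 < h -> x * h < 1 ->
  (forall u, D u -> ip u u <= C * \sum_j ip u (e j) ^+ 2 + h * energy ip A u u) ->
  energy_bounded_dim D ip A x k -> (k <= K)%N.
Proof.
move=> ipP EP DX Xe h0 xh poinc xk; rewrite leqNgt; apply/negP => Kk.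
(* With this slack, [h * (x + d)] is [(1 + x * h) / 2], the midpoint between [x * h] and [1]. *)
have d0 : 0 < (1 - x * h) / (2 * h) by rewrite divr_gt0 ?subr_gt0// mulr_gt0.
have [phi Dphi phiE] := xk _ d0.
have [c c0 ce] := left_kernel_vector (fun i j => ip (phi i) (e j)) Kk.
have [v0 vE] := phiE c c0; set v := \sum_i _ in v0 vE.
have Dv : D v by exact: (psd_mem_sum EP).
have := poinc v Dv; rewrite big1 ?mulr0 ?add0r; last first.
  by move=> j _; rewrite (psd_suml ipP) ?ce ?expr0n// => i; exact: DX.
move: v0 vE; move: (ip v v) (energy _ _ _ _) => w E w0 vE wE.
have := ler_wpM2l (ltW h0) vE.
have -> : h * ((x + (1 - x * h) / (2 * h)) * w) = (1 + x * h) / 2 * w.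
  by field; rewrite gt_eqF.
have : x * h * w < 1 * w by rewrite ltr_pM2r.
lra.
Qed.

(** * Bump functions *)

Section smooth_line.
Context {R : realType}.

Fixpoint diffk (k : nat) (f : R -> R) : Prop :=
  if k is k'.+1 then (forall t, derivable f t 1) /\ diffk k' (derive1 f) else True.

Definition smooth1 (f : R -> R) : Prop := forall k, diffk k f.

Lemma smooth1_derivable f t : smooth1 f -> derivable f t 1.
Proof. by move=> /(_ 1%N) []. Qed.

Lemma smooth1_derive f : smooth1 f -> smooth1 (derive1 f).
Proof. by move=> sf k; have [] := sf k.+1. Qed.

Lemma smooth1_continuous f : smooth1 f -> continuous f.
Proof.
move=> sf t; apply: differentiable_continuous; apply/derivable1_diffP.
exact: smooth1_derivable.
Qed.

Lemma diffk_le k f : diffk k.+1 f -> diffk k f.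
Proof. by elim: k f => [//|k ih] f [df /ih]; split. Qed.

Lemma diffkD k f g : diffk k f -> diffk k g -> diffk k (fun t => f t + g t).
Proof.
elim: k f g => [//|k ih] f g [df sf] [dg sg]; split.
  by move=> t; exact: derivableD.
rewrite (_ : derive1 _ = fun t => derive1 f t + derive1 g t); first exact: ih.
by apply/funext => t; rewrite !derive1E deriveD.
Qed.

Lemma diffkM k f g : diffk k f -> diffk k g -> diffk k (fun t => f t * g t).
Proof.
elim: k f g => [//|k ih] f g [df sf] [dg sg]; split.
  by move=> t; exact: derivableM.
rewrite (_ : derive1 _ = fun t => derive1 f t * g t + f t * derive1 g t).
  by apply: diffkD; apply: ih => //; exact: diffk_le.
apply/funext => t; rewrite !derive1E (deriveM (df t) (dg t)).
by rewrite /GRing.scale/= addrC mulrC.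
Qed.

Lemma is_derive_affine (f : R -> R) a b t : derivable f (a * t + b) 1 ->
  is_derive t 1 (fun s => f (a * s + b)) (a * derive1 f (a * t + b)).
Proof.
move=> df.
have h1 : is_derive t 1 (fun s : R => a * s + b) a.
  apply: is_derive_eq; by rewrite addr0 /GRing.scale/= mulr1.
have h2 : is_derive (a * t + b) 1 f (derive1 f (a * t + b)).
  by rewrite derive1E; apply: DeriveDef.
have := @is_derive1_comp R f (fun s => a * s + b) t _ _ h2 h1; rewrite /comp => h.
by apply: is_derive_eq; rewrite mulrC.
Qed.

Lemma diffk_affine k f a b : diffk k f -> diffk k (fun t => f (a * t + b)).
Proof.
elim: k f => [//|k ih] f [df sf]; split.
  by move=> t; apply: (@ex_derive _ _ _ _ _ _ _ (is_derive_affine (df _))).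
rewrite (_ : derive1 _ = fun t => (fun=> a) t * derive1 f (a * t + b)).
  apply: diffkM; last exact: ih.
  elim: k {ih sf} a => [//|k ih] a; split; first by move=> t; exact: derivable_cst.
  by rewrite (_ : derive1 _ = fun=> 0)//; apply/funext => t; rewrite derive1_cst.
apply/funext => t; rewrite derive1E.
exact: (@derive_val _ _ _ _ _ _ _ (is_derive_affine (df _))).
Qed.

(** The polynomial in [1 / t] is a parameter because the family is stable under differentiation:
    smoothness is then an induction over all [p] at once. *)
Definition flat_exp (p : {poly R}) (t : R) : R :=
  if 0 < t then p.[t^-1] * expR (- t^-1) else 0.

Lemma horner_bound (p : {poly R}) : exists C : R, 0 <= C /\
  forall s, 1 <= s -> `|p.[s]| <= C * s ^+ size p.
Proof.
exists (\sum_(i < size p) `|p`_i|); split; first exact: sumr_ge0.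
move=> s s1; rewrite horner_coef mulr_suml.
apply: le_trans (ler_norm_sum _ _ _) _; apply: ler_sum => i _.
rewrite normrM ler_wpM2l// ger0_norm ?exprn_ge0 ?(le_trans ler01)//.
by apply: ler_weXn2l => //; exact: ltnW.
Qed.

(** At [s = 1 / h] the exponential series gives [expR s >= s ^+ m / m!]. Taking [m] two above the
    size of [p] leaves a factor [h ^+ 2], so that the derivative at the origin is zero. *)
Lemma flat_exp_bound p : exists C : R, 0 <= C /\
  forall h, `|h| <= 1 -> `|flat_exp p h| <= C * h ^+ 2.
Proof.
have [C [C0 pC]] := horner_bound p.
pose m := (size p).+2.
exists (C * m`!%:R); split; first by rewrite mulr_ge0.
move=> h h1; rewrite /flat_exp; case: ifPn => [h0|_]; last first.
  by rewrite normr0 mulr_ge0 ?sqr_ge0// mulr_ge0.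
pose s := h^-1; rewrite -/s.
have s1 : 1 <= s by rewrite /s invf_ge1//; move: h1; rewrite ger0_norm// ltW.
have s0 : 0 < s by rewrite invr_gt0.
have m0 : 0 < m`!%:R :> R by rewrite ltr0n fact_gt0.
have es : s ^+ m / m`!%:R <= expR s.
  by apply: le_trans (expR_ge1Dxn (size p).+1 (ltW s0)); rewrite lerDr.
rewrite normrM (ger0_norm (expR_ge0 _)) expRN.
apply: (@le_trans _ _ (C * s ^+ size p * (m`!%:R / s ^+ m))).
  apply: ler_pM; [exact: normr_ge0|by rewrite -expRN expR_ge0|exact: pC|].
  rewrite -[leRHS]invrK lef_pV2 ?posrE ?expR_gt0//; last first.
    by rewrite invr_gt0 divr_gt0// exprn_gt0.
  by rewrite invf_div.
rewrite le_eqVlt; apply/orP; left; apply/eqP.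
have -> : h = s^-1 by rewrite invrK.
rewrite /m -[in s ^+ (size p).+2](addn2 (size p)) exprD.
by field; rewrite ?expf_neq0 ?gt_eqF.
Qed.

(** The derivative of [p(1/t) exp(-1/t)] is [t^-2 (p(1/t) - p'(1/t)) exp(-1/t)]. *)
Let derive_poly (p : {poly R}) : {poly R} := 'X^2 * (p - p^`()).

Lemma is_derive_flat_exp p (t : R) : is_derive t 1 (flat_exp p) (flat_exp (derive_poly p) t).
Proof.
have [t0|t0|->] := ltgtP t 0.
- have -> : flat_exp (derive_poly p) t = 0 by rewrite /flat_exp ltNge (ltW t0).
  apply: (near_eq_is_derive (f := cst 0)).
    near=> s; rewrite /flat_exp ltNge (_ : s <= 0)//; near: s.
    by apply: filterS (lt_nbhsl t0) => s /ltW.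
- have -> : flat_exp (derive_poly p) t = (derive_poly p).[t^-1] * expR (- t^-1).
    by rewrite /flat_exp t0.
  apply: (@near_eq_is_derive R R R (fun s : R => p.[s^-1] * expR (- s^-1)) _ t 1).
    near=> s; rewrite /flat_exp (_ : 0 < s)//; near: s.
    exact: lt_nbhsr.
  have dV : is_derive t 1 (fun s : R => s^-1) (- t ^- 2).
    have := @is_deriveV R id t 1 1 (lt0r_neq0 t0) (is_derive_id t 1).
    by rewrite /GRing.scale/= mulr1.
  have dp := @is_derive1_comp R (horner p) (fun s => s^-1) t _ _ (is_derive_poly p t^-1) dV.
  have dN : is_derive t 1 (fun s : R => - s^-1) (t ^- 2).
    by apply: is_derive_eq; rewrite opprK.
  have de := @is_derive1_comp R expR (fun s => - s^-1) t _ _ (is_derive_expR (- t^-1)) dN.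
  have dpe := is_deriveM dp de.
  apply: is_derive_eq.
  rewrite /GRing.scale/= /derive_poly hornerM hornerXn hornerD hornerN exprVn.
  by ring.
- have -> : flat_exp (derive_poly p) 0 = 0 by rewrite /flat_exp ltxx.
  have [C [C0 hC]] := flat_exp_bound p.
  have lim0 : (fun h : R => h^-1 *: (flat_exp p (h *: 1 + 0) - flat_exp p 0)) @ 0^' --> (0 : R).
    apply/cvgr0Pnorm_le => e e0.
    have C1 : 0 < C + 1 by lra.
    have d0 : 0 < Num.min 1 (e / (C + 1)) by rewrite lt_min ltr01 divr_gt0.
    rewrite near_withinE; apply/nbhs_ballP; exists (Num.min 1 (e / (C + 1))) => //= h.
    rewrite /ball/= sub0r normrN lt_min => /andP[h1 h2] hn0.
    rewrite [flat_exp p 0]/flat_exp ltxx subr0 addr0 /GRing.scale/= mulr1 normrM normfV.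
    have := hC h (ltW h1); rewrite -(real_normK (num_real h)) => h3.
    have hp : 0 < `|h| by rewrite normr_gt0.
    rewrite mulrC ler_pdivrMr//; apply: (le_trans h3).
    rewrite expr2 mulrA ler_wpM2r//.
    move: h2; rewrite ltr_pdivlMr// => h2.
    by have := normr_ge0 h; nra.
  have E : (fun h : R => h^-1 *: ((flat_exp p \o shift 0) (h *: 1) - flat_exp p 0)) @ 0^' --> (0 : R).
    exact: lim0.
  by apply: DeriveDef; [exact: (cvgP _ E)|exact: (cvg_lim _ E)].
Unshelve. all: by end_near.
Qed.

Lemma smooth1_flat_exp p : smooth1 (flat_exp p).
Proof.
move=> k; elim: k p => [//|k ih] p; split.
  by move=> t; have := is_derive_flat_exp p t; case.
rewrite (_ : derive1 _ = flat_exp (derive_poly p)); first exact: ih.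
by apply/funext => t; rewrite derive1E; have := is_derive_flat_exp p t; case.
Qed.

Definition bump (t : R) : R := flat_exp 1 t * flat_exp 1 (1 - t).

Lemma smooth1_bump : smooth1 bump.
Proof.
move=> k; apply: diffkM; first exact: smooth1_flat_exp.
rewrite (_ : (fun t => _) = fun t => flat_exp 1 (-1 * t + 1)).
  by apply: diffk_affine; exact: smooth1_flat_exp.
by apply/funext => t; rewrite mulN1r addrC.
Qed.

Lemma bump_out t : ~ (0 < t < 1) -> bump t = 0.
Proof.
move=> /negP; rewrite /bump /flat_exp subr_gt0 negb_and => /orP[] /negbTE ->.
  by rewrite mul0r.
by rewrite mulr0.
Qed.

(** Both [t] and [1 - t] are at least [1 / 4], so each factor is at least [expR (- 4)]. *)
Lemma bump_middle t : 4^-1 <= t <= 3 / 4 -> expR (- 4) ^+ 2 <= bump t.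
Proof.
move=> /andP[t1 t2]; have t0 : 0 < t by lra.
have t0' : 0 < 1 - t by lra.
rewrite /bump /flat_exp t0 t0' !hornerC !mul1r expr2.
by apply: ler_pM; rewrite ?expR_ge0// ler_expR lerN2 -[leRHS]invrK lef_pV2 ?posrE//; lra.
Qed.

End smooth_line.

(** * Product bump functions and their energy *)

Section product_functions.
Context {R : realType}.

Definition prodf n (b : 'I_n -> R -> R) (x : 'rV[R]_n) : R := \prod_j b j (x ord0 j).

Lemma differentiable_prodf n (b : 'I_n -> R -> R) x :
  (forall j t, derivable (b j) t 1) -> differentiable (prodf b) x.
Proof.
move=> db; rewrite /prodf.
have db' j : differentiable (fun y : 'rV[R]_n => b j (y ord0 j)) x.
  apply: (@differentiable_comp _ _ _ _ (fun y : 'rV[R]_n => y ord0 j) (b j)).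
    exact: differentiable_coord.
  by apply/derivable1_diffP; exact: db.
elim: (index_enum _) => [|j r ih].
  rewrite (_ : (fun y => _) = cst 1); first exact: differentiable_cst.
  by apply/funext => y; rewrite big_nil.
rewrite (_ : (fun y => _) =
  (fun y : 'rV[R]_n => b j (y ord0 j)) * (fun y => \prod_(k <- r) b k (y ord0 k))).
  exact: differentiableM.
by apply/funext => y; rewrite big_cons.
Qed.

Lemma pderiv_prodf n (b : 'I_n -> R -> R) i : (forall j t, derivable (b j) t 1) ->
  pderiv i (prodf b) = prodf (fun j => if j == i then derive1 (b j) else b j).
Proof.
move=> db; apply/funext => x.
pose P := \prod_(j | j != i) b j (x ord0 j).
have line h : prodf b (h *: delta_mx ord0 i + x) =
    (fun t => b i t * P) (h + x ord0 i).
  rewrite /prodf (bigD1 i)//= !mxE !eqxx mulr1; congr (_ * _).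
  by apply: eq_bigr => j ji; rewrite !mxE eqxx (negbTE ji) mulr0 add0r.
transitivity (derive1 (fun t => b i t * P) (x ord0 i)).
  exact: (derive_line line).1.
rewrite /prodf (bigD1 i)//= eqxx derive1Mr//.
by congr (_ * _); apply: eq_bigr => j /negbTE ->.
Qed.

Lemma smooth_prodf n (b : 'I_n -> R -> R) : (forall j, smooth1 (b j)) ->
  smooth_on setT (prodf b).
Proof.
move=> sb; apply: (@smooth_on_coind _ _ _ [set f | exists b : 'I_n -> R -> R,
  (forall j, smooth1 (b j)) /\ f = prodf b]); last by exists b.
  move=> _ [c [sc ->]] x; apply: differentiable_prodf => j t.
  exact: smooth1_derivable.
move=> _ [c [sc ->]] i.
exists (fun j => if j == i then derive1 (c j) else c j); split.
  by move=> j; case: ifP => _ //; exact: smooth1_derive.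
by rewrite -[LHS]/(pderiv i (prodf c)) pderiv_prodf// => j t; exact: smooth1_derivable.
Qed.

Lemma prodf_cons n (b : 'I_n.+1 -> R -> R) y t :
  prodf b (rV_cons (y, t)) = b ord0 t * prodf (b \o lift ord0) y.
Proof.
rewrite /prodf big_ord_recl rV_cons0/=; congr (_ * _).
by apply: eq_bigr => j _; rewrite rV_consS.
Qed.

Lemma bsupp_prodf n (b : 'I_n -> R -> R) B : (forall j, continuous (b j)) ->
  (forall j t, B < `|t| -> b j t = 0) -> bsupp (prodf b).
Proof.
move=> cb b0; apply: bsupp_continuous; last first.
  by exists B => x [i xi]; rewrite /prodf (bigD1 i)//= b0// mul0r.
rewrite /prodf; elim: (index_enum _) => [|j r ih].
  rewrite (_ : (fun y => _) = cst 1); first exact: cst_continuous.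
  by apply/funext => y; rewrite big_nil.
rewrite (_ : (fun y => _) =
  (fun y : 'rV[R]_n => b j (y ord0 j) * (\prod_(k <- r) b k (y ord0 k)))); last first.
  by apply/funext => y; rewrite big_cons.
move=> x; apply: (cvgM _ (ih x)).
apply: (@continuous_comp _ _ _ (fun y : 'rV[R]_n => y ord0 j) (b j)); last exact: cb.
exact: coord_continuous.
Qed.

Lemma integral_prodf n (b : 'I_n -> R -> R) B : (forall j, continuous (b j)) ->
  (forall j t, B < `|t| -> b j t = 0) -> integral_rV (prodf b) = \prod_j integral_R (b j).
Proof.
elim: n b => [|n ih] b cb b0; first by rewrite integral_rV0 /prodf !big_ord0.
have bS := bsupp_prodf cb b0.
rewrite (integral_rV_slice bS) big_ord_recl.
have cb' j : continuous ((b \o lift ord0) j) by exact: cb.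
have b0' j t : B < `|t| -> (b \o lift ord0) j t = 0 by exact: b0.
rewrite -(ih _ cb' b0') mulrC.
rewrite -integral_RZ; last exact: bsupp1_continuous (cb ord0) (b0 ord0).
congr integral_R; apply/funext => t; rewrite mulrC -integral_rVZ.
  by congr integral_rV; apply/funext => y; rewrite prodf_cons.
exact: bsupp_prodf cb' b0'.
Qed.

Lemma derive_bump_out (t : R) : ~ (0 < t < 1) -> derive1 bump t = 0.
Proof.
move=> t01; rewrite derive1E.
have d1 := is_derive_flat_exp (1 : {poly R}) t.
have d2 : is_derive t 1 (fun s : R => flat_exp 1 (-1 * s + 1)) (-1 * derive1 (flat_exp 1) (-1 * t + 1)).
  by apply: is_derive_affine; apply: smooth1_derivable; exact: smooth1_flat_exp.
have -> : bump = (flat_exp 1 : R -> R) * (fun s : R => flat_exp 1 (-1 * s + 1)).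
  by apply/funext => s; rewrite -[RHS]/(flat_exp 1 s * flat_exp 1 (-1 * s + 1)) mulN1r [- s + 1]addrC.
have d3 := is_deriveM d1 d2.
rewrite (@derive_val _ _ _ _ _ _ _ d3) derive1E.
have d4 := is_derive_flat_exp (1 : {poly R}) (-1 * t + 1).
rewrite (@derive_val _ _ _ _ _ _ _ d4) (_ : -1 * t + 1 = 1 - t); last by ring.
rewrite /flat_exp !subr_gt0 /GRing.scale/=.
move/negP : t01; rewrite negb_and => /orP[] /negbTE ->.
  by rewrite mul0r mulr0 addr0.
by rewrite mul0r !mulr0 addr0.
Qed.

Lemma derive_bump_bounded : exists2 L : R, 0 < L & forall t, `|derive1 bump t| <= L.
Proof.
have [|C CP] := @bsupp1_bounded R (derive1 bump).
  apply: (@bsupp1_continuous _ _ 1).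
    by apply: smooth1_continuous; apply: smooth1_derive; exact: smooth1_bump.
  move=> t t1; apply: derive_bump_out => /andP[t0 t1'].
  by move: t1; rewrite ger0_norm ?(ltW t0)// ltNge (ltW t1').
exists (`|C| + 1); first by rewrite ltr_wpDl.
by move=> t; apply: le_trans (CP t) _; have := ler_norm C; lra.
Qed.

Section scaled_bump.
Variables (c h : R).
Hypothesis h0 : 0 < h.

Definition scaled_bump (t : R) : R := bump (h^-1 * t + - (h^-1 * c)).

Let argE t : h^-1 * t + - (h^-1 * c) = (t - c) / h.
Proof. by rewrite mulrC mulrDl mulNr [c / h]mulrC. Qed.

Lemma smooth1_scaled_bump : smooth1 scaled_bump.
Proof. by move=> k; apply: diffk_affine; exact: smooth1_bump. Qed.

Lemma scaled_bump_out t : ~ (c < t < c + h) -> scaled_bump t = 0.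
Proof.
move=> tc; apply: bump_out; rewrite argE => /andP[t0 t1]; apply: tc.
move: t0 t1; rewrite ltr_pdivrMr// ltr_pdivlMr// mul0r mul1r => t0 t1.
by apply/andP; split; lra.
Qed.

Lemma derive_scaled_bump t : derive1 scaled_bump t = h^-1 * derive1 bump ((t - c) / h).
Proof.
rewrite derive1E -argE.
have db : derivable bump (h^-1 * t + - (h^-1 * c)) 1.
  by apply: smooth1_derivable; exact: smooth1_bump.
exact: (@derive_val _ _ _ _ _ _ _ (is_derive_affine db)).
Qed.

Lemma derive_scaled_bump_out t : ~ (c < t < c + h) -> derive1 scaled_bump t = 0.
Proof.
move=> tc; rewrite derive_scaled_bump derive_bump_out ?mulr0// => /andP[t0 t1]; apply: tc.
move: t0 t1; rewrite ltr_pdivrMr// ltr_pdivlMr// mul0r mul1r => t0 t1.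
by apply/andP; split; lra.
Qed.

Lemma bsupp1_vanish (f : R -> R) : continuous f -> (forall t, ~ (c < t < c + h) -> f t = 0) ->
  bsupp1 f.
Proof.
move=> cf f0; apply: (@bsupp1_continuous _ _ (`|c| + h)) => // t tB.
apply: f0 => /andP[t1 t2]; move: tB; rewrite ltNge ler_norml => /negP; apply.
have := ler_norm c; have := ler_norm (- c); rewrite normrN => *.
by apply/andP; split; lra.
Qed.

(** Only the middle half of the interval, of length [h / 2], is kept; there the bump is at least
    [expR (- 4) ^+ 2]. *)
Lemma integral_scaled_bump_ge :
  expR (- 4) ^+ 4 * (h / 2) <= integral_R (fun t => scaled_bump t ^+ 2).
Proof.
have h2 : 0 <= h / 2 by rewrite divr_ge0// ltW.
have bS : bsupp1 scaled_bump.
  by apply: bsupp1_vanish => //; [exact/smooth1_continuous/smooth1_scaled_bump|exact: scaled_bump_out].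
rewrite -(integral_R_indic_co (c + h / 4) h2) -integral_RZ; last exact: bsupp1_co.
apply: le_integral_R; [by apply: bsupp1Z; exact: bsupp1_co|exact: (bsupp1MM bS bS)|].
move=> t; rewrite indicE; case: (boolP (t \in _)) => tI; last by rewrite mulr0 sqr_ge0.
move: tI; rewrite inE/= in_itv/= mulr1 => /andP[t1 t2].
rewrite -[4%N]/(2 * 2)%N exprM ler_pXn2r ?nnegrE ?sqr_ge0//.
  rewrite /scaled_bump; apply: bump_middle; rewrite argE ler_pdivlMr// ler_pdivrMr//.
  by apply/andP; split; lra.
by rewrite /scaled_bump/bump /flat_exp; case: ifP => _; case: ifP => _;
  rewrite ?mul0r ?mulr0// !hornerC !mul1r mulr_ge0// expR_ge0.
Qed.

Lemma integral_derive_scaled_bump_le L : (forall t, `|derive1 bump t| <= L) ->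
  integral_R (fun t => derive1 scaled_bump t ^+ 2) <= (L / h) ^+ 2 * h.
Proof.
move=> bL.
have bS : bsupp1 (derive1 scaled_bump).
  apply: bsupp1_vanish; last exact: derive_scaled_bump_out.
  exact/smooth1_continuous/smooth1_derive/smooth1_scaled_bump.
rewrite -[X in _ * X](integral_R_indic_co c (ltW h0)) -integral_RZ; last exact: bsupp1_co.
apply: le_integral_R; [exact: (bsupp1MM bS bS)|by apply: bsupp1Z; exact: bsupp1_co|].
move=> t; rewrite indicE; case: (boolP (t \in _)) => tI.
  rewrite mulr1 derive_scaled_bump !exprMn [X in _ <= X]mulrC ler_wpM2l ?sqr_ge0//.
  have := bL ((t - c) / h); move: (derive1 _ _ : R) => w.
  rewrite ler_norml => /andP[w1 w2].
  have e1 : 0 <= L - w by lra.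
  have e2 : 0 <= L + w by lra.
  by have := mulr_ge0 e1 e2; lra.
rewrite mulr0 derive_scaled_bump_out ?expr0n// => /andP[t1 t2].
by move: tI; rewrite notin_setE/= in_itv/= (ltW t1) t2.
Qed.

End scaled_bump.
End product_functions.

Section bump_family.
Context {R : realType} {n : nat}.
Variables (L : R) (L0 : 0 < L) (bL : forall t : R, `|derive1 bump t| <= L).

Let beta : R := expR (- 4) ^+ 4.
Let beta0 : 0 < beta. Proof. by rewrite exprn_gt0// expR_gt0. Qed.

(* An upper bound for [\int b'^2 / \int b^2], [b] the bump on the unit interval. *)
Let rho : R := 2 * L ^+ 2 / beta.

Definition cell_bump (c : 'I_n -> R) (h : R) : 'rV[R]_n -> R :=
  prodf (fun j => scaled_bump (c j) h).

Section one.
Variables (c : 'I_n -> R) (h : R) (h0 : 0 < h).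

Let b j := scaled_bump (c j) h.
Let sb j : smooth1 (b j). Proof. exact: smooth1_scaled_bump. Qed.
Let db j t : derivable (b j) t 1. Proof. exact: smooth1_derivable. Qed.

Let B := \sum_j `|c j| + h.

Let big j (f : R -> R) : (forall t, ~ (c j < t < c j + h) -> f t = 0) ->
  forall t, B < `|t| -> f t = 0.
Proof.
move=> f0 t tB; apply: f0 => /andP[t1 t2]; move: tB.
rewrite ltNge ler_norml => /negP; apply.
have cj : `|c j| <= \sum_j `|c j| by rewrite (bigD1 j)//= lerDl sumr_ge0.
have := ler_norm (c j); have := ler_norm (- c j); rewrite normrN /B => *.
by apply/andP; split; lra.
Qed.

Lemma cell_bump_out (x : 'rV[R]_n) : (exists j, ~ (c j < x ord0 j < c j + h)) -> cell_bump c h x = 0.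
Proof.
by move=> [j xj]; rewrite /cell_bump /prodf (bigD1 j)//= scaled_bump_out// mul0r.
Qed.

Let b2 i j t := (if j == i then derive1 (b j) t else b j t) ^+ 2.

Let b2_out i j t : ~ (c j < t < c j + h) -> b2 i j t = 0.
Proof.
move=> tj; rewrite /b2; case: ifP => _.
  by rewrite (derive_scaled_bump_out h0 tj) expr0n.
by rewrite /b (scaled_bump_out h0 tj) expr0n.
Qed.

Let b2_cont i j : continuous (b2 i j).
Proof.
rewrite /b2; case: (j == i) => t; rewrite /continuous_at.
  have cd := smooth1_continuous (smooth1_derive (sb j)).
  rewrite (_ : (fun t => _) = (fun t => derive1 (b j) t * derive1 (b j) t)).
    by rewrite expr2; exact: (cvgM (cd t) (cd t)).
  by apply/funext => s; rewrite expr2.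
have cd := smooth1_continuous (sb j).
rewrite (_ : (fun t => _) = (fun t => b j t * b j t)).
  by rewrite expr2; exact: (cvgM (cd t) (cd t)).
by apply/funext => s; rewrite expr2.
Qed.

Lemma pderiv_cell_bump i (x : 'rV[R]_n) : pderiv i (cell_bump c h) x =
  \prod_j (if j == i then derive1 (b j) (x ord0 j) else b j (x ord0 j)).
Proof.
rewrite (pderiv_prodf i db) /prodf; apply: eq_bigr => j _.
by case: ifP.
Qed.

Lemma pderiv_cell_bump_out i (x : 'rV[R]_n) : (exists j, ~ (c j < x ord0 j < c j + h)) ->
  pderiv i (cell_bump c h) x = 0.
Proof.
move=> [j xj]; rewrite pderiv_cell_bump (bigD1 j)//=; case: ifP => _.
  by rewrite /b (derive_scaled_bump_out h0 xj) mul0r.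
by rewrite /b (scaled_bump_out h0 xj) mul0r.
Qed.

Let N j := integral_R (fun t => b j t ^+ 2).
Let N_ge j : beta * (h / 2) <= N j.
Proof. exact: integral_scaled_bump_ge. Qed.
Let N_gt0 j : 0 < N j.
Proof. by apply: lt_le_trans (N_ge j); rewrite mulr_gt0// divr_gt0. Qed.

Let cont2 j : continuous (fun t => b j t ^+ 2).
Proof.
have cd := smooth1_continuous (sb j); move=> t.
rewrite /continuous_at (_ : (fun t => _) = (fun t => b j t * b j t)).
  by rewrite expr2; exact: (cvgM (cd t) (cd t)).
by apply/funext => s; rewrite expr2.
Qed.

Lemma integral_cell_bump_sqr : integral_rV (fun x => cell_bump c h x ^+ 2) = \prod_j N j.
Proof.
rewrite (_ : (fun x => _) = prodf (fun j t => b j t ^+ 2)); last first.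
  by apply/funext => x; rewrite /cell_bump /prodf -prodrXl.
apply: (@integral_prodf R n _ B) => [j|j]; first exact: cont2.
by apply: (@big j) => t tj; rewrite /b (scaled_bump_out h0 tj) expr0n.
Qed.

Lemma integral_cell_bump_sqr_gt0 : 0 < integral_rV (fun x => cell_bump c h x ^+ 2).
Proof. by rewrite integral_cell_bump_sqr; apply: prodr_gt0. Qed.

(** Both integrals factor over the coordinates and differ only in the factor [i], where the
    one-dimensional bounds give the ratio [rho / h ^+ 2]. *)
Lemma integral_pderiv_cell_bump_sqr i :
  integral_rV (fun x => pderiv i (cell_bump c h) x ^+ 2) <=
  rho / h ^+ 2 * integral_rV (fun x => cell_bump c h x ^+ 2).
Proof.
rewrite integral_cell_bump_sqr.
rewrite (_ : (fun x => _) = prodf (b2 i)); last first.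
  by apply/funext => x; rewrite pderiv_cell_bump /prodf -prodrXl.
rewrite (@integral_prodf R n _ B) => [|j|j]; last by apply: (@big j) => t; exact: b2_out.
  rewrite (bigD1 i)//= [in leRHS](bigD1 i)//= mulrA.
  have -> : \prod_(j | j != i) integral_R (b2 i j) = \prod_(j | j != i) N j.
    apply: eq_bigr => j /negbTE ji; congr integral_R; apply/funext => t.
    by rewrite /b2 ji.
  apply: ler_wpM2r; first by apply: prodr_ge0 => j _; exact: ltW.
  have -> : b2 i i = fun t => derive1 (b i) t ^+ 2.
    by apply/funext => t; rewrite /b2 eqxx.
  apply: (le_trans (integral_derive_scaled_bump_le (c i) h0 bL)).
  have -> : (L / h) ^+ 2 * h = rho / h ^+ 2 * (beta * (h / 2)).
    by rewrite /rho; field; rewrite !gt_eqF.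
  apply: ler_wpM2l => //; rewrite divr_ge0 ?sqr_ge0// /rho divr_ge0 ?(ltW beta0)//.
  by rewrite mulr_ge0 ?sqr_ge0.
exact: b2_cont.
Qed.

Lemma test_cell_bump (Omega : set 'rV[R]_n) :
  (forall x : 'rV[R]_n, (forall j, c j <= x ord0 j <= c j + h) -> interior Omega x) ->
  test_function Omega (cell_bump c h).
Proof.
move=> cO; split; first exact: smooth_prodf.
apply: (@subset_trans _ [set x : 'rV[R]_n | forall j, c j <= x ord0 j <= c j + h]); last first.
  by move=> x /cO.
have cl : closed [set x : 'rV[R]_n | forall j, c j <= x ord0 j <= c j + h].
  rewrite (_ : [set x | _] = \bigcap_(j in [set: 'I_n])
    ((fun x : 'rV[R]_n => x ord0 j) @^-1` `[c j, c j + h]%classic)).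
    apply: closed_bigI => j _; apply: closed_comp; last exact: itv_closed.
    by move=> x _; exact: coord_continuous.
  apply/seteqP; split => [x xc j _|x xc j] /=; first by rewrite in_itv/= xc.
  by have := xc j I; rewrite /= in_itv.
rewrite [X in _ `<=` X](closure_id _).1//; apply: closure_subset => x /= bx j.
apply: contrapT => xj; move: bx; rewrite cell_bump_out ?eqxx//.
by exists j => /andP[x1 x2]; apply: xj; rewrite !ltW.
Qed.

End one.

Variables (Omega : set 'rV[R]_n) (a : 'I_n -> R) (s : R) (m : nat).
Hypotheses (cOmega : compact Omega) (s0 : 0 < s) (m0 : (0 < m)%N).
Hypothesis cubeO : forall x : 'rV[R]_n,
  (forall j, a j <= x ord0 j <= a j + s) -> interior Omega x.

Local Notation X := (L2 Omega).
Local Notation D := (test_function Omega).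
Local Notation ip := (L2_inner Omega).
Local Notation A := (fun f : 'rV[R]_n -> R => \- laplacian f).

Let h : R := s / m%:R.
Let h0 : 0 < h. Proof. by rewrite divr_gt0// ltr0n. Qed.

Let corner (k : {ffun 'I_n -> 'I_m}) (j : 'I_n) : R := a j + (k j)%:R * h.

Let corner_disjoint k l : k != l -> forall x : 'rV[R]_n,
  (exists j, ~ (corner k j < x ord0 j < corner k j + h)) \/
  (exists j, ~ (corner l j < x ord0 j < corner l j + h)).
Proof.
move=> kl x; have [j kj] : exists j, k j != l j.
  apply/existsP; apply: contraNT kl; rewrite negb_exists => /forallP h1.
  by apply/eqP/ffunP => j; apply/eqP; have := h1 j; rewrite negbK.
wlog lt : k l kl kj / (k j < l j)%N.
  move=> H; move: (kj); rewrite neq_ltn => /orP[kl'|lk']; first exact: H.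
  by have [] := H l k _ _ lk'; rewrite 1?eq_sym//; [right|left].
have [hk|hk] := pselect (corner k j < x ord0 j < corner k j + h); last by left; exists j.
right; exists j => /andP[x1 _]; move: hk => /andP[_ x2].
have : (k j).+1%:R * h <= (l j)%:R * h by rewrite ler_pM2r// ler_nat.
by rewrite -natr1 mulrDl mul1r; move: x1 x2; rewrite /corner; lra.
Qed.

Let phi k := cell_bump (corner k) h.

Let tphi k : D (phi k).
Proof.
apply: test_cell_bump => // x xk; apply: cubeO => j.
have /andP[x1 x2] := xk j.
have k1 : 0 <= (k j)%:R * h by rewrite mulr_ge0// ltW.
have k2 : (k j).+1%:R * h <= s.
  rewrite /h mulrCA ger_pMr// ler_pdivrMr ?ltr0n// mul1r ler_nat.
  exact: ltn_ord.
move: k2 x1 x2; rewrite -natr1 mulrDl mul1r /corner => *.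
by apply/andP; split; lra.
Qed.

(** Each of the [m ^ n] cells of side [s / m] carries one bump. Different bumps have disjoint
    supports, so norm and energy are both diagonal, and the bound [n * rho / h ^+ 2] for the
    Rayleigh quotient of one bump holds for every combination. *)
Lemma cell_bump_family :
  energy_bounded_dim D ip A (n%:R * rho * (m%:R / s) ^+ 2) (m ^ n).
Proof.
have <- : #|{: {ffun 'I_n -> 'I_m}}| = (m ^ n)%N by rewrite card_ffun !card_ord.
move=> d d0; exists (fun i => phi (enum_val i)) => // c [i0 ci0] v.
have XP := L2_psd_form cOmega; have EP := test_energy_psd_form cOmega.
have Xphi k : X (phi k) by exact: test_L2.
have ipE k l : ip (phi k) (phi l) = (k == l)%:R * integral_rV (fun x => phi k x ^+ 2).
  rewrite (L2_inner_out (f := phi k)); last by move=> x xO; rewrite (test_out (tphi k) xO) mul0r.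
  have [<-|kl] := eqVneq k l; first by rewrite mul1r.
  rewrite mul0r; apply: integral_rV_eq0 => x.
  have [xk|xl] := corner_disjoint kl x.
    by rewrite {1}/phi cell_bump_out// mul0r.
  by rewrite [X in _ * X]cell_bump_out// mulr0.
have EE k l : k != l -> energy ip A (phi k) (phi l) = 0.
  move=> kl; rewrite (test_energyE cOmega)//; apply: big1 => i _.
  apply: integral_rV_eq0 => x; have [xk|xl] := corner_disjoint kl x.
    by rewrite {1}/phi pderiv_cell_bump_out// mul0r.
  by rewrite [X in _ * X]pderiv_cell_bump_out// mulr0.
pose I2 k := integral_rV (fun x => phi k x ^+ 2).
have I20 k : 0 < I2 k by exact: integral_cell_bump_sqr_gt0.
have Ek k : energy ip A (phi k) (phi k) <= n%:R * rho * (m%:R / s) ^+ 2 * I2 k.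
  rewrite (test_energy_sqr cOmega)//.
  have -> : n%:R * rho * (m%:R / s) ^+ 2 * I2 k = \sum_(i < n) (rho / h ^+ 2 * I2 k).
    rewrite sumr_const card_ord -mulr_natl /h; field.
    by rewrite !gt_eqF// ltr0n.
  by apply: ler_sum => i _; exact: integral_pderiv_cell_bump_sqr.
have vv : ip v v = \sum_i c i ^+ 2 * I2 (enum_val i).
  rewrite (psd_sum2 XP)//; apply: eq_bigr => i _; rewrite (bigD1 i)//= ipE eqxx mul1r.
  rewrite -expr2 big1 ?addr0// => j ji.
  by rewrite ipE (inj_eq enum_val_inj) eq_sym (negbTE ji) mul0r mulr0.
have vE : energy ip A v v = \sum_i c i ^+ 2 * energy ip A (phi (enum_val i)) (phi (enum_val i)).
  rewrite (psd_sum2 EP)//; apply: eq_bigr => i _; rewrite (bigD1 i)//=.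
  rewrite -expr2 big1 ?addr0// => j ji.
  by rewrite EE ?mulr0// (inj_eq enum_val_inj) eq_sym.
have v0 : 0 < ip v v.
  rewrite vv (bigD1 i0)//= ltr_pwDl//; first by rewrite mulr_gt0// exprn_even_gt0.
  by apply: sumr_ge0 => i _; rewrite mulr_ge0 ?sqr_ge0// ltW.
split => //; rewrite mulrDl; apply: (@le_trans _ _ (n%:R * rho * (m%:R / s) ^+ 2 * ip v v)).
  rewrite vE vv mulr_sumr; apply: ler_sum => i _.
  by rewrite mulrCA ler_wpM2l ?sqr_ge0.
by rewrite lerDl mulr_ge0 ?ltW.
Qed.

End bump_family.

(** * Boxes *)

Lemma klipschitz_mono (R : realType) (V : normedModType R) (f : V -> R) (k K : R) :
  k <= K -> k.-lipschitz f -> K.-lipschitz f.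
Proof.
move=> kK kf xy xyT; apply: le_trans (kf xy xyT) _.
by rewrite ler_wpM2r.
Qed.

Lemma klipschitz_min (R : realType) (V : normedModType R) (f g : V -> R) (K : R) :
  K.-lipschitz f -> K.-lipschitz g -> K.-lipschitz (fun x => Num.min (f x) (g x)).
Proof.
move=> kf kg [x y] xyT /=; have /= := kf (x, y) xyT; have /= := kg (x, y) xyT.
rewrite !ler_norml => /andP[a1 a2] /andP[b1 b2]; rewrite /Num.min.
by apply/andP; split; case: ltP => ?; case: ltP => ?; lra.
Qed.

(** A minimum of Lipschitz functions turns a finite system of upper bounds into a single one; this
    provides the graph function at corners of a box. *)
Lemma klipschitz_system (R : realType) (V : normedModType R) (I : eqType) (r : seq I)
    (f : I -> V -> R) (K : R) : r != [::] -> (forall i, K.-lipschitz (f i)) ->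
  exists2 g : V -> R, K.-lipschitz g &
    forall y s, (s <= g y) = all (fun i => s <= f i y) r.
Proof.
move=> + kf; elim: r => [//|i [|j r] ih] _.
  by exists (f i) => // y s /=; rewrite andbT.
have [//|g kg gP] := ih; exists (fun y => Num.min (f i y) (g y)).
  exact: klipschitz_min.
by move=> y s; rewrite le_min gP.
Qed.

Section affine_maps.
Context {R : realType} {m n : nat}.
Implicit Types (M : 'M[R]_(m, n)) (c : 'rV[R]_n).

Lemma differentiable_affine_rV M c (t : 'rV[R]_m) :
  differentiable (fun t : 'rV[R]_m => t *m M + c) t.
Proof.
rewrite (_ : (fun _ => _) =
  (\sum_(i < m) (fun t : 'rV[R]_m => t ord0 i *: row i M)) + cst c); last first.
  by apply/funext => u; rewrite mulmx_sum_row -[RHS]/((\sum_(i < m) _) u + c) fct_sumE.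
apply: differentiableD; last exact: differentiable_cst.
apply: differentiable_sum => i; apply: (@differentiableZl R 'rV[R]_m _ (fun t : 'rV[R]_m => t ord0 i)).
exact: differentiable_coord.
Qed.

Lemma derive_affine_rV M c (t v : 'rV[R]_m) :
  'D_v (fun t : 'rV[R]_m => t *m M + c) t = v *m M.
Proof.
rewrite /derive; apply: lim_near_cst => //; near=> h.
rewrite /= mulmxDl -[_ + _ + c]addrA addrK -scalemxAl scalerA mulVf ?scale1r//.
by near: h; exact: nbhs_dnbhs_neq.
Unshelve. all: by end_near.
Qed.

Lemma smooth_affine_rV M c : smooth_on setT (fun t : 'rV[R]_m => t *m M + c).
Proof.
apply: (@smooth_on_coind _ _ _ [set f | exists M c, f = fun t : 'rV[R]_m => t *m M + c]).
- by move=> _ [N [b ->]] x; exact: differentiable_affine_rV.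
- move=> _ [N [b ->]] i; exists 0, (delta_mx ord0 i *m N); apply/funext => x.
  by rewrite derive_affine_rV mulmx0 add0r.
- by exists M, c.
Qed.

Lemma diff_affine_rV M c (t v : 'rV[R]_m) :
  'd (fun t : 'rV[R]_m => t *m M + c) t v = v *m M.
Proof. by rewrite -deriveE ?derive_affine_rV//; exact: differentiable_affine_rV. Qed.

Lemma smooth_cell_affine M c : (forall v : 'rV[R]_m, v *m M = 0 -> v = 0) ->
  smooth_cell (fun t : 'rV[R]_m => t *m M + c).
Proof.
move=> Minj; split.
- by exists setT; split; [exact: openT|by []|exact: smooth_affine_rV].
- move=> x y _ _ /addIr /eqP; rewrite -subr_eq0 -mulmxBl => /eqP/Minj/eqP.
  by rewrite subr_eq0 => /eqP.
- move=> t _ v w; rewrite !diff_affine_rV => /eqP; rewrite -subr_eq0 -mulmxBl.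
  by move=> /eqP/Minj/eqP; rewrite subr_eq0 => /eqP.
Qed.

End affine_maps.

Section box.
Context {R : realType}.
Variables (n : nat) (s : 'I_n.+1 -> R).
Hypothesis s0 : forall i, 0 < s i.

Definition cbox : set 'rV[R]_n.+1 := [set x | forall i, 0 <= x ord0 i <= s i].

Lemma compact_cbox : compact cbox.
Proof.
rewrite (_ : cbox = [set v : 'rV[R]_n.+1 | forall j, `[0, s j]%classic (v ord0 j)]).
  by apply: (@rV_compact _ _ (fun j => `[0, s j]%classic)) => j; exact: segment_compact.
by apply/seteqP; split => x h i; have := h i; rewrite /= in_itv/=.
Qed.

Lemma closed_cbox : closed cbox.
Proof. by apply: compact_closed; [exact: norm_hausdorff|exact: compact_cbox]. Qed.

Lemma near_coord (p : 'rV[R]_n.+1) (P : 'I_n.+1 -> R -> Prop) :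
  (forall i, \forall t \near p ord0 i, P i t) ->
  nbhs p (fun x : 'rV[R]_n.+1 => forall i, P i (x ord0 i)).
Proof.
move=> Pp; apply: (@filter_forall _ _ (fun i (x : 'rV[R]_n.+1) => P i (x ord0 i)) (nbhs p)) => i.
exact: (@coord_continuous _ _ _ ord0 i p _ (Pp i)).
Qed.

Lemma interior_cbox : interior cbox = [set x | forall i, 0 < x ord0 i < s i].
Proof.
apply/seteqP; split => [x xO i|x xO].
  have /nbhs_ballP[e /= e0 eB] := xO.
  have e2 : 0 < e / 2 by rewrite divr_gt0.
  have shift_in (d : R) : `|d| = e / 2 -> 0 <= x ord0 i + d <= s i.
    move=> dE; have := eB (x + d *: delta_mx ord0 i); rewrite /= => /(_ _ i).
    rewrite !mxE !eqxx mulr1; apply; apply/rV_ballP => // j.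
    rewrite !mxE eqxx opprD addrA subrr sub0r normrN normrM dE /=.
    case: eqP => _; rewrite ?normr1 ?normr0; lra.
  have /andP[_ x1] := shift_in (e / 2) (gtr0_norm e2).
  have /andP[x2 _] := shift_in (- (e / 2)) (etrans (normrN _) (gtr0_norm e2)).
  by apply/andP; split; lra.
apply: (@filterS _ (nbhs x) _ [set y : 'rV[R]_n.+1 | forall i, 0 < y ord0 i < s i]).
  by move=> y yi i; have /andP[? ?] := yi i; rewrite !ltW.
apply: (@near_coord x (fun i t => 0 < t < s i)) => i; have /andP[x1 x2] := xO i.
near=> t; apply/andP; split; near: t; [exact: lt_nbhsr|exact: lt_nbhsl].
Unshelve. all: by end_near.
Qed.

Lemma boundary_cboxP x : boundary cbox x <->
  cbox x /\ exists i, x ord0 i = 0 \/ x ord0 i = s i.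
Proof.
rewrite /boundary -(closure_id _).1; last exact: closed_cbox.
split=> [[xB /= xI]|[xB [i xi]]]; split => //.
  apply: contrapT => /forallNP h; apply: xI; rewrite interior_cbox => i.
  have /andP[x1 x2] := xB i; have /not_orP[h1 h2] := h i.
  by rewrite !lt_neqAle x1 x2 eq_sym !andbT; apply/andP; split; apply/eqP.
rewrite interior_cbox => /(_ i); case: xi => ->; rewrite ltxx//.
by rewrite andbF.
Qed.

(** The normal is the normalised sum of the outer normals of the faces through [p]. Each active
    constraint then reads [dot x nu <= f i (x - dot x nu *: nu)], and the graph function is the
    minimum of the active [f i]. *)
Lemma lipschitz_boundary_cbox : lipschitz_boundary cbox.
Proof.
move=> p /boundary_cboxP[pB [i0 pi0]].
(* Sign of the outer normal in coordinate [i]: [-1] on the lower face, [1] on the upper face, [0] if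
   [p] lies on neither. *)
pose sg i : R := if p ord0 i == 0 then -1 else if p ord0 i == s i then 1 else 0.
have sg2 i : sg i ^+ 2 = (sg i != 0)%:R.
  rewrite /sg; case: (p ord0 i == 0); first by rewrite sqrrN expr1n oppr_eq0 oner_eq0.
  by case: (p ord0 i == s i); rewrite ?expr1n ?oner_eq0// expr0n eqxx.
have sgi0 : sg i0 != 0.
  rewrite /sg; have [_|h] := eqVneq (p ord0 i0) 0; first by rewrite oppr_eq0 oner_eq0.
  case: pi0 => [h0|->]; first by rewrite h0 eqxx in h.
  by rewrite eqxx oner_eq0.
pose m : R := \sum_i sg i ^+ 2.
have m0 : 0 < m.
  rewrite /m (bigD1 i0)//= ltr_pwDl//; last by apply: sumr_ge0 => i _; exact: sqr_ge0.
  by rewrite exprn_even_gt0.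
pose r := Num.sqrt m.
have r0 : 0 < r by rewrite sqrtr_gt0.
have r2 : r ^+ 2 = m by rewrite sqr_sqrtr// ltW.
pose nu : 'rV[R]_n.+1 := \row_i (sg i / r).
pose b i : R := if p ord0 i == 0 then 0 else s i.
pose f i (y : 'rV[R]_n.+1) := r * (b i - sg i * y ord0 i).
have kf i : r.-lipschitz (f i).
  move=> [x y] _ /=; rewrite /f -mulrBr normrM (gtr0_norm r0) ler_wpM2l ?(ltW r0)//.
  have -> : b i - sg i * x ord0 i - (b i - sg i * y ord0 i) = - sg i * (x - y) ord0 i.
    by rewrite !mxE; ring.
  rewrite normrM normrN; have sg1 : `|sg i| <= 1.
    rewrite /sg; case: (p ord0 i == 0); first by rewrite normrN normr1.
    by case: (p ord0 i == s i); rewrite ?normr1// normr0.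
  apply: le_trans (ler_wpM2r _ sg1) _ => //; rewrite mul1r.
  rewrite -[leRHS]/(mx_norm (x - y)) mx_normrE.
  exact: (le_bigmax _ (fun ij : 'I_1 * 'I_n.+1 => `|(x - y) ij.1 ij.2|) (ord0, i)).
pose act := [seq i <- enum 'I_n.+1 | sg i != 0].
have act0 : act != [::].
  have : i0 \in act by rewrite mem_filter sgi0 mem_enum.
  by case: act.
(* Constraints that are inactive at [p], including the face opposite to an active one, stay
   satisfied near [p]. *)
have near_p : nbhs p (fun x : 'rV[R]_n.+1 => forall i,
    (p ord0 i == 0 -> x ord0 i <= s i) /\ (p ord0 i != 0 -> 0 <= x ord0 i) /\
    (sg i = 0 -> x ord0 i <= s i)).
  apply: (@near_coord p (fun i t => (p ord0 i == 0 -> t <= s i) /\ (p ord0 i != 0 -> 0 <= t)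
    /\ (sg i = 0 -> t <= s i))) => i.
  have /andP[p0 ps] := pB i.
  have h1 : \forall t \near p ord0 i, p ord0 i == 0 -> t <= s i.
    have [pi0'|_] := eqVneq (p ord0 i) 0; last by apply: (@filterE _ (nbhs (p ord0 i))) => t.
    have : p ord0 i < s i by rewrite pi0'.
    by move/lt_nbhsl; apply: filterS => t /ltW.
  have h2 : \forall t \near p ord0 i, p ord0 i != 0 -> 0 <= t.
    have [_|pi0'] := eqVneq (p ord0 i) 0; first by apply: (@filterE _ (nbhs (p ord0 i))) => t.
    have : 0 < p ord0 i by rewrite lt_neqAle eq_sym pi0'.
    by move/lt_nbhsr; apply: filterS => t /ltW.
  have h3 : \forall t \near p ord0 i, sg i = 0 -> t <= s i.
    have [pis|pis] := eqVneq (p ord0 i) (s i).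
      apply: (@filterE _ (nbhs (p ord0 i))) => t; rewrite /sg pis gt_eqF// eqxx => /eqP.
      by rewrite oner_eq0.
    have : p ord0 i < s i by rewrite lt_neqAle pis.
    by move/lt_nbhsl; apply: filterS => t /ltW.
  by apply: filterS3 h1 h2 h3 => t t1 t2 t3.
have [g kg gP] := klipschitz_system act0 kf.
exists nu, g; split.
- rewrite /dot; under eq_bigr => i _ do rewrite !mxE.
  rewrite (eq_bigr (fun i => sg i ^+ 2 / m)); last first.
    by move=> i _; rewrite -r2; field; rewrite gt_eqF.
  by rewrite -mulr_suml divff// gt_eqF.
- by exists r; split; [rewrite num_real|move=> M rM; exact: (klipschitz_mono (ltW rM) kg)].
- apply: filterS near_p => x xnear.
  have xact i : sg i != 0 -> (dot x nu <= f i (x - dot x nu *: nu)) = (sg i * x ord0 i <= b i).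
    move=> si; rewrite /f !mxE.
    have -> : r * (b i - sg i * (x ord0 i + - (dot x nu * (sg i / r)))) =
      r * (b i - sg i * x ord0 i) + sg i ^+ 2 * dot x nu.
      by field; rewrite gt_eqF.
    by rewrite sg2 si mul1r lerDr pmulr_rge0// subr_ge0.
  rewrite gP; split=> [xB|/allP xg i].
    apply/allP => i; rewrite mem_filter mem_enum andbT => si; rewrite xact//.
    have /andP[x1 x2] := xB i; rewrite /sg /b; case: (p ord0 i == 0).
      by rewrite mulN1r oppr_le0.
    by case: (p ord0 i == s i); rewrite ?mul1r// mul0r ltW.
  have [n1 [n2 n3]] := xnear i.
  have xi : sg i != 0 -> sg i * x ord0 i <= b i.
    by move=> si; rewrite -xact//; apply: xg; rewrite mem_filter si mem_enum.
  move: xi n1 n2 n3; rewrite /sg /b; have [p0|p0] := eqVneq (p ord0 i) 0.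
    rewrite oppr_eq0 oner_eq0 mulN1r oppr_le0 => /(_ isT) x0 /(_ isT) x1 _ _.
    by rewrite x0 x1.
  have [ps|ps] := eqVneq (p ord0 i) (s i).
    by rewrite oner_eq0 mul1r => /(_ isT) x0 _ /(_ isT) x1 _; rewrite x0 x1.
  by rewrite eqxx => _ _ /(_ isT) -> /(_ erefl) ->.
Qed.

(** A face is given by its fixed coordinate and a boolean, true for the upper face. *)
Let face_index : finType := ('I_n.+1 * bool)%type.

Definition face_mx (i : 'I_n.+1) : 'M[R]_(n, n.+1) :=
  \matrix_(k, j) (if j == lift i k then s j else 0).

Definition face_pt (k : face_index) : 'rV[R]_n.+1 :=
  \row_j (if (j == k.1) && k.2 then s j else 0).

Definition face (k : face_index) (t : 'rV[R]_n) : 'rV[R]_n.+1 :=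
  t *m face_mx k.1 + face_pt k.

Lemma face_lift k t j : face k t ord0 (lift k.1 j) = t ord0 j * s (lift k.1 j).
Proof.
rewrite !mxE eq_sym (negbTE (neq_lift _ _)) /= addr0 (bigD1 j)//= !mxE eqxx big1 ?addr0//.
by move=> l lj; rewrite !mxE (inj_eq (@lift_inj _ _)) eq_sym (negbTE lj) mulr0.
Qed.

Lemma face_fixed k t : face k t ord0 k.1 = if k.2 then s k.1 else 0.
Proof.
rewrite !mxE eqxx /= big1 ?add0r// => l _.
by rewrite !mxE (negbTE (neq_lift _ _)) mulr0.
Qed.

Lemma piecewise_smooth_boundary_cbox : piecewise_smooth_boundary cbox.
Proof.
exists #|{: face_index}|, (fun k => face (enum_val k)); split.
- move=> k; apply: smooth_cell_affine => v v0; apply/rowP => j.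
  have := congr1 (fun u : 'rV[R]_n.+1 => u ord0 (lift (enum_val k).1 j)) v0.
  have := face_lift (enum_val k) v j; rewrite /face v0 add0r !mxE => + _.
  rewrite eq_sym (negbTE (neq_lift _ _))/= => /esym/eqP.
  by rewrite mulf_eq0 [s _ == 0]gt_eqF// orbF => /eqP.
- apply/seteqP; split => x.
    move=> /boundary_cboxP[xB [i xi]].
    pose k : face_index := (i, x ord0 i == s i).
    exists (enum_rank k) => //; rewrite enum_rankK.
    exists (\row_j (x ord0 (lift i j) / s (lift i j))).
      move=> j; rewrite mxE; have /andP[x1 x2] := xB (lift i j).
      by rewrite divr_ge0 ?(ltW (s0 _))//= ler_pdivrMr// mul1r.
    apply/rowP => j; case: (unliftP i j) => [l ->|->].
      by rewrite (face_lift k) mxE divfK// gt_eqF.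
    rewrite (face_fixed k) /=; case: eqP => // h.
    by case: xi => // ->.
  move=> [k _ [t tc <-]]; apply/boundary_cboxP; split; last first.
    exists (enum_val k).1; rewrite face_fixed; case: ifP => _; [by right|by left].
  move=> j; case: (unliftP (enum_val k).1 j) => [l ->|->].
    rewrite face_lift; have /andP[t1 t2] := tc l.
    by rewrite mulr_ge0 ?(ltW (s0 _))//= ler_piMl// ltW.
  by rewrite face_fixed; case: ifP => _; rewrite ?lexx ?(ltW (s0 _)).
- move=> k l kl; apply/seteqP; split => // x [[t tc xt] [u uc xu]].
  have : enum_val k != enum_val l by rewrite (inj_eq enum_val_inj).
  case: (enum_val k) (enum_val l) xt xu => [i b] [i' b'] xt xu.
  (* Faces with different fixed coordinates: a relative interior point of the second has coordinate
     [i] strictly between [0] and [s i], while the first fixes it at an end. *)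
  have [ii'|ii'] := eqVneq i i'; last first.
    case: (unliftP i' i) ii' xt => [j ->|->]; last by rewrite eqxx.
    move=> _ xt _; have /= h0 := face_fixed (lift i' j, b) t; rewrite xt -xu in h0.
    have /= h1 := face_lift (i', b') u j; move: h0; rewrite h1 {h1}.
    have /andP[u0 u1] := uc j; have := s0 (lift i' j); case: b {xt} => sj h.
      have : u ord0 j * s (lift i' j) < 1 * s (lift i' j) by rewrite ltr_pM2r.
      by rewrite h mul1r ltxx.
    by have := mulr_gt0 u0 sj; rewrite h ltxx.
  subst i'; move=> bb; have := face_fixed (i, b) t; have := face_fixed (i, b') u.
  rewrite xt xu /= => -> h; case: b b' h bb {xt xu} => [] [] //= h; rewrite ?eqxx// => _.
    by have := s0 i; rewrite h ltxx.
  by have := s0 i; rewrite -h ltxx.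
Qed.

Lemma normal_domain_cbox : normal_domain cbox.
Proof.
split; [|exact: compact_cbox|exact: lipschitz_boundary_cbox|exact: piecewise_smooth_boundary_cbox].
by exists 0 => i; rewrite mxE lexx ltW.
Qed.

End box.

(** * Symmetry of second derivatives and rigidity *)

Lemma norm_add_lt (R : realFieldType) (r u v : R) : 0 < r ->
  0 <= u <= r / 4 -> 0 <= v <= r / 4 -> `|u + v| < r.
Proof. by move=> r0 /andP[u0 uh] /andP[v0 vh]; rewrite ger0_norm; lra. Qed.

Lemma dist_half_false (R : realFieldType) (A B p d : R) :
  `|A - B| / 2 = d -> `|A - p| < d -> `|B - p| < d -> False.
Proof. by move=> dE Ap Bp; have := ler_distD p A B; rewrite [`|p - B|]distrC; lra. Qed.

Lemma mulfI2 (R : fieldType) (h u v p q : R) : h != 0 ->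
  u = h * (h * p) -> v = h * (h * q) -> u = v -> p = q.
Proof. by move=> h0 -> -> /(mulfI h0)/(mulfI h0). Qed.

Lemma subr_swap (V : zmodType) (a b c d : V) : a - b - (c - d) = a - c - (b - d).
Proof. by rewrite !opprB [d - c]addrC addrACA [- b + d]addrC. Qed.

Section directional_derivatives.
Context {R : realType} {n : nat}.
Implicit Types (g : 'rV[R]_n -> R) (v x y : 'rV[R]_n).

Lemma derive_line_MVT g v x (h : R) : 0 < h ->
  (forall t, 0 <= t <= h -> derivable g (t *: v + x) v) ->
  exists2 t, 0 <= t <= h & g (h *: v + x) - g x = h * 'D_v g (t *: v + x).
Proof.
move=> h0 dg; pose phi (t : R) := g (t *: v + x).
have line t k : g (k *: v + (t *: v + x)) = phi (k + t).
  by rewrite /phi addrA -scalerDl.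
have dphi t : 0 <= t <= h -> derivable phi t 1.
  by move=> /dg; rewrite (derive_line (line t)).2.
have [|t||t] := @MVT_segment R phi (fun t => 'D_v g (t *: v + x)) 0 h.
- exact: ltW.
- rewrite in_itv/= => /andP[t0 th].
  apply: DeriveDef; first by apply: dphi; rewrite !ltW.
  by rewrite (derive_line (line t)).1 derive1E.
- by apply: derivable_within_continuous => u; rewrite in_itv/=; exact: dphi.
- rewrite in_itv/= => th; rewrite /phi scale0r add0r subr0 => ->.
  by exists t => //; rewrite mulrC.
Qed.

Lemma derive_shift g v c x : 'D_v (fun y => g (c + y)) x = 'D_v g (c + x).
Proof.
rewrite /derive.
suff -> : (fun h => h^-1 *: (g (c + (h *: v + x)) - g (c + x))) =
  (fun h => h^-1 *: (g (h *: v + (c + x)) - g (c + x))) by [].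
by apply/funext => k /=; rewrite addrCA.
Qed.

Lemma derivable_shift g v c x : derivable g (c + x) v -> derivable (fun y => g (c + y)) x v.
Proof.
rewrite /derivable.
suff -> : (fun h => h^-1 *: (g (c + (h *: v + x)) - g (c + x))) =
  (fun h => h^-1 *: (g (h *: v + (c + x)) - g (c + x))) by [].
by apply/funext => k /=; rewrite addrCA.
Qed.

End directional_derivatives.

Section schwarz.
Context {R : realType} {n : nat}.
Variables (U : set 'rV[R]_n) (g : 'rV[R]_n -> R).
Hypothesis openU : open U.
Hypothesis dg : forall s x i, U x -> derivable (partials s g) x (delta_mx ord0 i).
Hypothesis cg : forall s x, U x -> {for x, continuous (partials s g)}.

Local Notation e i := (delta_mx ord0 i : 'rV[R]_n).

Lemma mixed_difference i j x h : 0 < h ->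
  (forall a b, 0 <= a <= h -> 0 <= b <= h -> U (b *: e j + (a *: e i + x))) ->
  exists a b, [/\ 0 <= a <= h, 0 <= b <= h &
    g (h *: e j + (h *: e i + x)) - g (h *: e i + x) - (g (h *: e j + x) - g x) =
    h * (h * partials [:: j; i] g (b *: e j + (a *: e i + x)))].
Proof.
move=> h0 hU; have hh : 0 <= h <= h by rewrite lexx ltW.
have h00 : 0 <= (0 : R) <= h by rewrite lexx ltW.
have U0 a : 0 <= a <= h -> U (a *: e i + x).
  by move=> ah; have := hU a 0 ah h00; rewrite scale0r add0r.
pose phi y := g (h *: e j + y) - g y.
have [|a ah Ea] := @derive_line_MVT _ _ phi (e i) x h h0.
  move=> t th; apply: derivableB; first apply: derivable_shift.
    by apply: (@dg [::]); exact: hU.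
  by apply: (@dg [::]); exact: U0.
have [|b bh Eb] := @derive_line_MVT _ _ (partials [:: i] g) (e j) (a *: e i + x) h h0.
  by move=> t th; apply: dg; exact: hU.
exists a, b; split => //; rewrite -[LHS]/(phi (h *: e i + x) - phi x) Ea; congr (_ * _).
rewrite -Eb /= deriveB; first by rewrite derive_shift.
- by apply: derivable_shift; apply: (@dg [::]); exact: hU.
- by apply: (@dg [::]); exact: U0.
Qed.

(** The second difference over a square of side [h] is symmetric in the two directions, and by two
    mean value theorems it equals [h ^+ 2] times either mixed derivative at some point of the
    square. By continuity, the two cannot differ at [x]. *)
Lemma schwarz i j x : U x -> partials [:: j; i] g x = partials [:: i; j] g x.
Proof.
move=> Ux; apply/eqP/negPn/negP => neq.
pose d := `|partials [:: j; i] g x - partials [:: i; j] g x| / 2.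
have d0 : 0 < d by rewrite divr_gt0// normr_gt0 subr_eq0.
have N : nbhs x (fun y => U y /\ `|partials [:: j; i] g x - partials [:: j; i] g y| < d /\
                        `|partials [:: i; j] g x - partials [:: i; j] g y| < d).
  have h1 := open_nbhs_nbhs (conj openU Ux).
  have /cvgrPdist_lt/(_ d d0) h2 := @cg [:: j; i] x Ux.
  have /cvgrPdist_lt/(_ d d0) h3 := @cg [:: i; j] x Ux.
  exact: (filterI h1 (filterI h2 h3)).
have /nbhs_ballP[r /= r0 rN] := N.
(* If [i = j] the two displacements add up in one coordinate, so [2 * h] has to stay below [r]. *)
pose h := r / 4; have h0 : 0 < h by rewrite divr_gt0.
have small u v : 0 <= u <= h -> 0 <= v <= h -> `|u + v| < r by exact: norm_add_lt.
have inB k l a b : 0 <= a <= h -> 0 <= b <= h -> ball x r (b *: e l + (a *: e k + x)).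
  move=> /andP[a0 ah] /andP[b0 bh]; apply/rV_ballP => // m.
  rewrite !mxE eqxx /= addrA opprD addrCA subrr addr0 normrN.
  have hh : 0 <= h <= h by rewrite lexx ltW.
  have h00 : 0 <= (0 : R) <= h by rewrite lexx ltW.
  by case: eqP => _; case: eqP => _; rewrite ?mulr1 ?mulr0; apply: small; rewrite ?a0 ?b0.
have [a [b [ah bh E1]]] := @mixed_difference i j x h h0 (fun a b ah bh => (rN _ (inB i j a b ah bh)).1).
have [c [f [ch fh E2]]] := @mixed_difference j i x h h0 (fun a b ah bh => (rN _ (inB j i a b ah bh)).1).
have N1 : `|partials [:: j; i] g x - partials [:: j; i] g (b *: e j + (a *: e i + x))| < d :=
  (rN _ (inB i j a b ah bh)).2.1.
have N2 : `|partials [:: i; j] g x - partials [:: i; j] g (f *: e i + (c *: e j + x))| < d :=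
  (rN _ (inB j i c f ch fh)).2.2.
have E : partials [:: j; i] g (b *: e j + (a *: e i + x)) =
         partials [:: i; j] g (f *: e i + (c *: e j + x)).
  apply: (mulfI2 (lt0r_neq0 h0) E1 E2).
  rewrite (addrCA (h *: e i)); exact: subr_swap.
by rewrite E in N1; exact: dist_half_false erefl N1 N2.
Qed.

End schwarz.

Section coordinates_of_smooth_maps.
Context {R : realType} {n m : nat}.
Variables (U : set 'rV[R]_n) (f : 'rV[R]_n -> 'rV[R]_m).
Hypothesis openU : open U.
Hypothesis sf : smooth_on U f.

Definition coord_fun (a : 'I_m) (x : 'rV[R]_n) : R := f x ord0 a.

Lemma derivable_coord_partials s a x v : U x ->
  derivable (fun y => partials s f y ord0 a) x v.
Proof.
move=> Ux; have := (derivable_mxP (partials s f) x v).1.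
by apply; apply: diff_derivable; exact: sf.
Qed.

Lemma partials_coord s a x : U x -> partials s (coord_fun a) x = partials s f x ord0 a.
Proof.
elim: s x => [//|i s ih] x Ux /=.
rewrite (@near_eq_derive _ _ _ _ (fun y => partials s f y ord0 a)).
  by rewrite (@derive_mx _ _ _ _ (partials s f)) ?mxE//; apply: diff_derivable; exact: sf.
by apply: filterS (open_nbhs_nbhs (conj openU Ux)) => y /ih.
Qed.

Lemma near_partials_coord s a x : U x ->
  \near x, partials s f x ord0 a = partials s (coord_fun a) x.
Proof.
by move=> Ux; apply: filterS (open_nbhs_nbhs (conj openU Ux)) => y Uy; rewrite partials_coord.
Qed.

Lemma derivable_partials_coord s a x v : U x -> derivable (partials s (coord_fun a)) x v.
Proof.
move=> Ux; apply: (@near_eq_derivable _ _ _ (fun y => partials s f y ord0 a)).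
  exact: near_partials_coord.
exact: derivable_coord_partials.
Qed.

Lemma continuous_partials_coord s a x : U x -> {for x, continuous (partials s (coord_fun a))}.
Proof.
move=> Ux; rewrite /prop_for /continuous_at partials_coord//.
apply: (cvg_trans (near_eq_cvg (near_partials_coord s a Ux))).
apply: (@continuous_comp _ _ _ (partials s f) (fun M : 'rV[R]_m => M ord0 a)).
  by apply: differentiable_continuous; exact: sf.
exact: coord_continuous.
Qed.

Lemma partials_swap a i j x : U x ->
  partials [:: j; i] (coord_fun a) x = partials [:: i; j] (coord_fun a) x.
Proof.
apply: (@schwarz _ _ U) => // [s y k Uy|s y Uy].
  exact: derivable_partials_coord.
exact: continuous_partials_coord.
Qed.

End coordinates_of_smooth_maps.

(** * Rigidity of isometric maps *)

Section isometries.
Context {R : realType} {n : nat}.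
Variables (f : 'rV[R]_n -> 'rV[R]_n) (U V : set 'rV[R]_n).
Hypotheses (openU : open U) (sf : smooth_on U f).
Hypotheses (openV : open V) (VU : V `<=` U).
Hypothesis isof : forall x, V x -> forall v w, dot ('d f x v) ('d f x w) = dot v w.

Local Notation e i := (delta_mx ord0 i : 'rV[R]_n).
Local Notation D i a := (partials [:: i] (coord_fun f a)).
Local Notation DD i j a := (partials [:: i; j] (coord_fun f a)).

Lemma dot_delta i j : dot (e i) (e j) = (i == j)%:R.
Proof.
rewrite /dot (bigD1 i)//= !mxE !eqxx mul1r big1 ?addr0// => k ki.
by rewrite !mxE (negbTE ki) andbF mul0r.
Qed.

Lemma isometry_gram i j x : V x -> \sum_a D i a x * D j a x = (i == j)%:R.
Proof.
move=> Vx; have Ux := VU Vx; rewrite -dot_delta -(isof Vx) /dot.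
apply: eq_bigr => a _.
by rewrite !(partials_coord openU)// /= !deriveE//; exact: (@sf [::]).
Qed.

Lemma isometry_gram_derive k i j x : V x ->
  \sum_a (DD k i a x * D j a x + D i a x * DD k j a x) = 0.
Proof.
move=> Vx; have Ux := VU Vx.
have : 'D_(e k) (\sum_a (fun y => D i a y * D j a y)) x = 0.
  rewrite (@near_eq_derive _ _ _ _ (cst ((i == j)%:R : R))) ?derive_cst//.
  apply: filterS (open_nbhs_nbhs (conj openV Vx)) => y Vy.
  by rewrite fct_sumE isometry_gram.
have dD l a : derivable (D l a) x (e k) by exact: (@derivable_partials_coord _ _ _ U f openU sf [:: l] a x (e k) Ux).
have hM a : 'D_(e k) (fun y => D i a y * D j a y) x = D i a x * DD k j a x + D j a x * DD k i a x.
  exact: (deriveM (dD i a) (dD j a)).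
rewrite derive_sum => [h|a]; last exact: (derivableM (dD i a) (dD j a)).
rewrite -[RHS]h; apply: eq_bigr => a _; apply: etrans (esym (hM a)).
by rewrite addrC; congr (_ + _); rewrite mulrC.
Qed.

(** Write [f_i] for partial derivatives. Differentiating the constant [dot f_i f_i] along [j] gives
    [dot f_i f_ij = 0]; differentiating [dot f_i f_j] along [i] then gives [dot f_ii f_j = 0] for
    all [j]. The [f_j] form an orthonormal basis, so [f_ii = 0]. *)
Lemma isometry_second_derive i a x : V x -> DD i i a x = 0.
Proof.
move=> Vx; have Ux := VU Vx.
pose w : 'rV[R]_n := \row_a DD i i a x.
pose J : 'M[R]_n := \matrix_(j, a) D j a x.
have JJ : J *m J^T = 1%:M.
  apply/matrixP => j k; rewrite !mxE -(isometry_gram j k Vx); apply: eq_bigr => b _.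
  by rewrite !mxE.
have wJ : w *m J^T = 0.
  apply/rowP => j; rewrite !mxE.
  transitivity (\sum_b DD i i b x * D j b x); first by apply: eq_bigr => b _; rewrite !mxE.
  have h1 := isometry_gram_derive i i j Vx.
  have h2 := isometry_gram_derive j i i Vx.
  have h3 : \sum_b D i b x * DD i j b x = 0.
    move: h2; under eq_bigr => b _ do rewrite (partials_swap openU sf b i j Ux) [X in X + _]mulrC.
    by rewrite big_split /= -mulr2n => /eqP; rewrite mulrn_eq0 => /orP[//|/eqP].
  by move: h1; rewrite big_split /= h3 addr0.
have : w = 0 by rewrite -[w]mulmx1 -(mulmx1C JJ) mulmxA wJ mul0mx.
by move=> /rowP/(_ a); rewrite !mxE.
Qed.

(* Second derivatives vanish, so f is affine along the segment. *)
Lemma isometry_segment i x T : 0 < T -> (forall t, 0 <= t <= T -> V (t *: e i + x)) ->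
  dot (f (T *: e i + x) - f x) (f (T *: e i + x) - f x) = T ^+ 2.
Proof.
move=> T0 hV; have V0 : V x by have := hV 0; rewrite scale0r add0r => h; apply: h; rewrite lexx ltW.
have fE a : f (T *: e i + x) ord0 a - f x ord0 a = T * D i a x.
  have [|t tT ->] := @derive_line_MVT _ _ (coord_fun f a) (e i) x T T0.
    by move=> t /hV/VU Ut; exact: (@derivable_partials_coord _ _ _ U f openU sf [::] a _ (e i) Ut).
  congr (_ * _); apply/eqP; rewrite -subr_eq0; apply/eqP.
  have /andP[t0 tT'] := tT; move: t0; rewrite le_eqVlt => /orP[/eqP<-|t0].
    by rewrite scale0r add0r subrr.
  have sub_in u : 0 <= u <= t -> 0 <= u <= T by move=> /andP[-> ut]; exact: le_trans ut tT'.
  have [|u uT ->] := @derive_line_MVT _ _ (D i a) (e i) x t t0.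
    by move=> u /sub_in/hV/VU Ut; exact: (@derivable_partials_coord _ _ _ U f openU sf [:: i] a _ (e i) Ut).
  by rewrite -[X in _ * X]/(DD i i a _) isometry_second_derive ?mulr0//; exact/hV/sub_in.
have g1 := isometry_gram i i V0; rewrite eqxx in g1.
rewrite -[RHS]mulr1 -[1]g1 mulr_sumr.
apply: eq_bigr => a _; have fEa : (f (T *: e i + x) - f x) ord0 a = T * D i a x.
  by rewrite -fE [LHS]mxE; congr (_ + _); rewrite mxE.
by rewrite fEa mulrACA -expr2.
Qed.

End isometries.

Lemma dot_bounded (R : realType) n (u v : 'rV[R]_n) A :
  (forall i, `|u ord0 i| <= A) -> (forall i, `|v ord0 i| <= A) ->
  dot (u - v) (u - v) <= n%:R * (2 * A) ^+ 2.
Proof.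
move=> uA vA; have h i : (u - v) ord0 i * (u - v) ord0 i <= (2 * A) ^+ 2.
  rewrite -expr2 -[leLHS]real_normK ?num_real// !mxE ler_sqr ?nnegrE//.
  - by apply: le_trans (ler_normB _ _) _; have := uA i; have := vA i; lra.
  - by have := le_trans (normr_ge0 _) (uA i); lra.
have -> : n%:R * (2 * A) ^+ 2 = \sum_(i < n) (2 * A) ^+ 2.
  by rewrite sumr_const card_ord mulr_natl.
by apply: ler_sum => i _; exact: h.
Qed.

(** The segment from [s i / 4] to [3 * s i / 4] in coordinate [i], with the other coordinates at a
    quarter of their sides, stays in the interior, where constant Gram matrices can be
    differentiated. Its end points are sent into a cube of half-side [A]. *)
Lemma isometric_embedding_cbox (R : realType) n (s : 'I_n.+1 -> R) (Omega : set 'rV[R]_n.+1) f (A : R) i :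
  (forall j, 0 < s j) -> isometric_embedding (cbox s) Omega f ->
  (forall x, Omega x -> forall j, `|x ord0 j| <= A) ->
  (s i / 2) ^+ 2 <= n.+1%:R * (2 * A) ^+ 2.
Proof.
move=> s0 [[U [oU BU sf]] _ fO isof] OA.
pose V := interior (cbox s); have VB : V `<=` cbox s by exact: interior_subset.
pose x : 'rV[R]_n.+1 := \row_j (s j / 4).
have seg t : 0 <= t <= s i / 2 -> V (t *: delta_mx ord0 i + x).
  move=> /andP[t0 ts]; rewrite /V interior_cbox => j; rewrite !mxE eqxx /=.
  have := s0 j; case: eqP => [->|_] sj; rewrite ?mulr1 ?mulr0; lra.
have T0 : 0 < s i / 2 by rewrite divr_gt0.
have VOm t : 0 <= t <= s i / 2 -> Omega (f (t *: delta_mx ord0 i + x)).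
  by move=> /seg/VB h; apply: fO; exists (t *: delta_mx ord0 i + x).
rewrite -(@isometry_segment _ _ f U V oU sf _ _ _ i x _ T0 seg).
- apply: dot_bounded; apply: OA; first by apply: VOm; rewrite lexx ltW.
  by have := VOm 0; rewrite scale0r add0r => h; apply: h; rewrite lexx ltW.
- exact: open_interior.
- by move=> y /VB/BU.
- by move=> y /VB/isof.
Qed.

(** * Regularity of normal domains *)

Section regularity.
Context {R : realType}.

Lemma lipschitz_continuous (V : normedModType R) (g : V -> R) : lipschitz g -> continuous g.
Proof.
move=> /pinfty_ex_gt0[M M0 gM] x; apply/cvgrPdist_lt => e e0; near=> y.
apply: le_lt_trans (gM (x, y) _) _ => //=.
rewrite mulrC -ltr_pdivlMr//; near: y.
by apply: cvgr_dist_lt => //; rewrite divr_gt0.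
Unshelve. all: by end_near.
Qed.

Section affine.
Context {n : nat}.
Implicit Types (nu p x y : 'rV[R]_n).

Lemma dotE (u v : 'rV[R]_n) : dot u v = (u *m v^T) ord0 ord0.
Proof. by rewrite !mxE; apply: eq_bigr => i _; rewrite !mxE. Qed.

Lemma dotDl (u v w : 'rV[R]_n) : dot (u + v) w = dot u w + dot v w.
Proof. by rewrite !dotE mulmxDl mxE. Qed.

Lemma dotZl a (u v : 'rV[R]_n) : dot (a *: u) v = a * dot u v.
Proof. by rewrite !dotE -scalemxAl mxE. Qed.

Lemma affine_rV_continuous m (M : 'M[R]_(n, m)) :
  continuous (fun x : 'rV[R]_n => x *m M : 'rV[R]_m).
Proof.
move=> x; have := differentiable_continuous (differentiable_affine_rV M 0 x).
by rewrite (_ : (fun t => t *m M + 0) = fun t => t *m M)//; apply/funext => t; rewrite addr0.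
Qed.

Lemma dot_continuous nu : continuous (fun x => dot x nu).
Proof.
move=> x; rewrite (_ : (fun _ => _) = (fun M : 'rV[R]_1 => M ord0 ord0) \o (fun x => x *m nu^T)).
  by apply: continuous_comp; [exact: affine_rV_continuous|exact: coord_continuous].
by apply/funext => y; rewrite /= dotE.
Qed.

Lemma proj_continuous nu : continuous (fun x => x - dot x nu *: nu).
Proof.
move=> x; rewrite (_ : (fun _ => _) = (fun x => x *m (1%:M - nu^T *m nu))).
  exact: affine_rV_continuous.
apply/funext => y; rewrite mulmxBr mulmx1 mulmxA; congr (_ - _).
by rewrite [y *m _]mx11_scalar mul_scalar_mx -dotE.
Qed.

(* Moving a boundary point in the direction [- nu] enters the interior. *)
Lemma lipschitz_boundary_closure_interior (Omega : set 'rV[R]_n) :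
  closed Omega -> lipschitz_boundary Omega -> Omega `<=` closure (interior Omega).
Proof.
move=> clO lO p Op; have [pI|pI] := pselect (interior Omega p).
  exact: subset_closure.
have [|nu [g [nu1 lg pO]]] := lO p; first by split => //; exact: subset_closure.
have cg := lipschitz_continuous lg.
have line_cvg : (fun t : R => p - t *: nu) @ 0 --> p.
  rewrite -{2}[p]subr0 -(scale0r nu); apply: cvgB; first exact: cvg_cst.
  by apply: cvgZr_tmp; exact: cvg_id.
move=> B pB; have pO' := nbhs_interior pO.
have : nbhs (0 : R) (fun t : R => B (p - t *: nu) /\
    nbhs (p - t *: nu) (fun x => Omega x <-> dot x nu <= g (x - dot x nu *: nu))).
  exact: (line_cvg _ (filterI pB pO')).
move=> /nbhs_ballP[e /= e0 eB].
pose t := e / 2; have t0 : 0 < t by rewrite divr_gt0.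
have [Bx xO] : B (p - t *: nu) /\
    nbhs (p - t *: nu) (fun x => Omega x <-> dot x nu <= g (x - dot x nu *: nu)).
  apply: eB; rewrite /ball /= sub0r normrN gtr0_norm// /t; lra.
exists (p - t *: nu); split => //.
have dx : dot (p - t *: nu) nu = dot p nu - t by rewrite -scaleNr dotDl dotZl nu1 mulr1.
(* Since [nu] is a unit vector, the move leaves the projection on the hyperplane fixed and lowers
   [dot x nu] by [t]: the inequality becomes strict, which is an open condition. *)
have px : p - t *: nu - dot (p - t *: nu) nu *: nu = p - dot p nu *: nu.
  by rewrite dx scalerBl opprB addrA subrK.
have lt_x : dot (p - t *: nu) nu < g (p - t *: nu - dot (p - t *: nu) nu *: nu).
  have := (nbhs_singleton pO).1 Op; rewrite px dx; lra.
have : nbhs (p - t *: nu) (fun x => 0 < g (x - dot x nu *: nu) - dot x nu).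
  apply: (@cvgr_gt _ _ (nbhs (p - t *: nu)) _ _ (g (p - t *: nu - dot (p - t *: nu) nu *: nu) - dot (p - t *: nu) nu)).
    apply: cvgB; last exact: dot_continuous.
    apply: (@continuous_comp _ _ _ (fun x => x - dot x nu *: nu) g); last exact: cg.
    exact: proj_continuous.
  by rewrite subr_gt0.
apply: filterS2 xO => x xO; rewrite subr_gt0 => lt; apply/xO; exact: ltW.
Qed.

End affine.

Lemma normal_domain_interior n (Omega : set 'rV[R]_n) :
  normal_domain Omega -> interior Omega !=set0.
Proof.
move=> [[p Op] cO lO _]; have clO : closed Omega by apply: compact_closed => //; exact: norm_hausdorff.
have [x [xI _]] := lipschitz_boundary_closure_interior clO lO Op filterT.
by exists x.
Qed.

Lemma open_cube_sub n (V : set 'rV[R]_n) : open V -> V !=set0 ->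
  exists (a : 'I_n -> R) (s : R), 0 < s /\
    forall x : 'rV[R]_n, (forall i, a i <= x ord0 i <= a i + s) -> V x.
Proof.
move=> oV [p Vp]; have /nbhs_ballP[e /= e0 eV] := open_nbhs_nbhs (conj oV Vp).
exists (fun i => p ord0 i), (e / 2); split; first by rewrite divr_gt0.
move=> x xp; apply: eV; apply/rV_ballP => // i; have := xp i => /andP[x1 x2].
by rewrite distrC ger0_norm; lra.
Qed.

End regularity.

(** * Thin boxes *)

Lemma energy_bounded_dim_mono (R : realType) (V : lmodType R) (D : set V)
    (ip : V -> V -> R) (A : V -> V) (x y : R) k :
  x <= y -> energy_bounded_dim D ip A x k -> energy_bounded_dim D ip A y k.
Proof.
move=> xy h d /h[phi Dphi phiE]; exists phi => // c /phiE[v0 vE]; split => //.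
by apply: le_trans vE _; rewrite ler_wpM2r ?lerD2r// ltW.
Qed.

(** A lower bound of Weyl type: a cube inside the interior, fixed once and for all, is divided into
    [m ^ n.+1] cells carrying one bump each. *)
Lemma energy_bounded_dim_domain (R : realType) n (Omega : set 'rV[R]_n.+1) :
  normal_domain Omega -> exists2 c : R, 0 < c & forall m, (0 < m)%N ->
    energy_bounded_dim (test_function Omega) (L2_inner Omega)
      (fun f : 'rV[R]_n.+1 -> R => \- laplacian f) (c * m%:R ^+ 2) (m ^ n.+1).
Proof.
move=> nO; have [_ cO _ _] := nO; have [L L0 bL] := @derive_bump_bounded R.
have [a [s [s0 cubeO]]] := open_cube_sub (@open_interior _ Omega) (normal_domain_interior nO).
exists (n.+1%:R * (2 * L ^+ 2 / expR (- 4) ^+ 4) / s ^+ 2).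
  by rewrite divr_gt0 ?exprn_gt0// mulr_gt0// divr_gt0 ?mulr_gt0 ?exprn_gt0// expR_gt0.
move=> m m0; rewrite [_ / s ^+ 2 * _]mulrAC -[_ * _ / s ^+ 2]mulrA -expr_div_n.
exact: (cell_bump_family bL cO s0 m0 cubeO).
Qed.

Lemma expn_regroup r S m n :
  ((r * S) ^ n * (2 * m) ^ n.+1 = r ^ n * (2 ^ n.+1 * S ^ n) * m ^ n.+1)%N.
Proof. by rewrite !expnMn !mulnA [(r ^ n * S ^ n * _)%N]mulnAC. Qed.

Section thin_box.
Context {R : realType} {n : nat}.
Variables (eps : R) (q : nat).
Hypotheses (eps0 : 0 < eps) (q0 : (0 < q)%N).

Definition thin_size : 'I_n.+1 -> R := @grid_size R n eps 1 q.

Lemma thin_size_gt0 i : 0 < thin_size i.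
Proof. by rewrite /thin_size /grid_size; case: unliftP => *; rewrite mulr_gt0 ?ltr0n. Qed.

Local Notation B := (cbox thin_size).
Local Notation D := (test_function B).
Local Notation ip := (L2_inner B).
Local Notation A := (fun f : 'rV[R]_n.+1 -> R => \- laplacian f).

Let cB : compact B. Proof. exact: compact_cbox. Qed.

(** The Poincare inequality across the thin side involves no functional, so that
    [energy_bounded_dim_le] applies with [K = 0]. *)
Lemma thin_box_dim_eq0 x k : x * eps ^+ 2 < 1 -> energy_bounded_dim D ip A x k -> k = 0%N.
Proof.
move=> xe xk; apply/eqP; rewrite -leqn0.
apply: (@energy_bounded_dim_le _ _ (L2 B) D ip A (eps ^+ 2) 0 x 0 k (fun=> 0)) xk => //.
- exact: L2_psd_form.
- exact: test_energy_psd_form.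
- by move=> f; exact: test_L2.
- by case.
- by rewrite exprn_gt0.
- move=> u tu; rewrite mul0r add0r (L2_inner_sqr tu) (test_energy_sqr cB tu).
  have := @dirichlet_poincare R n (fun=> 0) eps eps0 u _ (test_weak_grad cB tu).
  move=> h; apply: le_trans (h _) _.
    move=> x0 x0N; apply: nbhs_singleton (test_near0 tu _).
    rewrite interior_cbox => /(_ ord0); rewrite /thin_size /grid_size unlift_none mul1r.
    by move=> ?; apply: x0N; rewrite add0r.
  rewrite ler_wpM2l ?sqr_ge0// (bigD1 ord0)//= lerDl; apply: sumr_ge0 => i _.
  by apply: integral_rV_ge0 => y; rewrite sqr_ge0.
Qed.

(** Cutting the thin side into [m] parts and the others, of length [q * eps], into [q * m] parts
    gives [q ^ n * m ^ n.+1] cells of side [eps / m]. *)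
Lemma thin_box_dim_le m x k : (0 < m)%N -> x * (eps / m%:R) ^+ 2 < 1 ->
  energy_bounded_dim D ip A x k -> (k <= q ^ n * m ^ n.+1)%N.
Proof.
move=> m0 xm xk; pose h := eps / m%:R.
have h0 : 0 < h by rewrite divr_gt0 ?ltr0n.
have -> : (q ^ n * m ^ n.+1)%N = #|{: grid_index n m (q * m)}|.
  by rewrite card_grid_index expnMn mulnC expnS mulnAC -mulnA.
apply: (@energy_bounded_dim_le _ _ (L2 B) D ip A (h ^+ 2) (h ^+ n.+1)^-1 x _ k
  (fun j => \1_(cell (grid_corner (fun=> 0) h (enum_val j)) h))) xk => //.
- exact: L2_psd_form.
- exact: test_energy_psd_form.
- by move=> f; exact: test_L2.
- by move=> j; exact: indic_cell_L2.
- by rewrite exprn_gt0.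
- move=> u tu; apply: test_poincare_grid => // y; rewrite interior_cbox => yB i.
  have := yB i; rewrite add0r /thin_size /grid_size /h => /andP[y0 y1].
  rewrite (ltW y0)/=; apply: lt_le_trans y1 _.
  by case: unliftP => *; rewrite ?natrM; rewrite le_eqVlt; apply/orP; left; apply/eqP; field; rewrite pnatr_eq0 -lt0n m0.
Qed.

End thin_box.

Lemma thin_box_subspectral (R : realType) n (Omega : set 'rV[R]_n.+1) (L : R) :
  normal_domain Omega -> 0 < L -> exists q : nat, (0 < q)%N /\
    dirichlet_subspectral Omega (cbox (@thin_size R n (L / q%:R) q)).
Proof.
move=> nO L0; have [_ cO _ _] := nO; have [c c0 cP] := energy_bounded_dim_domain nO.
(* [S] absorbs the constant [c]; [r] is such that [q ^ n * (2 * m) ^ n.+1 = (r * m) ^ n.+1]. *)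
pose S := (Num.truncn (c * L ^+ 2)).+1.
have S1 : c * L ^+ 2 < S%:R by exact: truncnS_gt.
have S2 : c * L ^+ 2 <= S%:R ^+ 2.
  apply: le_trans (ltW S1) _; rewrite expr2 ler_peMr//.
  by rewrite ler1n.
pose r := (2 ^ n.+1 * S ^ n)%N; pose q := (r * S)%N.
have r0 : (0 < r)%N by rewrite muln_gt0 !expn_gt0.
have q0 : (0 < q)%N by rewrite muln_gt0 r0.
have qR0 : 0 < q%:R :> R by rewrite ltr0n.
exists q; split => // x; set eps := L / q%:R.
have eps0 : 0 < eps by rewrite divr_gt0.
apply: counting_le_energy_bounded_dim; first exact: compact_cbox.
move=> k xk.
(* The least such [m.+1] is the number of parts of the thin side adapted to the level [x]. *)
have ex_m : exists m, x * (eps / m.+1%:R) ^+ 2 < 1.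
  exists (Num.truncn (x * eps ^+ 2)); have := truncnS_gt (x * eps ^+ 2).
  move: ((Num.truncn (x * eps ^+ 2)).+1) (ltn0Sn (Num.truncn (x * eps ^+ 2))) => j j0 xj.
  have j1 : 1 <= j%:R :> R by rewrite ler1n.
  rewrite expr_div_n mulrA ltr_pdivrMr ?exprn_gt0 ?ltr0n// mul1r.
  by apply: lt_le_trans xj _; rewrite expr2 ler_peMr// ltW// (lt_le_trans _ j1).
(* If one part suffices, the box has no eigenvalue up to [x]. Otherwise there are [m.+2] parts, and
   minimality gives [m.+1 ^ 2 <= x * eps ^+ 2]. *)
case: (ex_minnP ex_m) => -[|m] mx m_min.
  have -> : k = 0%N by apply: (thin_box_dim_eq0 eps0 _ xk); move: mx; rewrite divr1.
  by apply: esum_ge0 => lam _; apply: ereal_sup_ubound; exists 0%N => //; exists (fun=> 0); split; [case|move=> ? ? []].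
have km := thin_box_dim_le eps0 (ltn0Sn m.+1) mx xk.
have xm : 1 <= x * (eps / m.+1%:R) ^+ 2.
  by rewrite leNgt; apply/negP => /m_min; rewrite ltnn.
apply: (@le_trans _ _ (((r * m.+1) ^ n.+1)%N%:R%:E)).
  rewrite lee_fin ler_nat; apply: leq_trans km _.
  have m2 : (m.+2 <= 2 * m.+1)%N by rewrite mul2n -addnn addSn ltnS leq_addl.
  apply: (@leq_trans (q ^ n * (2 * m.+1) ^ n.+1)).
    by rewrite leq_mul2l leq_exp2r// m2 orbT.
  have -> : ((r * m.+1) ^ n.+1 = r ^ n * (2 ^ n.+1 * S ^ n) * m.+1 ^ n.+1)%N.
    by rewrite expnMn [(r ^ n.+1)%N]expnSr.
  by rewrite leq_eqVlt; apply/orP; left; apply/eqP; exact: expn_regroup.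
apply: energy_bounded_dim_le_counting => //; apply: energy_bounded_dim_mono (cP (r * m.+1)%N _); last by rewrite muln_gt0 r0.
have mR0 : 0 < m.+1%:R :> R by [].
have rR0 : 0 < r%:R :> R by rewrite ltr0n.
have SR0 : 0 < S%:R :> R by [].
have h : (m.+1%:R * r%:R) ^+ 2 * (c * L ^+ 2) <= (m.+1%:R * r%:R) ^+ 2 * S%:R ^+ 2.
  by rewrite ler_wpM2l ?sqr_ge0.
move: xm; rewrite /eps /q natrM => xm; rewrite natrM.
(* With [q = r * S], minimality bounds [x] below by [(m.+1 * q / L) ^+ 2]; then
   [c * L ^+ 2 <= S ^+ 2] yields [c * (r * m.+1) ^+ 2 <= x]. *)
have : (m.+1%:R * (r%:R * S%:R) / L) ^+ 2 <= x.
  have p0 : 0 < (m.+1%:R * (r%:R * S%:R) / L) ^+ 2.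
    by rewrite exprn_gt0// divr_gt0// !mulr_gt0.
  have := ler_wpM2l (ltW p0) xm; rewrite mulr1 => /le_trans; apply.
  by rewrite le_eqVlt; apply/orP; left; apply/eqP; field; rewrite ?gt_eqF.
apply: le_trans; rewrite expr_div_n ler_pdivlMr ?exprn_gt0//.
apply: le_trans (_ : _ <= (m.+1%:R * r%:R) ^+ 2 * S%:R ^+ 2) _.
  by apply: le_trans h; rewrite le_eqVlt; apply/orP; left; apply/eqP; ring.
by rewrite le_eqVlt; apply/orP; left; apply/eqP; ring.
Qed.

Lemma exists_nonembedded_ge2 (R : realType) n (Omega : set 'rV[R]_n.+2) :
  normal_domain Omega ->
  exists Omega' : set 'rV[R]_n.+2,
    [/\ normal_domain Omega', dirichlet_subspectral Omega Omega' &
        ~ embeds_isometrically Omega' Omega].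
Proof.
move=> nO; have [_ cO _ _] := nO; have [B OB] := compact_coord_bounded cO.
pose A : R := `|B| + 1; have A0 : 0 < A by rewrite ltr_wpDl.
(* An embedding would give [(L / 2) ^+ 2 <= n.+2 * (2 * A) ^+ 2], whereas [L / 2] is
   [n.+3 * (2 * A)]. *)
pose L : R := 4 * A * n.+3%:R.
have L0 : 0 < L by rewrite !mulr_gt0.
have [q [q0 sub]] := thin_box_subspectral nO L0.
have qR0 : 0 < q%:R :> R by rewrite ltr0n.
have s0 : forall i, 0 < @thin_size R n.+1 (L / q%:R) q i.
  by move=> i; apply: thin_size_gt0 => //; rewrite divr_gt0.
exists (cbox (@thin_size R n.+1 (L / q%:R) q)); split => //.
  exact: normal_domain_cbox.
move=> [f fiso].
have OA x : Omega x -> forall j, `|x ord0 j| <= A.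
  by move=> /OB xB j; apply: le_trans (xB j) _; rewrite /A; have := ler_norm B; lra.
(* The index [lift ord0 ord0] is that of a long side, which exists from dimension two on. *)
have := isometric_embedding_cbox (lift ord0 ord0) s0 fiso OA.
rewrite /thin_size /grid_size liftK [q%:R * _]mulrC divfK ?gt_eqF// /L.
move: (A) A0 => a a0; have n0 : 0 < n.+2%:R :> R by [].
rewrite -[n.+3%:R]natr1; move: (n.+2%:R) n0 => N N0.
have -> : (4 * a * (N + 1) / 2) ^+ 2 = (N + 1) ^+ 2 * (2 * a) ^+ 2 by field.
rewrite ler_pM2r ?exprn_gt0 ?mulr_gt0//; nra.
Qed.

(** * Dimension one *)

Section isometries_of_the_line.
Context {R : realType}.
Local Notation mu := (@lebesgue_measure R).
Implicit Types (A E K S : set R) (f : R -> R) (b t s : R).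

Lemma measurable_translate b :
  measurable_fun setT ((fun t => t + b) : measurableTypeR R -> measurableTypeR R).
Proof. by apply: measurable_funD => //; exact: measurable_cst. Qed.

Lemma lebesgue_measure_translate b A : measurable (A : set (measurableTypeR R)) ->
  mu ((fun t => t + b) @^-1` A) = mu A.
Proof.
move=> mA.
pose nu := pushforward mu ((fun t => t + b) : measurableTypeR R -> measurableTypeR R).
pose nu_m := (measure_function_pushforward__canonical__measure_function_Measure mu (measurable_translate b)).
suff : mu A = (nu_m : {measure set _ -> \bar R}) A by move=> ->.
apply: lebesgue_measure_unique => // _ [[x y]] _ <-.
rewrite /= /pushforward (_ : _ @^-1` _ = `]x - b, y - b]%classic); last first.
  by apply/seteqP; split => t; rewrite /= !in_itv/= ltrBlDr lerBrDr.
rewrite !lebesgue_measure_itv/= !lte_fin ltrD2r; case: ifP => // _.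
by rewrite -!EFinB opprB addrA subrK.
Qed.

Lemma lebesgue_measure_isometry (sg : R) b A : sg = 1 \/ sg = -1 ->
  measurable (A : set (measurableTypeR R)) ->
  measurable ((fun t => sg * t + b) @^-1` A : set (measurableTypeR R)) /\
  mu ((fun t => sg * t + b) @^-1` A) = mu A.
Proof.
move=> sg1 mA; have mT : measurable ((fun t => t + b) @^-1` A : set (measurableTypeR R)).
  by rewrite -[X in measurable X]setTI; exact: measurable_translate.
case: sg1 => ->.
  rewrite (_ : (fun t => 1 * t + b) = (fun t => t + b)); last by apply/funext => t; rewrite mul1r.
  by split => //; exact: lebesgue_measure_translate.
rewrite (_ : _ @^-1` A = -%R @^-1` ((fun t => t + b) @^-1` A)); last first.
  by apply/seteqP; split => t /=; rewrite mulN1r.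
split.
  by rewrite -[X in measurable X]setTI; apply: (@oppr_measurable R setT) => //.
apply: etrans (lebesgue_measure_translate b mA).
exact: (lebesgue_measureN mT).
Qed.

Section locally_isometric.
Variables (K : set R) (f : R -> R).
Hypotheses (cK : compact K) (fK : set_inj K f).
Hypothesis cf : forall t, K t -> {for t, continuous f}.
Hypothesis loc : forall t, K t -> exists sg b, (sg = 1 \/ sg = -1) /\
  \forall u \near t, K u -> f u = sg * u + b.

Let mK : measurable (K : set (measurableTypeR R)).
Proof. by apply: closed_measurable; apply: compact_closed => //; exact: Rhausdorff. Qed.

(** Required of every measurable subset of [A], so that the property passes to unions by splitting a
    subset. *)
Definition image_measure_preserving (A : set R) := forall E, measurable (E : set (measurableTypeR R)) ->
  E `<=` A -> measurable (f @` E : set (measurableTypeR R)) /\ mu (f @` E) = mu E.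

Lemma image_measure_preserving_affine A sg b : sg = 1 \/ sg = -1 ->
  (forall u, A u -> f u = sg * u + b) -> image_measure_preserving A.
Proof.
move=> sg1 fA E mE EA; have sg2 : sg * sg = 1 by case: sg1 => ->; rewrite ?mulr1// mulrNN mulr1.
have -> : f @` E = (fun t => sg * t + (- (sg * b))) @^-1` E.
  apply/seteqP; split => [_ [u Eu <-]|t Et] /=.
    by rewrite (fA _ (EA _ Eu)) mulrDr mulrA sg2 mul1r addrK.
  exists (sg * t + - (sg * b)) => //; rewrite (fA _ (EA _ Et)).
  by rewrite mulrBr !mulrA sg2 !mul1r subrK.
exact: lebesgue_measure_isometry.
Qed.

Lemma image_measure_preservingU A B : A `<=` K -> B `<=` K ->
  measurable (A : set (measurableTypeR R)) ->
  image_measure_preserving A -> image_measure_preserving B -> image_measure_preserving (A `|` B).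
Proof.
move=> AK BK mA pA pB E mE EAB.
have [m1 e1] := pA (E `&` A) (measurableI _ _ mE mA) (@subIsetr _ _ _).
have [m2 e2] := pB (E `\` A) (measurableD mE mA) (fun t Et => match EAB t Et.1 with
  | or_introl h => False_ind _ (Et.2 h) | or_intror h => h end).
have EE : E = (E `&` A) `|` (E `\` A) by rewrite setUIDK.
have fE : f @` E = f @` (E `&` A) `|` f @` (E `\` A) by rewrite -image_setU -EE.
split; first by rewrite fE; exact: measurableU.
have addf : mu (f @` E) = (mu (f @` (E `&` A)) + mu (f @` (E `\` A)))%E.
  rewrite fE measureU//.
  apply/seteqP; split => // y [[u [Eu Au] uy] [w [Ew nAw] wy]].
  apply: nAw; suff <- : u = w by [].
  apply: fK; rewrite ?inE; [exact: AK| |by rewrite uy].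
  by case: (EAB _ Ew) => [/AK|/BK].
have addE : mu E = (mu (E `&` A) + mu (E `\` A))%E.
  rewrite [in LHS]EE measureU//.
  - exact: (measurableI _ _ mE mA).
  - exact: (measurableD mE mA).
  - by rewrite setDE setIACA setICr setI0.
by rewrite addf e1 e2 addE.
Qed.

(* The complements in K of measure preserving sets form a filter, which cannot
   cluster at a point of K. *)
Lemma locally_isometric_measure :
  measurable (f @` K : set (measurableTypeR R)) /\ mu (f @` K) = mu K.
Proof.
pose F : set_system R := [set A | exists B, [/\ measurable (B : set (measurableTypeR R)),
  image_measure_preserving (K `&` B) & forall t, K t -> ~ B t -> A t]].
suff [B [mB pB KB]] : F set0.
  apply: (pB K mK) => t Kt; split => //.
  by apply: contrapT => /(KB _ Kt).
apply: contrapT => F0.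
have FF : ProperFilter F.
  split; first by [].
  split.
  - by exists set0; split => // E mE; rewrite setI0; rewrite subset0 => ->; rewrite image_set0 !measure0.
  - move=> P Q [B [mB pB KB]] [C [mC pC KC]]; exists (B `|` C); split.
    + exact: measurableU.
    + rewrite setIUr; apply: image_measure_preservingU => //; exact: measurableI.
    + by move=> t Kt /not_orP[nB nC]; split; [exact: KB|exact: KC].
  - by move=> P Q PQ [B [mB pB KB]]; exists B; split => // t Kt /(KB _ Kt)/PQ.
have FK : F K.
  exists set0; split => // E mE; rewrite setI0 subset0 => ->.
  by rewrite image_set0 !measure0.
have [t [Kt tF]] := cK FF FK.
have [sg [b [sg1 /nbhs_ballP[r /= r0 rP]]]] := loc Kt.
have : F (~` ball t r).
  exists (ball t r); split.
  - by rewrite ball_itv; exact: measurable_itv.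
  - by apply: (image_measure_preserving_affine sg1) => u [Ku /rP]; exact.
  - by [].
by move=> /tF/(_ (nbhsx_ballx t r r0))[u []].
Qed.

(** The image is compact, so a point of [S] that it misses lies in an open set that it misses; as
    [S] is the closure of its interior, a whole ball of [S] is missed, and [S] would have larger
    measure than [K]. *)
Lemma locally_isometric_surj S : compact S -> S `<=` closure (interior S) ->
  f @` K `<=` S -> (mu S <= mu K)%E -> S `<=` f @` K.
Proof.
move=> cS Sreg fKS SK s Ss.
have cfK : closed (f @` K).
  apply: compact_closed; first exact: Rhausdorff.
  apply: continuous_compact => //; apply: continuous_in_subspaceT => t.
  by rewrite inE => /cf.
apply: contrapT => nfs.
have /Sreg/(_ _ (open_nbhs_nbhs (conj (closed_openC cfK) nfs)))[w [wS wf]] := Ss.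
have N : nbhs w (S `&` ~` (f @` K)).
  exact: (filterI wS (open_nbhs_nbhs (conj (closed_openC cfK) wf))).
have /nbhs_ballP[e /= e0 eP] := N.
have mS : measurable (S : set (measurableTypeR R)).
  by apply: closed_measurable; apply: compact_closed => //; exact: Rhausdorff.
have mB : measurable (ball w e : set (measurableTypeR R)) by rewrite ball_itv; exact: measurable_itv.
have [mfK fKE] := locally_isometric_measure.
have le_fKB : (mu (f @` K `|` ball w e) <= mu S)%E.
  apply: le_measure; rewrite ?inE//; first exact: measurableU.
  by move=> t [/fKS//|/eP[]].
have addB : mu (f @` K `|` ball w e) = (mu K + (e *+ 2)%:E)%E.
  rewrite -fKE -(lebesgue_measure_ball w (ltW e0)); apply: measureU => //.
  by apply/seteqP; split => // t [fKt /eP[_]].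
have Kfin : (mu K < +oo)%E by exact: compact_finite_measure.
have := le_trans le_fKB SK; rewrite addB -[mu K]fineK ?ge0_fin_numE// -EFinD lee_fin.
by rewrite gerDl leNgt pmulrn_lgt0// e0.
Qed.

(** By injectivity [f t] is not in the compact image of [K] minus a ball around [t]. Hence values
    near [f t] are attained inside the ball, where [f] is affine on [K], and so every point near [t]
    belongs to [K]. *)
Lemma locally_isometric_interior S t : S `<=` f @` K -> K t -> nbhs (f t) S -> nbhs t K.
Proof.
move=> SfK Kt Sft; have [sg [b [sg1 /nbhs_ballP[r /= r0 rP]]]] := loc Kt.
have sg2 : sg * sg = 1 by case: sg1 => ->; rewrite ?mulr1// mulrNN mulr1.
pose K1 := K `\` ball t r.
have cK1 : compact K1.
  rewrite /K1 setDE; apply: compact_closedI => //; apply: open_closedC; exact: ball_open.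
have cfK1 : closed (f @` K1).
  apply: compact_closed; first exact: Rhausdorff.
  apply: continuous_compact => //; apply: continuous_in_subspaceT => u.
  by rewrite inE => -[/cf].
have nf : (~` (f @` K1)) (f t).
  move=> [u [Ku nu] fu]; apply: nu.
  have -> : u = t by apply: fK; rewrite ?inE.
  exact: ballxx.
have ft : f t = sg * t + b by apply: rP => //; exact: ballxx.
have N : nbhs (f t) (S `&` ~` (f @` K1)).
  exact: (filterI Sft (open_nbhs_nbhs (conj (closed_openC cfK1) nf))).
have cG : (fun u : R => sg * u + b) @ t --> f t.
  rewrite ft; apply: cvgD; last exact: cvg_cst.
  by apply: cvgM; [exact: cvg_cst|exact: cvg_id].
have NG : nbhs t (fun u => S (sg * u + b) /\ (~` (f @` K1)) (sg * u + b)) by exact: (cG _ N).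
apply: filterS NG => u /= [/SfK[w Kw wE] nK1].
have [wr|wr] := pselect (ball t r w); last by exfalso; apply: nK1; exists w.
suff -> : u = w by [].
have := rP _ wr Kw; rewrite wE => /addIr h.
by rewrite -[u]mul1r -[w]mul1r -sg2 -!mulrA h.
Qed.

End locally_isometric.

End isometries_of_the_line.

(** * One-dimensional normal domains as subsets of the line *)

Section one_dimensional_domains.
Context {R : realType}.
Implicit Types (S : set R) (t u : R) (bs : seq R).

Definition rV1 (t : R) : 'rV[R]_1 := const_mx t.

Lemma rV1E t i j : rV1 t i j = t. Proof. by rewrite mxE. Qed.

Lemma rV1_eta (x : 'rV[R]_1) : rV1 (x ord0 ord0) = x.
Proof. by apply/rowP => i; rewrite rV1E (ord1 i). Qed.

Lemma nbhs_rV1 t (P : set 'rV[R]_1) : nbhs (rV1 t) P <-> nbhs t (fun u => P (rV1 u)).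
Proof.
split=> /nbhs_ballP[e /= e0 eP]; apply/nbhs_ballP; exists e => //=.
  by move=> u tu; apply: eP; apply/rV_ballP => // i; rewrite !rV1E.
move=> x /rV_ballP; rewrite -(rV1_eta x) => /(_ e0 ord0); rewrite !rV1E => tx.
exact: eP.
Qed.

Lemma rV1_continuous : continuous rV1.
Proof. by move=> t P /nbhs_rV1. Qed.

(** Near a boundary point the set is a half-line, and [bs] enumerates the boundary without
    repetition, so that boundary points can be counted by its size. *)
Definition interval_domain S bs : Prop :=
  [/\ S !=set0, compact S,
      forall t, S t -> ~ nbhs t S -> exists sg : R, (sg = 1 \/ sg = -1) /\
        \forall u \near t, S u <-> sg * u <= sg * t,
      uniq bs & forall t, t \in bs <-> S t /\ ~ nbhs t S].

Lemma boundary_rV1 (Omega : set 'rV[R]_1) t : closed Omega ->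
  boundary Omega (rV1 t) <-> Omega (rV1 t) /\ ~ nbhs t (fun u => Omega (rV1 u)).
Proof.
move=> clO; rewrite /boundary -(closure_id _).1//; split=> -[Ot nt]; split => //.
  by move=> /nbhs_rV1.
by move=> /= /nbhs_rV1.
Qed.

Lemma dot_rV1 (x y : 'rV[R]_1) : dot x y = x ord0 ord0 * y ord0 ord0.
Proof. by rewrite /dot big_ord1. Qed.

(** In dimension one the hyperplane is a point and projections vanish, so the graph function is the
    constant [g 0]. Cells of the boundary are images of a [0]-cube, hence single points. *)
Lemma normal_domain_interval (Omega : set 'rV[R]_1) : normal_domain Omega ->
  exists bs, interval_domain (rV1 @^-1` Omega) bs.
Proof.
move=> [[x Ox] cO lO [k [sigma [_ bO _]]]].
have clO : closed Omega by apply: compact_closed => //; exact: norm_hausdorff.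
exists (undup [seq sigma i 0 ord0 ord0 | i <- enum 'I_k]); split.
- by exists (x ord0 ord0); rewrite /= rV1_eta.
- rewrite (_ : _ @^-1` _ = (fun x : 'rV[R]_1 => x ord0 ord0) @` Omega).
    apply: continuous_compact => //; apply: continuous_subspaceT.
    by move=> y; exact: coord_continuous.
  apply/seteqP; split => [t Ot|_ [y Oy <-]] /=; last by rewrite rV1_eta.
  by exists (rV1 t); rewrite ?rV1E.
- move=> t St nSt; have /lO[nu [g [nu1 _ near_g]]] : boundary Omega (rV1 t).
    by apply/boundary_rV1.
  pose sg := nu ord0 ord0; have sg2 : sg * sg = 1 by rewrite -dot_rV1.
  have sg1 : sg = 1 \/ sg = -1.
    have /eqP : sg ^+ 2 = 1 by rewrite expr2.
    by rewrite sqrf_eq1 => /orP[/eqP|/eqP]; [left|right].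
  exists sg; split => //.
  have proj0 y : y - dot y nu *: nu = 0.
    by apply/rowP => i; rewrite !mxE (ord1 i) dot_rV1 -/sg -mulrA sg2 mulr1 subrr.
  have near_t : \forall u \near t, Omega (rV1 u) <-> sg * u <= g 0.
    move/nbhs_rV1: near_g; apply: filterS => u ->.
    by rewrite proj0 dot_rV1 rV1E mulrC.
  (* A strict inequality at [t] would persist nearby and make [t] an interior point. *)
  suff <- : g 0 = sg * t by [].
  have := (nbhs_singleton near_t).1 St; rewrite le_eqVlt => /orP[/eqP//|lt].
  exfalso; apply: nSt.
  have c : (fun u : R => sg * u) @ t --> sg * t by apply: cvgM; [exact: cvg_cst|exact: cvg_id].
  have lt_near : \forall u \near t, sg * u < g 0 by exact: (c _ (lt_nbhsl lt)).
  by apply: filterS2 near_t lt_near => u h /ltW/h.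
- exact: undup_uniq.
- move=> t; apply: iff_trans (_ : boundary Omega (rV1 t) <-> _); last exact: boundary_rV1.
  rewrite mem_undup bO.
  split=> [/mapP[i _ ->]|[i _ [u _ ut]]].
    by exists i => //; exists 0; [case|rewrite rV1_eta].
  apply/mapP; exists i; first by rewrite mem_enum.
  by rewrite (_ : 0 = u) ?ut ?rV1E// [u]thinmx0.
Qed.

Lemma interval_normal_domain S bs : interval_domain S bs ->
  normal_domain [set x : 'rV[R]_1 | S (x ord0 ord0)].
Proof.
move=> [[t0 St0] cS hS ubs bsP]; set Omega := [set x | _].
have OE t : Omega (rV1 t) = S t by rewrite /Omega /= rV1E.
have OE' : (fun u => Omega (rV1 u)) = S by apply/funext.
have cO : compact Omega.
  rewrite (_ : Omega = rV1 @` S).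
    apply: continuous_compact => //; apply: continuous_subspaceT; exact: rV1_continuous.
  apply/seteqP; split => [x Sx|_ [t St <-]]; last by rewrite OE.
  by exists (x ord0 ord0) => //; exact: rV1_eta.
have clO : closed Omega by apply: compact_closed => //; exact: norm_hausdorff.
have bO x : boundary Omega x <-> x ord0 ord0 \in bs.
  by rewrite -[x in boundary _ x]rV1_eta boundary_rV1// OE OE' bsP.
split => //; first by exists (rV1 t0); rewrite OE.
- move=> p /bO/bsP[Sp nSp]; have [sg [sg1 near_sg]] := hS _ Sp nSp.
  have sg2 : sg * sg = 1 by case: sg1 => ->; rewrite ?mulr1// mulrNN mulr1.
  exists (rV1 sg), (cst (sg * p ord0 ord0)); split.
  + by rewrite dot_rV1 !rV1E.
  + exists 0; split; first exact: real0.
    by move=> M M0 [x y] _ /=; rewrite subrr normr0 mulr_ge0// ltW.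
  + suff : nbhs (rV1 (p ord0 ord0)) (fun x => Omega x <-> dot x (rV1 sg) <=
        cst (sg * p ord0 ord0) (x - dot x (rV1 sg) *: rV1 sg)) by rewrite {1}rV1_eta.
    apply/nbhs_rV1; apply: filterS near_sg => u Su.
    by rewrite OE dot_rV1 !rV1E mulrC.
- exists (size bs), (fun i (t : 'rV[R]_0) => t *m (0 : 'M[R]_(0, 1)) + rV1 (nth 0 bs i)).
  have sE i (t : 'rV[R]_0) : t *m (0 : 'M[R]_(0, 1)) + rV1 (nth 0 bs i) = rV1 (nth 0 bs i).
    by rewrite mulmx0 add0r.
  split.
  + by move=> i; apply: smooth_cell_affine => v _; exact: thinmx0.
  + apply/seteqP; split => [x /bO/(nthP 0)[i ib xE]|x [i _ [u _ <-]]].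
      exists (Ordinal ib) => //; exists 0; first by case.
      by rewrite sE/= xE rV1_eta.
    by apply/bO; rewrite sE rV1E mem_nth.
  + move=> i j ij; apply/seteqP; split => // x [[u _ ux] [v _ vx]].
    move: ux vx; rewrite !sE => <- /(congr1 (fun M : 'rV[R]_1 => M ord0 ord0)).
    rewrite !rV1E => /eqP; rewrite nth_uniq// => /eqP ji.
    by move/eqP: ij; apply; apply/val_inj.
Qed.

End one_dimensional_domains.

(** * Isometric embeddings of one-dimensional domains *)

Section line_rigidity.
Context {R : realType}.
Implicit Types (S : set R) (t u : R) (bs : seq R).

Lemma interval_domain_closure_interior S bs : interval_domain S bs ->
  S `<=` closure (interior S).
Proof.
move=> [_ _ hS _ _] t St; have [tI|tI] := pselect (nbhs t S); first exact: subset_closure.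
have [sg [sg1 near_sg]] := hS t St tI.
have sgn u : `|sg * u| = `|u| by rewrite normrM; case: sg1 => ->; rewrite ?normrN normr1 mul1r.
have sg2 : sg * sg = 1 by case: sg1 => ->; rewrite ?mulr1// mulrNN mulr1.
move=> B tB; have /nbhs_ballP[r /= r0 rP] : nbhs t (fun u => B u /\ (S u <-> sg * u <= sg * t)).
  exact: filterI tB near_sg.
have r2 : 0 < r / 2 by rewrite divr_gt0.
pose w := t - sg * (r / 2).
have tw u : `|w - u| < r / 2 -> ball t r u.
  move=> wu; rewrite /ball /= (_ : t - u = (w - u) + sg * (r / 2)); last by rewrite /w; ring.
  apply: le_lt_trans (ler_normD _ _) _; rewrite sgn [`|r / 2|]gtr0_norm//; lra.
have w0 : `|w - w| < r / 2 by rewrite subrr normr0.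
exists w; split; last by case: (rP _ (tw _ w0)).
apply/nbhs_ballP; exists (r / 2) => //= u wu; apply: (rP _ (tw _ wu)).2.2.
have : sg * (u - w) < r / 2.
  by apply: le_lt_trans (ler_norm _) _; rewrite sgn distrC.
have -> : sg * (u - w) = sg * u - sg * t + sg * sg * (r / 2) by rewrite /w; ring.
by rewrite sg2 mul1r; lra.
Qed.

(** Lets the mean value theorem be applied inside the domain up to its boundary points. *)
Lemma interval_domain_locally_convex S bs t : interval_domain S bs -> S t ->
  exists2 r, 0 < r & forall u w, ball t r u -> S u ->
    (t <= w <= u) || (u <= w <= t) -> ball t r w /\ S w.
Proof.
move=> [_ _ hS _ _] St.
have between r u w : ball t r u -> (t <= w <= u) || (u <= w <= t) -> ball t r w.
  rewrite /ball /= !ltr_norml => /andP[tu1 tu2] /orP[|] /andP[w1 w2].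
    by apply/andP; split; lra.
  by apply/andP; split; lra.
have [/nbhs_ballP[r /= r0 rS]|tI] := pselect (nbhs t S).
  by exists r => // u w tu Su /(between _ _ _ tu) tw; split => //; exact: rS.
have [sg [sg1 /nbhs_ballP[r /= r0 rP]]] := hS t St tI.
exists r => // u w tu Su uw; have tw := between _ _ _ tu uw; split => //.
apply/(rP _ tw); have := (rP _ tu).1 Su.
by case: sg1 => ->; rewrite ?mulN1r ?mul1r; case/orP: uw => /andP[w1 w2]; lra.
Qed.

Variables (S' S : set R) (bs' bs : seq R) (Omega : set 'rV[R]_1) (f : 'rV[R]_1 -> 'rV[R]_1).
Hypotheses (domS' : interval_domain S' bs') (domS : interval_domain S bs).
Hypothesis SE : S = rV1 @^-1` Omega.
Hypothesis fiso : isometric_embedding [set x : 'rV[R]_1 | S' (x ord0 ord0)] Omega f.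

Let phi t : R := coord_fun f ord0 (rV1 t).

Let phi_inj : set_inj S' phi.
Proof.
move=> t u /set_mem St /set_mem Su tu; have [_ finj _ _] := fiso.
have /(congr1 (fun x : 'rV[R]_1 => x ord0 ord0)) : rV1 t = rV1 u.
  apply: finj; rewrite ?inE /= ?rV1E//.
  by rewrite -[LHS]rV1_eta -[RHS]rV1_eta; congr rV1.
by rewrite !rV1E.
Qed.

Let phi_in t : S' t -> S (phi t).
Proof.
move=> St; have [_ _ fO _] := fiso; rewrite SE /= rV1_eta.
by apply: fO; exists (rV1 t) => //=; rewrite rV1E.
Qed.

Let line_rV1 h t : h *: delta_mx ord0 ord0 + rV1 t = rV1 (h + t) :> 'rV[R]_1.
Proof. by apply/rowP => i; rewrite !mxE (ord1 i) !eqxx mulr1. Qed.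

Let phi_continuous t : S' t -> {for t, continuous phi}.
Proof.
move=> St; have [[U [oU OU sf]] _ _ _] := fiso.
apply: (@continuous_comp _ _ _ rV1 (coord_fun f ord0)); first exact: rV1_continuous.
apply: (@continuous_partials_coord _ _ _ U f oU sf [::]).
by apply: OU; rewrite /= rV1E.
Qed.

(** The derivative is continuous with values [1] and [-1] on the domain, hence constant there near
    [t]; the mean value theorem on the segment between [t] and [u] makes [phi] affine. *)
Let phi_locally_isometric t : S' t -> exists sg b, (sg = 1 \/ sg = -1) /\
  \forall u \near t, S' u -> phi u = sg * u + b.
Proof.
move=> St; have [[U [oU OU sf]] _ _ isof] := fiso.
have SU u : S' u -> U (rV1 u) by move=> Su; apply: OU; rewrite /= rV1E.
pose D u : R := partials [:: ord0] (coord_fun f ord0) (rV1 u).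
have D2 u : S' u -> D u * D u = 1.
  move=> Su; have := isometry_gram oU sf OU isof ord0 ord0 (_ : [set x : 'rV[R]_1 | S' (x ord0 ord0)] (rV1 u)).
  by rewrite big_ord1 eqxx; apply; rewrite /= rV1E.
have D1 u : S' u -> D u = 1 \/ D u = -1.
  by move=> /D2 /eqP; rewrite -expr2 sqrf_eq1 => /orP[/eqP|/eqP]; [left|right].
have cD : {for t, continuous D}.
  apply: (@continuous_comp _ _ _ rV1 (partials [:: ord0] (coord_fun f ord0))).
    exact: rV1_continuous.
  exact: (@continuous_partials_coord _ _ _ U f oU sf [:: ord0] _ _ (SU _ St)).
have Dt : \forall u \near t, S' u -> D u = D t.
  have : \forall u \near t, `|D t - D u| < 1 by move/cvgrPdist_lt : cD; apply.
  apply: filterS => u lt Su; move: lt.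
  by case: (D1 _ St) => ->; case: (D1 _ Su) => -> //; rewrite ?opprK ltr_norml; lra.
have /nbhs_ballP[r1 /= r10 r1P] := Dt.
have [r2 r20 r2P] := interval_domain_locally_convex domS' St.
exists (D t), (phi t - D t * t); split; first exact: D1.
pose r := Num.min r1 r2; have r0 : 0 < r by rewrite lt_min r10.
apply/nbhs_ballP; exists r => //= u; rewrite /ball /= lt_min => /andP[tu1 tu2] Su.
have seg w : (t <= w <= u) || (u <= w <= t) -> S' w /\ D w = D t.
  move=> uw; have [tw Sw] := r2P _ _ tu2 Su uw; split => //; apply: r1P => //.
  move: tu1; rewrite /ball /= !ltr_norml => /andP[h1 h2].
  by case/orP: uw => /andP[w1 w2]; apply/andP; split; lra.
have der w v : U (rV1 w) -> derivable (coord_fun f ord0) (rV1 w) v.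
  by move=> Uw; exact: (@derivable_partials_coord _ _ _ U f oU sf [::]).
have mvt a b : a < b -> (forall w, a <= w <= b -> S' w /\ D w = D t) ->
    phi b - phi a = (b - a) * D t.
  move=> ab abP; have ba : 0 < b - a by rewrite subr_gt0.
  have [|s sab] := @derive_line_MVT _ _ (coord_fun f ord0)
      (delta_mx ord0 ord0) (rV1 a) (b - a) ba.
    move=> s sab; rewrite line_rV1; apply: der; apply: SU.
    by apply: (abP _ _).1; case/andP: sab => s1 s2; apply/andP; split; lra.
  rewrite !line_rV1 subrK -[_ - _]/(phi b - phi a) => ->; congr (_ * _).
  rewrite -[LHS]/(D (s + a)); apply: (abP _ _).2.
  by case/andP: sab => s1 s2; apply/andP; split; lra.
have [ut|tu|->] := ltgtP u t; last by rewrite addrC subrK.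
  have := mvt u t ut (fun w h => seg w (introT orP (or_intror h))); lra.
have := mvt t u tu (fun w h => seg w (introT orP (or_introl h))); lra.
Qed.

(** The map is onto by [locally_isometric_surj], so it cannot send a boundary point of [S'] to an
    interior point of [S]; injectivity then compares the numbers of boundary points. *)
Lemma isometric_embedding_boundary : (@lebesgue_measure R S <= @lebesgue_measure R S')%E ->
  (size bs' <= size bs)%N.
Proof.
move=> SS'; have [_ cS' _ ubs' bsP'] := domS'; have [_ cS _ _ bsP] := domS.
have Sphi : S `<=` phi @` S'.
  apply: (locally_isometric_surj cS' phi_inj phi_continuous phi_locally_isometric cS) => //.
    exact: interval_domain_closure_interior domS.
  by move=> _ [t St <-]; exact: phi_in.
rewrite -(size_map phi); apply: uniq_leq_size.
  rewrite map_inj_in_uniq// => t u /bsP'[St _] /bsP'[Su _].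
  by apply: phi_inj; rewrite inE.
move=> _ /mapP[t /bsP'[St nSt] ->]; apply/bsP; split; first exact: phi_in.
move=> h; apply: nSt; apply: (locally_isometric_interior cS' phi_inj _ _ Sphi) h => //.
Qed.

End line_rigidity.

(** * Cutting a one-dimensional domain *)

Section cut.
Context {R : realType}.
Variables (S : set R) (a : R).

(** The cut point is kept in both pieces, as [a] and as [a + 1], so that the result is closed. *)
Definition cut : set R := [set t | t <= a /\ S t \/ a + 1 <= t /\ S (t - 1)].

Definition cut_boundary (bs : seq R) : seq R :=
  [seq b <- bs | b < a] ++ [seq b + 1 | b <- bs & a < b] ++ [:: a; a + 1].

Lemma size_cut_boundary bs : a \notin bs -> size (cut_boundary bs) = (size bs + 2)%N.
Proof.
rewrite !size_cat size_map /= addnA => abs; congr (_ + _)%N.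
elim: bs abs => //= b bs ih; rewrite inE negb_or => /andP[ab /ih]; case: (ltgtP b a) ab => //= _ _ <-; by rewrite ?addSn ?addnS.
Qed.

Lemma near_cut_lt t : t < a -> \forall u \near t, cut u <-> S u.
Proof.
move=> ta; near=> u; have ua : u < a by near: u; exact: lt_nbhsl.
split=> [[[]//|[h _]]|Su]; first by exfalso; clear -ua h; lra.
by left; rewrite ltW.
Unshelve. all: by end_near.
Qed.

Lemma nbhs_shift (P : set R) t : nbhs t (fun u => P (u - 1)) <-> nbhs (t - 1) P.
Proof.
split=> /nbhs_ballP[r /= r0 rP]; apply/nbhs_ballP; exists r => // u; rewrite /ball /= => tu.
  rewrite (_ : u = u + 1 - 1); last by rewrite addrK.
  by apply: rP; rewrite /ball /= (_ : t - (u + 1) = t - 1 - u)//; ring.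
by apply: rP; rewrite /ball /= (_ : t - 1 - (u - 1) = t - u)//; ring.
Qed.

Lemma near_cut_gt t : a + 1 < t -> \forall u \near t, cut u <-> S (u - 1).
Proof.
move=> ta; near=> u; have ua : a + 1 < u by near: u; exact: lt_nbhsr.
split=> [[[h _]|[]//]|Su]; first by exfalso; move: ua; apply/negP; rewrite -leNgt; lra.
by right; rewrite ltW.
Unshelve. all: by end_near.
Qed.

Hypothesis Sa : nbhs a S.

Lemma near_cut_left : \forall u \near a, cut u <-> u <= a.
Proof.
near=> u; have ua : u < a + 1 by near: u; apply: lt_nbhsl; lra.
have Su : S u by near: u.
split=> [[[]//|[h _]]|ua']; last by left.
by move: ua; rewrite ltNge h.
Unshelve. all: by end_near.
Qed.

Lemma near_cut_right : \forall u \near (a + 1), cut u <-> a + 1 <= u.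
Proof.
have Sa1 : nbhs (a + 1) (fun u => S (u - 1)) by apply/nbhs_shift; rewrite addrK.
near=> u; have ua : a < u by near: u; apply: lt_nbhsr; lra.
have Su : S (u - 1) by near: u.
split=> [[[h _]|[]//]|ua']; last by right.
by move: ua; rewrite ltNge h.
Unshelve. all: by end_near.
Qed.

Lemma cut_gap t : a < t < a + 1 -> ~ cut t.
Proof. by move=> /andP[h1 h2] [[h _]|[h _]]; lra. Qed.

Lemma near_iff_nbhs (P Q : set R) t : (\forall u \near t, P u <-> Q u) ->
  (P t <-> Q t) /\ (nbhs t P <-> nbhs t Q).
Proof.
move=> PQ; split; first exact: nbhs_singleton PQ.
by split=> h; apply: filterS2 PQ h => u h1 h2; apply/h1.
Qed.

Lemma not_nbhs_le t : ~ nbhs t (fun u : R => u <= t).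
Proof.
move=> /nbhs_ballP[r /= r0 rP]; have := rP (t + r / 2).
rewrite /ball /= opprD addrA subrr sub0r normrN gtr0_norm ?divr_gt0// => h.
have : t + r / 2 <= t by apply: h; lra.
lra.
Qed.

Lemma not_nbhs_ge t : ~ nbhs t (fun u : R => t <= u).
Proof.
move=> /nbhs_ballP[r /= r0 rP]; have := rP (t - r / 2).
rewrite /ball /= opprB addrC subrK gtr0_norm ?divr_gt0// => h.
have : t <= t - r / 2 by apply: h; lra.
lra.
Qed.

Lemma interval_domain_cut bs : interval_domain S bs ->
  interval_domain cut (cut_boundary bs).
Proof.
move=> [_ cS hS ubs bsP]; have clS : closed S by apply: compact_closed => //; exact: Rhausdorff.
split.
- by exists a; left; rewrite lexx; split => //; exact: nbhs_singleton Sa.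
- rewrite (_ : cut = (S `&` [set t | t <= a]) `|` (fun t => t + 1) @` (S `&` [set t | a <= t])).
    apply: compactU; first by apply: compact_closedI => //; exact: closed_le.
    apply: continuous_compact; last by apply: compact_closedI => //; exact: closed_ge.
    apply: continuous_subspaceT => t; apply: cvgD; [exact: cvg_id|exact: cvg_cst].
  apply/seteqP; split => t.
    by case=> -[h1 h2]; [left|right; exists (t - 1); rewrite ?subrK//; split => //=; lra].
  by case=> [[h1 h2]|[u [Su /= au] <-]]; [left|right; rewrite addrK; split => //; lra].
- move=> t Ct nCt; have [ta|ta|ta] := ltgtP t a.
  + have near_t := near_cut_lt ta; have [e1 e2] := near_iff_nbhs near_t.
    have [||sg [sg1 near_sg]] := hS t; [exact/e1|by move=> /e2|].
    exists sg; split => //; apply: filterS2 near_t near_sg => u h1 h2.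
    exact: iff_trans h1 h2.
  + have [ta1|ta1|ta1] := ltgtP t (a + 1).
    * by exfalso; apply: (@cut_gap t); rewrite ?ta.
    * have near_t := near_cut_gt ta1; have [e1 e2] := near_iff_nbhs near_t.
      have [||sg [sg1 near_sg]] := hS (t - 1); [exact/e1|by move=> h; apply: nCt; apply/e2; apply/nbhs_shift|].
      exists sg; split => //; move: ((nbhs_shift _ t).2 near_sg); apply: filterS2 near_t => u h1 h2.
      apply: iff_trans h1 (iff_trans h2 _).
      by rewrite !mulrBr lerBlDr subrK.
    * exists (-1); split; first by right.
      rewrite ta1; apply: filterS near_cut_right => u h; rewrite h !mulN1r lerN2.
      by [].
  + exists 1; split; first by left.
    by rewrite ta; apply: filterS near_cut_left => u h; rewrite h !mul1r.
- rewrite /cut_boundary !cat_uniq filter_uniq//= map_inj_uniq ?filter_uniq//; last exact: addIr.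
  rewrite !inE; apply/and5P; split => //.
  + rewrite has_cat negb_or /= !mem_filter ltxx /= orbF; apply/andP; split.
      apply/hasPn => x /mapP[b]; rewrite mem_filter => /andP[ab _] ->.
      by rewrite mem_filter negb_and -leNgt; apply/orP; left; lra.
    by rewrite negb_and -leNgt lerDl ler01.
  + rewrite orbF negb_or; apply/andP; split; apply/negP => /mapP[b].
      by rewrite mem_filter => /andP[ab _]; lra.
    by rewrite mem_filter => /andP[ab _] /addIr ba; rewrite ba ltxx in ab.
  + by apply/eqP; lra.
move=> t; rewrite !mem_cat mem_filter !inE.
have shift_mem : (t \in [seq b + 1 | b <- bs & a < b]) = (a + 1 < t) && (t - 1 \in bs).
  apply/mapP/andP => [[b]|[h1 h2]].
    by rewrite mem_filter => /andP[ab bbs] ->; rewrite ltrD2r addrK.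
  by exists (t - 1); rewrite ?subrK// mem_filter h2 andbT ltrBrDr.
rewrite shift_mem; have [ta|ta|ta] := ltgtP t a.
- have -> : (a + 1 < t) = false by apply/negbTE; rewrite -leNgt; lra.
  have -> : (t == a + 1) = false by apply/eqP => h; lra.
  have [e1 e2] := near_iff_nbhs (near_cut_lt ta).
  rewrite /= !orbF; apply: iff_trans (bsP t) _.
  by split=> -[h1 h2]; split; [exact/e1|by move=> /e2|exact/e1|by move=> /e2].
- rewrite /=; have [ta1|ta1|ta1] := ltgtP t (a + 1).
  + by split => // -[/cut_gap]; rewrite ta ta1 => /(_ isT).
  + have [e1 e2] := near_iff_nbhs (near_cut_gt ta1).
    rewrite /= orbF; apply: iff_trans (bsP (t - 1)) _.
    split=> -[h1 h2]; split; [exact/e1|by move=> /e2/nbhs_shift|exact/e1|].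
    by move=> h; apply: h2; apply/e2; apply/nbhs_shift.
  + rewrite /=; split => // _; rewrite ta1; have [e1 e2] := near_iff_nbhs near_cut_right.
    by split; [exact/e1|move=> /e2; exact: not_nbhs_ge].
- rewrite /= orbT; split => // _; rewrite ta; have [e1 e2] := near_iff_nbhs near_cut_left.
  by split; [exact/e1|move=> /e2; exact: not_nbhs_le].
Qed.

(** [S] is the disjoint union of the parts in []-oo, a]] and in []a, +oo[]. Moving the second by [1]
    keeps its measure and the disjointness, and the result lies in [cut]. *)
Lemma lebesgue_measure_cut : compact S ->
  (@lebesgue_measure R S <= @lebesgue_measure R cut)%E.
Proof.
move=> cS; have clS : closed S by apply: compact_closed => //; exact: Rhausdorff.
have mS : measurable (S : set (measurableTypeR R)) by exact: closed_measurable.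
pose A : set (measurableTypeR R) := S `&` `]-oo, a]%classic.
pose B : set (measurableTypeR R) := S `&` `]a, +oo[%classic.
have mA : measurable A by apply: measurableI => //; exact: measurable_itv.
have mB : measurable B by apply: measurableI => //; exact: measurable_itv.
pose B1 : set (measurableTypeR R) := (fun t => t + (-1)) @^-1` B.
have mB1 : measurable B1 by rewrite -[X in measurable X]setTI; exact: measurable_translate.
have SAB : S = A `|` B.
  rewrite /A /B -setIUr (_ : _ `|` _ = setT) ?setIT//.
  by apply/seteqP; split => // t _; rewrite /= !in_itv/= andbT; case: (leP t a); [left|right].
have sep (t : R) : t <= a -> a < t -> False by move=> ta; rewrite ltNge ta.
have sep1 (t : R) : t <= a -> a < t + (-1) -> False.
  by move=> ta at1; apply: sep ta _; apply: lt_trans at1 _; rewrite gtrBl.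
have shift_le (t : R) : (a + 1 <= t) = (a <= t + (-1)) by rewrite lerBrDr.
have -> : lebesgue_measure S = lebesgue_measure (A `|` B1).
  rewrite {1}SAB !measureU//.
  - by congr (_ + _)%E; exact/esym/lebesgue_measure_translate.
  - apply/seteqP; split => // t [[_]]; rewrite /= in_itv/= => ta [_] /=.
    by rewrite in_itv/= andbT => /(sep1 _ ta).
  - apply/seteqP; split => // t [[_]]; rewrite /= in_itv/= => ta [_] /=.
    by rewrite in_itv/= andbT => /(sep _ ta).
apply: le_measure; rewrite ?inE.
- exact: measurableU.
- rewrite (_ : cut = A `|` (fun t => t + (-1)) @^-1` (S `&` `[a, +oo[%classic)).
    apply: measurableU => //; rewrite -[X in measurable X]setTI; apply: measurable_translate => //.
    by apply: measurableI => //; exact: measurable_itv.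
  apply/seteqP; split => t.
    case=> -[h1 h2]; [left|right]; split => //; rewrite /= in_itv//=.
    by rewrite -shift_le h1.
  case=> [[St]|[St]]; rewrite /= in_itv/= ?andbT => h; [by left|right; split => //].
  by rewrite shift_le.
- move=> t [[St]|[St]]; rewrite /= in_itv/= ?andbT => h; [by left|right; split => //].
  by rewrite shift_le ltW.
Qed.

End cut.

(** * Integrals on the line *)

Section integrals_on_the_line.
Context {R : realType}.

Lemma integral_R_translate (b : R) (h : R -> R) : bsupp1 h -> (forall t, 0 <= h t) ->
  integral_R (fun t => h (t + b)) = integral_R h.
Proof.
move=> [mh _] h0; rewrite /integral_R /Rintegral; congr fine.
have := @ge0_integral_pushforward _ _ _ _ R _ (measurable_translate b)
  (@lebesgue_measure R) setT (EFin \o h) measurableT.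
rewrite preimage_setT => <-.
- apply: eq_measure_integral; first by move=> mT A mA; exact: measurable_translate.
  by move=> mphi A mA _; exact: lebesgue_measure_translate.
- exact/measurable_EFinP.
- by move=> t _; rewrite /= lee_fin.
Qed.

Lemma integral_rV1 (h : 'rV[R]_1 -> R) : bsupp h ->
  integral_rV h = integral_R (fun t => h (rV1 t)).
Proof.
move=> bh; rewrite integral_rV_slice//; congr integral_R; apply/funext => t.
rewrite integral_rV0; congr h; apply/rowP => i.
by rewrite (ord1 i) rV_cons0 rV1E.
Qed.

Lemma bsupp1_rV1 (h : 'rV[R]_1 -> R) : bsupp h -> bsupp1 (fun t => h (rV1 t)).
Proof.
move=> bh; have := bsupp1_slice bh 0.
rewrite (_ : (fun t => h (rV_cons (0, t))) = fun t => h (rV1 t))//.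
by apply/funext => t; congr h; apply/rowP => i; rewrite (ord1 i) rV_cons0 rV1E.
Qed.

Lemma differentiable_rV1 (F : 'rV[R]_1 -> R) x : derivable F x (delta_mx ord0 ord0) ->
  differentiable F x.
Proof.
move=> dF; pose G (t : R) := F (rV1 t).
have FG : F = G \o (fun x : 'rV[R]_1 => x ord0 ord0).
  by apply/funext => y; rewrite /G /= rV1_eta.
rewrite FG; apply: differentiable_comp; first exact: differentiable_coord.
apply/derivable1_diffP; have [|_ <-//] := @derive_line R 1 F G (delta_mx ord0 ord0) x (x ord0 ord0).
move=> h; rewrite /G; congr F; apply/rowP => i.
by rewrite (ord1 i) rV1E !mxE !eqxx mulr1.
Qed.

End integrals_on_the_line.

(** * Transplantation of test functions *)

Section transplantation.
Context {R : realType}.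
Variables (Omega : set 'rV[R]_1) (a : R).
Hypotheses (cOmega : compact Omega) (Oa : nbhs (rV1 a) Omega).

Let S : set R := rV1 @^-1` Omega.
Let Sa : nbhs a S. Proof. by move/nbhs_rV1 : Oa. Qed.

Definition cut_domain : set 'rV[R]_1 := [set x | cut S a (x ord0 ord0)].

Local Notation Omega' := cut_domain.
Hypothesis cOmega' : compact Omega'.

(** Sends [Omega] back into the cut domain. It jumps at [a], which is harmless in [psi \o glue]
    since test functions of the cut domain vanish near [a] and near [a + 1]. *)
Definition glue (x : 'rV[R]_1) : 'rV[R]_1 := if x ord0 ord0 <= a then x else rV1 1 + x.

Local Notation D := (test_function Omega).
Local Notation D' := (test_function Omega').

Lemma interior_cut_domain t : interior Omega' (rV1 t) <-> nbhs t (cut S a).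
Proof.
rewrite /interior /=; apply: iff_trans (nbhs_rV1 _ _) _.
by rewrite (_ : (fun u => Omega' (rV1 u)) = cut S a)//; apply/funext => u; rewrite /Omega' /= rV1E.
Qed.

(** No point of [[a, a + 1]] is interior to the cut domain: the open interval is a gap, and its ends
    are boundary points. *)
Lemma test_cut_near0 psi t : D' psi -> a <= t <= a + 1 -> \forall x \near rV1 t, psi x = 0.
Proof.
move=> tpsi /andP[at0 at1]; apply: (test_near0 tpsi) => /interior_cut_domain.
have [ta|ta|ta] := ltgtP t a.
- by move: at0; rewrite leNgt ta.
- have [ta1|ta1|ta1] := ltgtP t (a + 1).
  + by move=> /nbhs_singleton; apply: cut_gap; rewrite ta ta1.
  + by move: at1; rewrite leNgt ta1.
  + by rewrite ta1 => /(near_iff_nbhs (near_cut_right Sa)).2; exact: not_nbhs_ge.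
- by rewrite ta => /(near_iff_nbhs (near_cut_left Sa)).2; exact: not_nbhs_le.
Qed.

Lemma near_shift_rV1 (P : set 'rV[R]_1) (x : 'rV[R]_1) :
  nbhs (rV1 1 + x) P -> nbhs x (fun y => P (rV1 1 + y)).
Proof.
move=> /nbhs_ballP[e /= e0 eP]; apply/nbhs_ballP; exists e => // y xy; apply: eP.
have /rV_ballP h := xy; apply/rV_ballP => // i.
by rewrite mxE [in X in _ - X]mxE opprD addrACA subrr add0r; exact: h.
Qed.

Lemma near_glue_lt (x : 'rV[R]_1) : x ord0 ord0 < a -> \forall y \near x, glue y = y.
Proof.
move=> xa; have h : nbhs x (fun y : 'rV[R]_1 => forall i, y ord0 i < a).
  by apply: (@near_coord _ 0 x (fun _ t => t < a)) => i; rewrite (ord1 i); exact: lt_nbhsl.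
apply: filterS h => y /(_ ord0) ya.
by rewrite /glue ltW.
Qed.

Lemma near_glue_gt (x : 'rV[R]_1) : a < x ord0 ord0 -> \forall y \near x, glue y = rV1 1 + y.
Proof.
move=> xa; have h : nbhs x (fun y : 'rV[R]_1 => forall i, a < y ord0 i).
  by apply: (@near_coord _ 0 x (fun _ t => a < t)) => i; rewrite (ord1 i); exact: lt_nbhsr.
apply: filterS h => y /(_ ord0) ya.
by rewrite /glue leNgt ya.
Qed.

Lemma near_glue_eq psi (x : 'rV[R]_1) : D' psi -> x ord0 ord0 = a -> \forall y \near x, psi (glue y) = 0.
Proof.
move=> tpsi xa; have h1 : \forall y \near x, psi y = 0.
  by rewrite -(rV1_eta x) xa; apply: test_cut_near0 => //; rewrite lexx lerDl ler01.
have h2 : \forall y \near x, psi (rV1 1 + y) = 0.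
  apply: (@near_shift_rV1 (fun y => psi y = 0)).
  rewrite (_ : rV1 1 + x = rV1 (a + 1)); last first.
    by apply/rowP => i; rewrite !mxE (ord1 i) xa addrC.
  by apply: test_cut_near0 => //; rewrite lexx lerDl ler01.
by apply: filterS2 h1 h2 => y y1 y2; rewrite /glue; case: ifP.
Qed.

Lemma near_glue psi (x : 'rV[R]_1) : D' psi ->
  [\/ \forall y \near x, psi (glue y) = psi y /\ glue y = y,
      \forall y \near x, psi (glue y) = psi (rV1 1 + y) /\ glue y = rV1 1 + y |
      (\forall y \near x, psi (glue y) = 0) /\ glue x = x /\ \forall y \near x, psi y = 0].
Proof.
move=> tpsi; have [xa|xa|xa] := ltgtP (x ord0 ord0) a.
- by apply: Or31; apply: filterS (near_glue_lt xa) => y ->.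
- by apply: Or32; apply: filterS (near_glue_gt xa) => y ->.
- apply: Or33; split; first exact: near_glue_eq.
  split; first by rewrite /glue xa lexx.
  by rewrite -(rV1_eta x) xa; apply: test_cut_near0 => //; rewrite lexx lerDl ler01.
Qed.

Lemma glue_derive psi (x : 'rV[R]_1) : D' psi ->
  derivable (psi \o glue) x (delta_mx ord0 ord0) /\
  'D_(delta_mx ord0 ord0) (psi \o glue) x = 'D_(delta_mx ord0 ord0) psi (glue x).
Proof.
move=> tpsi; have [spsi _] := tpsi.
have dpsi y : derivable psi y (delta_mx ord0 ord0) by exact: smooth_derivable.
have [h|h|[h [gx h']]] := near_glue x tpsi.
- have hs : \near x, (psi \o glue) x = psi x by apply: filterS h => y [].
  split; first by apply: near_eq_derivable (dpsi x); apply: filterS hs => y ->.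
  by rewrite (near_eq_derive _ hs) (nbhs_singleton h).2.
- have hs : \near x, (psi \o glue) x = psi (rV1 1 + x) by apply: filterS h => y [].
  split.
    apply: (@near_eq_derivable _ _ _ (fun y => psi (rV1 1 + y))); first by apply: filterS hs => y ->.
    exact: derivable_shift.
  by rewrite (near_eq_derive _ hs) derive_shift (nbhs_singleton h).2.
- have hs : \near x, (psi \o glue) x = cst (0 : R) x by apply: filterS h.
  have hs' : \near x, psi x = cst (0 : R) x by apply: filterS h'.
  split.
    by apply: (@near_eq_derivable _ _ _ (cst (0 : R))); [apply: filterS hs => y ->|exact: derivable_cst].
  by rewrite gx (near_eq_derive _ hs) (near_eq_derive _ hs').
Qed.

Lemma glue_pderiv psi i : D' psi -> pderiv i (psi \o glue) = pderiv i psi \o glue.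
Proof.
by move=> tpsi; apply/funext => x; rewrite /pderiv (ord1 i) /= (glue_derive x tpsi).2.
Qed.

(** Composition with [glue] commutes with partial derivatives, so the functions [psi \o glue] form a
    class stable under differentiation, as [smooth_on_coind] requires. *)
Lemma test_glue psi : D' psi -> D (psi \o glue).
Proof.
move=> tpsi; split.
  apply: (@smooth_on_coind _ _ _ [set f | exists2 psi, D' psi & f = psi \o glue]).
  - by move=> _ [g tg ->] x; apply: differentiable_rV1; exact: (glue_derive x tg).1.
  - move=> _ [g tg ->] i; exists (pderiv i g); first exact: test_pderiv.
    exact: glue_pderiv.
  - by exists psi.
move=> x xcl; apply: contrapT => xI.
suff [y [+ y0]] : [set y | (psi \o glue) y != 0] `&` [set y | psi (glue y) = 0] !=set0.
  by rewrite /= y0 eqxx.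
apply: xcl.
have [xa|xa|xa] := ltgtP (x ord0 ord0) a.
- have nI : ~ interior Omega' x.
    rewrite -(rV1_eta x) => /interior_cut_domain/(near_iff_nbhs (near_cut_lt S xa)).2.
    by move=> h; apply: xI; rewrite -(rV1_eta x); apply/nbhs_rV1.
  by apply: filterS2 (near_glue_lt xa) (test_near0 tpsi nI) => y /= ->.
- have nI : ~ interior Omega' (rV1 1 + x).
    rewrite (_ : rV1 1 + x = rV1 (x ord0 ord0 + 1)); last first.
      by apply/rowP => i; rewrite !mxE (ord1 i) addrC.
    have xa1 : a + 1 < x ord0 ord0 + 1 by rewrite ltrD2r.
    move=> /interior_cut_domain/(near_iff_nbhs (near_cut_gt S xa1)).2/nbhs_shift.
    by rewrite addrK => h; apply: xI; rewrite -(rV1_eta x); apply/nbhs_rV1.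
  by apply: filterS2 (near_glue_gt xa) (near_shift_rV1 (test_near0 tpsi nI)) => y /= ->.
- exact: near_glue_eq.
Qed.

(** Both integrals are split at [a]: the left parts agree, the right parts differ by a translation,
    and [psi] vanishes on the gap. *)
Lemma integral_glue psi : D' psi ->
  integral_rV (fun x => psi (glue x) ^+ 2) = integral_rV (fun x => psi x ^+ 2).
Proof.
move=> tpsi; have tg := test_glue tpsi.
have b1 : bsupp (fun x => psi (glue x) ^+ 2) := bsupp_sqr (test_bsupp cOmega tg).
have b2 : bsupp (fun x => psi x ^+ 2) := bsupp_sqr (test_bsupp cOmega' tpsi).
rewrite !integral_rV1//; pose H t := psi (rV1 t) ^+ 2.
have bH : bsupp1 H := bsupp1_rV1 b2.
have H0 t : 0 <= H t by exact: sqr_ge0.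
have Hgap t : a <= t <= a + 1 -> H t = 0.
  by move=> h; rewrite /H (nbhs_singleton (test_cut_near0 tpsi h)) expr0n.
have bI (i : interval R) : bsupp1 (fun t => H t * \1_[set` i] t).
  apply: (@bsupp1M _ H (\1_[set` i])) => //.
  by exists 1 => t; rewrite indicE; case: (_ \in _); rewrite ?normr1 ?normr0.
pose H1 t := H t * \1_(`]-oo, a]%classic) t; pose H2 t := H t * \1_(`]a, +oo[%classic) t.
have bH2 : bsupp1 (fun t => H2 (t + 1)).
  have [mH2 [B BP]] := bI `]a, +oo[; split.
    exact: (measurableT_comp mH2 (measurable_translate 1)).
  have B0 : 0 <= B by have [h _] := BP 0; exact: le_trans h.
  exists (B + 1) => t; have [h1 h2] := BP (t + 1); split; first by apply: le_trans h1 _; rewrite lerDl.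
  move=> Bt; apply: h2; have := ler_normB (t + 1) 1; rewrite addrK normr1; lra.
transitivity (integral_R (fun t => H1 t + H2 (t + 1))).
  congr integral_R; apply/funext => t; rewrite /glue rV1E /H1 /H2 !indicE.
  rewrite !mem_setE !in_itv/= andbT; have [ta|ta] := leP t a.
    rewrite mulr1 -/(H t) [X in _ = _ + X](_ : _ = 0) ?addr0//.
    have [ta1|ta1] := ltP a (t + 1); last by rewrite mulr0.
    by rewrite mulr1 Hgap// ltW//= lerD2r.
  have -> : (a < t + 1) = true by apply: lt_trans ta _; rewrite ltrDl.
  rewrite mulr0 add0r mulr1 /H; congr (psi _ ^+ 2).
  by apply/rowP => i; rewrite !mxE addrC.
rewrite integral_RD ?bI//; last exact: (bI `]-oo, a]).
rewrite (integral_R_translate 1 (bI `]a, +oo[)); last first.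
  by move=> t; rewrite mulr_ge0// indicE; case: (_ \in _).
rewrite -integral_RD; [|exact: (bI `]-oo, a])|exact: (bI `]a, +oo[)].
congr integral_R; apply/funext => t; rewrite /H1 !indicE !mem_setE !in_itv/= andbT.
by have [ta|ta] := leP t a; rewrite /= ?mulr1 ?mulr0 ?addr0 ?add0r.
Qed.

(** Composition with [glue] is linear and preserves norms and energies, hence all Rayleigh
    quotients. *)
Lemma energy_bounded_dim_glue x k :
  energy_bounded_dim D' (L2_inner Omega') (fun f : 'rV[R]_1 -> R => \- laplacian f) x k ->
  energy_bounded_dim D (L2_inner Omega) (fun f : 'rV[R]_1 -> R => \- laplacian f) x k.
Proof.
move=> h d /h[phi Dphi phiE]; exists (fun i => phi i \o glue).
  by move=> i; exact: test_glue.
move=> c c0 /=; have [] := phiE c c0; set v' := \sum_i c i *: phi i.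
have -> : \sum_i c i *: (phi i \o glue) = v' \o glue.
  by apply/funext => y; rewrite /= /v' !fct_sumE.
have tv' : D' v'.
  by apply: (psd_mem_sum (test_energy_psd_form cOmega')) => i; exact: Dphi.
have tv := test_glue tv'.
have -> : L2_inner Omega (v' \o glue) (v' \o glue) = L2_inner Omega' v' v'.
  by rewrite (L2_inner_sqr tv) (L2_inner_sqr tv') integral_glue.
have Ele : energy (L2_inner Omega) (fun f : 'rV[R]_1 -> R => \- laplacian f) (v' \o glue) (v' \o glue) <=
    energy (L2_inner Omega') (fun f : 'rV[R]_1 -> R => \- laplacian f) v' v'.
  apply: le_trans (_ : _ <= \sum_i integral_rV (fun x => pderiv i v' x ^+ 2)) _; last first.
    by rewrite le_eqVlt; apply/orP; left; apply/eqP/esym; exact: (test_energy_sqr cOmega' tv').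
  apply: le_trans (_ : _ <= \sum_i integral_rV (fun x => pderiv i (v' \o glue) x ^+ 2)) _.
    by rewrite le_eqVlt; apply/orP; left; apply/eqP; exact: (test_energy_sqr cOmega tv).
  apply: ler_sum => i _; rewrite glue_pderiv//.
  by rewrite integral_glue//; exact: test_pderiv.
by move=> v0 vE; split => //; exact: le_trans Ele vE.
Qed.

Lemma cut_domain_subspectral : dirichlet_subspectral Omega Omega'.
Proof.
move=> x; apply: counting_le_energy_bounded_dim => // k /energy_bounded_dim_glue.
exact: energy_bounded_dim_le_counting.
Qed.

End transplantation.

Lemma exists_nonembedded1 (R : realType) (Omega : set 'rV[R]_1) :
  normal_domain Omega ->
  exists Omega' : set 'rV[R]_1,
    [/\ normal_domain Omega', dirichlet_subspectral Omega Omega' &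
        ~ embeds_isometrically Omega' Omega].
Proof.
move=> nO; have [_ cO _ _] := nO; have [bs domS] := normal_domain_interval nO.
have [c cI] := normal_domain_interior nO; pose a := c ord0 ord0.
have Oa : nbhs (rV1 a) Omega by rewrite rV1_eta.
have Sa : nbhs a (rV1 @^-1` Omega) by move/nbhs_rV1 : Oa.
have domC := interval_domain_cut Sa domS.
have nO' : normal_domain (cut_domain Omega a) by exact: interval_normal_domain domC.
exists (cut_domain Omega a); split => //.
  by apply: cut_domain_subspectral => //; case: nO'.
move=> [f fiso]; have [_ cS _ _ bsP] := domS.
have := isometric_embedding_boundary domC domS erefl fiso (lebesgue_measure_cut a cS).
rewrite size_cut_boundary; first by rewrite addn2 ltnNge leqnSn.
by apply/negP => /bsP[_]; apply.
Qed.

Theorem mainTheorem9 (R : realType) (n : nat) (hn : (0 < n)%N)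
    (Omega : set 'rV[R]_n) (hOmega : normal_domain Omega) :
  exists Omega' : set 'rV[R]_n,
    [/\ normal_domain Omega',
        dirichlet_subspectral Omega Omega' &
        ~ embeds_isometrically Omega' Omega].
Proof.
case: n hn Omega hOmega => [//|[|n]] _ Omega nO.
- exact: exists_nonembedded1.
- exact: exists_nonembedded_ge2.
Qed.
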